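(* Let $k$ be a differential field which is a finitely generated differential extension of $\overline{\mathbb{Q}}$, with algebraically closed field of constants $C$. Let $[A]: Y'=AY$ with $A\in\mathrm{Mat}(n,k)$ be a linear differential system and let $\mathcal{M}:=(k^n,\nabla=\partial-A)$ be the associated differential module. Assume that the differential Galois group of $[A]$ is reductive and unimodular. Then the system $[A]$ is in reduced form if and only if every invariant $\phi\in\mathrm{Sym}(n\mathcal{M})^{\nabla}$ of the module has constant coefficients.
   Context: $(k,\partial)$ is a differential field of characteristic zero with algebraically closed constant field $C$. $K$ is a Picard-Vessiot extension of $k$ for $[A]$, $V\subset K^n$ is the $C$-vector space of solutions of $[A]$, $G=\mathrm{Aut}_\partial(K/k)\subset GL(V)$ is the differential Galois group and $\mathfrak{g}=\mathrm{Lie}(G)$. Unimodular means $G\subset SL(V)$. A choice of basis of $V$ represents $G$ in $GL_n(C)$ and $\mathfrak{g}$ in $\mathrm{Mat}(n,C)$; another basis gives conjugate representations. For a field $L\supseteq C$, $\mathfrak{g}(L)=\mathfrak{g}\otimes_C L\subset \mathrm{Mat}(n,L)$. Reduced form: $[A]$ is in reduced form when $A\in\mathfrak{g}(\overline{k})$, for the representation of $\mathfrak{g}$ given by some choice of basis of $V$. $n\mathcal{M}=\mathcal{M}\oplus\cdots\oplus\mathcal{M}$ ($n$ copies), with system matrix $A\oplus\cdots\oplus A$ (block diagonal), and $\mathrm{Sym}(n\mathcal{M})=\bigoplus_m \mathrm{Sym}^m(n\mathcal{M})$. For each $m$, $\mathrm{Const}=\mathrm{Sym}^m(n\,\cdot)$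 is a group morphism $M\mapsto \mathrm{Sym}^m(M\oplus\cdots\oplus M)$ on invertible $n\times n$ matrices (matrix of the induced action in the canonical basis), and $\mathfrak{const}$ is its linearization: $\mathrm{Const}(\mathrm{Id}+\varepsilon B)=\mathrm{Id}+\varepsilon\,\mathfrak{const}(B)$, $\varepsilon^2=0$. An invariant of the module in $\mathrm{Sym}^m(n\mathcal{M})^\nabla$ is a rational solution $\phi={}^t(\lambda_1,\dots,\lambda_N)\in k^N$ of $\phi'=\mathfrak{const}(A)\phi$; it has constant coefficients when $\lambda_i\in C$ for all $i$. *)

(* Defs.v *)
From HB Require Import structures.
From mathcomp Require Import all_boot all_order all_algebra all_field.
From mathcomp Require Import mpoly.

Set Implicit Arguments.
Unset Strict Implicit.
Unset Printing Implicit Defensive.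

Import GRing.Theory.
Local Open Scope ring_scope.

HB.mixin Record isDifferential F of GRing.Field F := {
  der : F -> F;
  derD : {morph der : x y / x + y};
  derM : forall x y, der (x * y) = der x * y + x * der y
}.

#[short(type="diffFieldType")]
HB.structure Definition DiffField := {F of GRing.Field F & isDifferential F}.

Section Constants.
Variable k : diffFieldType.

Definition is_constant : {pred k} := [pred x | der x == 0].

Lemma is_constant_divring : divring_closed is_constant.
Proof.
have d0 : der (0 : k) = 0.
  by apply: (addrI (der (0 : k))); rewrite -derD !addr0.
have d1 : der (1 : k) = 0.
  by apply: (addrI (der (1 : k))); rewrite addr0 -{3}[1](mulr1 1) derM mulr1 mul1r.
have dN (x : k) : der (- x) = - der x.
  by apply: (addrI (der x)); rewrite -derD !subrr.
split=> [|x y|x y]; rewrite !inE ?d1 //.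
  by move=> /eqP x0 /eqP y0; rewrite derD dN x0 y0 subrr.
move=> /eqP x0 /eqP y0; rewrite derM x0 mul0r add0r mulf_eq0.
have [->|ny] := eqVneq y 0; first by rewrite invr0 d0 eqxx orbT.
apply/orP; right; apply/eqP/(mulfI ny); rewrite mulr0.
by move: (derM y y^-1); rewrite divff // d1 y0 mul0r add0r.
Qed.

HB.instance Definition _ :=
  GRing.isDivringClosed.Build k is_constant is_constant_divring.

Record constants := Constant { const_val : k; _ : const_val \in is_constant }.

HB.instance Definition _ := [isSub for const_val].
HB.instance Definition _ := [Choice of constants by <:].
HB.instance Definition _ :=
  [SubChoice_isSubIntegralDomain of constants by <:].
HB.instance Definition _ := [SubIntegralDomain_isSubField of constants by <:].

End Constants.

Definition diff_morphism (k K : diffFieldType) (f : k -> K) : Prop :=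
  forall x, f (der x) = der (f x).

Definition subfield (K : fieldType) (P : K -> Prop) : Prop :=
  [/\ P 1, forall x y, P x -> P y -> P (x - y),
      forall x y, P x -> P y -> P (x * y) & forall x, P x -> P x^-1].

Definition diff_subfield (K : diffFieldType) (P : K -> Prop) : Prop :=
  subfield P /\ forall x, P x -> P (der x).

(* [algC] is the algebraic closure of the rationals; the only derivation it
   carries is 0.  Its embedding in [k] forces [k] to have characteristic 0. *)
Definition finitely_generated_over_Qbar (k : diffFieldType) : Prop :=
  exists j : {rmorphism algC -> k}, (forall a, der (j a) = 0) /\
  exists s : seq k, forall P : k -> Prop, diff_subfield P ->
    (forall a, P (j a)) -> (forall x, x \in s -> P x) -> forall x, P x.

Definition is_algebraic_closure (k : fieldType) (kbar : closedFieldType)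
    (ib : {rmorphism k -> kbar}) : Prop :=
  forall x, algebraicOver ib x.

Section AlgebraicGroups.
Variables (F : fieldType) (n : nat).
Implicit Types (G H X Y : 'M[F]_n -> Prop) (f : {mpoly F[n * n]}).

Definition entries_eval f (M : 'M[F]_n) : F := f.@[fun i => mxvec M 0 i].

Definition closed_in_GL X : Prop :=
  exists I : {mpoly F[n * n]} -> Prop, forall M,
    X M <-> M \in unitmx /\ forall f, I f -> entries_eval f M = 0.

Definition Zariski_connected H : Prop :=
  forall X Y, closed_in_GL X -> closed_in_GL Y ->
    (forall M, H M -> X M \/ Y M) -> (forall M, ~ [/\ H M, X M & Y M]) ->
    (forall M, H M -> X M) \/ (forall M, H M -> Y M).

Definition is_subgroup H : Prop :=
  [/\ forall M, H M -> M \in unitmx, H 1%:M,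
      forall M N, H M -> H N -> H (M *m N) & forall M, H M -> H (invmx M)].

Definition normal_in H G : Prop :=
  (forall M, H M -> G M) /\
  forall M N, G M -> H N -> H (invmx M *m N *m M).

Definition unipotent H : Prop :=
  forall M, H M -> exists e : nat, (M - 1%:M) ^+ e = 0.

Definition unipotent_radical G (M : 'M[F]_n) : Prop :=
  exists H, [/\ is_subgroup H, closed_in_GL H, Zariski_connected H,
                normal_in H G & unipotent H] /\ H M.

Definition reductive G : Prop :=
  forall M, unipotent_radical G M -> M = 1%:M.

(* The tangent space of [G] at the identity. *)
Definition Lie G (B : 'M[F]_n) : Prop :=
  forall f, (forall M, G M -> entries_eval f M = 0) ->
    \sum_(i < n * n) entries_eval f^`M(i) 1%:M * mxvec B 0 i = 0.

(* The image of [Lie G] (x) [L] in ['M[L]_n], for [L] an extension of [F]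
   along [h]. *)
Definition Lie_over (L : fieldType) (h : F -> L) G (A : 'M[L]_n) : Prop :=
  exists (r : nat) (B : 'I_r -> 'M[F]_n) (a : 'I_r -> L),
    (forall i, Lie G (B i)) /\ A = \sum_(i < r) a i *: map_mx h (B i).

End AlgebraicGroups.

Definition solution (k : diffFieldType) (N p : nat) (A : 'M[k]_N)
    (Y : 'M[k]_(N, p)) : Prop :=
  map_mx der Y = A *m Y.

Section Galois.
Variables (k K : diffFieldType) (iK : {rmorphism k -> K}).
Variables (n : nat) (A : 'M[k]_n).

Record is_Picard_Vessiot : Prop := IsPicardVessiot {
  PV_diff : diff_morphism iK;
  PV_constants : forall y : K, der y = 0 -> exists c : constants k, y = iK (val c);
  PV_generated : exists U : 'M[K]_n,
    [/\ U \in unitmx, solution (map_mx iK A) U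
      & forall P : K -> Prop, subfield P -> (forall x, P (iK x)) ->
          (forall i j, P (U i j)) -> forall y, P y]
}.

Definition const_to_K (c : constants k) : K := iK (val c).

(* The columns of [U] form a basis of the space of solutions in [K^n] over
   the field of constants. *)
Definition solution_basis (U : 'M[K]_n) : Prop :=
  solution (map_mx iK A) U /\
  forall v : 'cV[K]_n, solution (map_mx iK A) v ->
    exists! c : 'cV[constants k]_n, v = U *m map_mx const_to_K c.

(* The matrices, in the basis [U] of the solution space, of the differential
   automorphisms of [K] over [k]. *)
Definition Galois_group (U : 'M[K]_n) (M : 'M[constants k]_n) : Prop :=
  exists sigma : {rmorphism K -> K},
    [/\ bijective sigma, diff_morphism sigma,
        forall x, sigma (iK x) = iK x
      & map_mx sigma U = U *m map_mx const_to_K M].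

(* A change of basis conjugates [Galois_group U], so the next two properties
   do not depend on the basis; being in reduced form does. *)
Definition Galois_reductive : Prop :=
  exists U, solution_basis U /\ reductive (Galois_group U).

Definition Galois_unimodular : Prop :=
  exists U, solution_basis U /\ forall M, Galois_group U M -> \det M = 1.

Definition reduced_form (kbar : closedFieldType) (ib : {rmorphism k -> kbar}) :
    Prop :=
  exists U, solution_basis U /\
    Lie_over (fun c : constants k => ib (val c)) (Galois_group U)
      (map_mx ib A).

End Galois.

Definition Sym_index (N m : nat) : finType :=
  {mu : 'X_{1..N < m.+1} | mdeg mu == m}.

Definition Sym_dim (N m : nat) : nat := #|{: Sym_index N m}|.

Definition Sym_monomial N m (i : 'I_(Sym_dim N m)) : 'X_{1..N} :=
  bmnm (val (enum_val i)).

(* [Sym^m(R^N)] is the space of forms of degree [m] in the basis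
   ['X_0, ..., 'X_(N-1)] of [R^N], with basis the monomials; [M] sends ['X_l]
   to its [l]-th column. *)
Definition Sym_mx (R : comNzRingType) (N m : nat) (M : 'M[R]_N) :
    'M[R]_(Sym_dim N m) :=
  \matrix_(i, j)
    ('X_[R, Sym_monomial j] \mPo [tuple \sum_(h < N) M h l *: 'X_h | l < N])
      @_(Sym_monomial i).

Definition Const (R : comNzRingType) (n m : nat) (M : 'M[R]_n) :=
  Sym_mx m (\mxdiag_(i < n) M).

(* The coefficient of [eps] in [Const (1 + eps B)], with [eps := 'X]; only
   the class of this polynomial matrix modulo ['X^2] is used. *)
Definition const (k : fieldType) (n m : nat) (B : 'M[k]_n) :=
  map_mx (coefp 1) (Const m (1%:M + 'X *: map_mx polyC B)).

Definition Sym_invariant (k : diffFieldType) (n m : nat) (A : 'M[k]_n)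
    (phi : 'cV[k]_(Sym_dim (\sum_(i < n) n) m)) : Prop :=
  solution (const m A) phi.

Definition constant_coefficients (k : diffFieldType) (N : nat)
    (phi : 'cV[k]_N) : Prop :=
  forall i, phi i 0 \in @is_constant k.

(* Main.v *)
Require Import Defs.
From HB Require Import structures.
From mathcomp Require Import all_boot all_order all_algebra all_field.
From mathcomp Require Import fingroup perm mpoly boolp ring.
From mathcomp Require classical_sets.

Set Implicit Arguments.
Unset Strict Implicit.
Unset Printing Implicit Defensive.

Import GRing.Theory.
Local Open Scope ring_scope.

(* An element of [Sym^m (n M)] is a form [f] of degree [m] in the entries of an n x n
   matrix [Y] over [k], on which [M] acts by [f (Y M)]; it is an invariant of the module
   when [f' = df(Y) (Y A)], i.e. when [f (Y U^-1)] has constant coefficients, and then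
   [f (Y U^-1)] is an invariant of the Galois group [G].

   If [A] is reduced, every invariant of [G] is killed by [A], hence is a constant
   invariant of the module; the injection [f |-> f (Y U^-1)] preserves degrees, so these
   are all the invariants of the module.

   Conversely, if invariants are constant then [v (N U)] is constant for every invariant
   [v] of [G] and every constant matrix [N], because [K^G = k].  The Nullstellensatz
   yields a constant invertible [P0] with [v (N U) = v (N P0)].  Since [G] is reductive
   and unimodular, each weight of a semi-invariant has an inverse that is also a weight,
   so semi-invariants [a] satisfy [a (N U) = h a (N P0)] with [h] depending on the weight
   only.  The determinants of a basis of the bounded part of the ideal of [G] are
   semi-invariants; this makes the ideal of [G] vanish on [P0^-1 A P0] to first order, so
   that [A] is reduced in the basis [U P0^-1].

   The inverse of a weight is obtained without representation theory: the trace form on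
   [Lie G] is nondegenerate, as its radical would exponentiate to a unipotent normal
   subgroup; the differential of the weight is therefore represented by a central element,
   semisimple with rational eigenvalues, whose spectral projections provide determinants
   with which a power of the semi-invariant can be balanced to a weight of finite order. *)

(** * Replicas of linear operators *)


(** One copy of the module becomes one row of [Y], so right multiplication treats the [n] copies
    alike, and the forms are polynomial functions on all [n] x [n] matrices: enough of them to see
    the equations of [G]. Only symmetric powers are at hand, no duals, so the weight of a
    semi-invariant has to be cancelled by another polynomial; for the multiplicative group in
    dimension 1 no such polynomial exists. Unimodularity supplies it: scalar matrices are orthogonal
    to [Lie G] for the trace form, so rational exponents can be shifted until they are natural
    numbers. Reductivity is given as triviality of the unipotent radical, hence the detour through
    traces and exponentials. Spaces of polynomials have infinite dimension, but translations
    preserve degrees; instead of restricting an operator to a subspace, one writes its effect on a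
    vector as that of a polynomial in another operator. *)

Section PolyOperator.
Variables (F : fieldType) (V : lmodType F).
Implicit Types (T : {linear V -> V}) (p q : {poly F}) (v : V) (a : F).

Definition papply T q v : V := \sum_(j < size q) q`_j *: iter j T v.

Lemma papplyE T q v m : (size q <= m)%N ->
  papply T q v = \sum_(j < m) q`_j *: iter j T v.
Proof.
move=> qm; rewrite /papply (big_ord_widen m (fun j => q`_j *: iter j T v) qm).
rewrite big_mkcond; apply: eq_bigr => j _; case: ltnP => // /(nth_default 0) ->.
by rewrite scale0r.
Qed.

Lemma papplyD T p q v : papply T (p + q) v = papply T p v + papply T q v.
Proof.
rewrite (papplyE T v (size_polyD p q)) (papplyE T v (leq_maxl (size p) (size q))).
rewrite (papplyE T v (leq_maxr (size p) (size q))) -big_split.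
by apply: eq_bigr => j _; rewrite coefD scalerDl.
Qed.

Lemma papplyC T a v : papply T a%:P v = a *: v.
Proof. by rewrite (papplyE T v (size_polyC_leq1 a)) big_ord1 coefC. Qed.

Lemma papplyCM T a q v : papply T (a%:P * q) v = a *: papply T q v.
Proof.
rewrite mul_polyC (papplyE T v (size_scale_leq a q)) scaler_sumr.
by apply: eq_bigr => j _; rewrite coefZ scalerA.
Qed.

Lemma papplyMX T q v : papply T (q * 'X) v = papply T q (T v).
Proof.
have le : (size (q * 'X)%R <= (size q).+1)%N.
  by apply: leq_trans (size_polyMleq _ _) _; rewrite size_polyX addn2.
rewrite (papplyE T v le) big_ord_recl coefMX eqxx scale0r add0r.
by apply: eq_bigr => j _; rewrite coefMX /= -iterSr.
Qed.

Lemma papply_comm T q v : papply T q (T v) = T (papply T q v).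
Proof. by rewrite linear_sum; apply: eq_bigr => j _; rewrite linearZ /= -iterSr. Qed.

Lemma papplyM T p q v : papply T (p * q) v = papply T p (papply T q v).
Proof.
elim/poly_ind: p v => [|p c IHp] v.
  by rewrite mul0r -[0]/(0%:P) !papplyC !scale0r.
rewrite mulrDl !papplyD papplyCM papplyC; congr (_ + _).
by rewrite -mulrA ['X * q]mulrC mulrA !papplyMX IHp papply_comm.
Qed.

Lemma papply_is_linear T q : linear (papply T q).
Proof.
have iterL j a u v : iter j T (a *: u + v) = a *: iter j T u + iter j T v.
  by elim: j => //= j ->; rewrite linearP.
move=> a u v; rewrite scaler_sumr -big_split; apply: eq_bigr => j _.
by rewrite iterL scalerDr !scalerA mulrC.
Qed.
HB.instance Definition _ T q :=
  GRing.isLinear.Build F V V *:%R (papply T q) (papply_is_linear T q).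

Definition geneig T a v := exists m, papply T (('X - a%:P) ^+ m) v = 0.

Lemma papplyXsub T a v : papply T ('X - a%:P) v = T v - a *: v.
Proof.
by rewrite papplyD -polyCN papplyC scaleNr -['X]mul1r papplyMX papplyC scale1r.
Qed.

Lemma papply_eigen T a q v : T v = a *: v -> papply T q v = q.[a] *: v.
Proof.
move=> Tv; elim/poly_ind: q => [|q c IHq]; first by rewrite horner0 -[0]/(0%:P) papplyC.
by rewrite papplyD papplyC papplyMX Tv linearZ /= IHq scalerA hornerMXaddC scalerDl mulrC.
Qed.

Lemma papply_geneig T a c m q v : ('X - a%:P) ^+ m %| q - c%:P ->
  papply T (('X - a%:P) ^+ m) v = 0 -> papply T q v = c *: v.
Proof.
move=> /dvdpP[u] /(canRL (subrK _)) -> v0.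
by rewrite papplyD papplyM v0 linear0 add0r papplyC.
Qed.

End PolyOperator.

Lemma interpolation (F : fieldType) (s : seq F) (m : nat) (c : F -> F) :
  exists q : {poly F}, forall a, a \in s -> ('X - a%:P) ^+ m %| q - (c a)%:P.
Proof.
elim: s => [|b s [q qP]]; first by exists 0.
have [bs|bs] := boolP (b \in s).
  by exists q => a; rewrite inE => /orP[/eqP->|]; exact: qP.
pose e := \prod_(a <- s) ('X - a%:P) ^+ m.
have cop : coprimep (('X - b%:P) ^+ m) e.
  rewrite /e; elim: (s) bs => [|a t IHt]; first by rewrite big_nil coprimep1.
  rewrite inE negb_or big_cons coprimepMr => /andP[ba /IHt ->]; rewrite andbT.
  apply: coprimep_expl; apply: coprimep_expr.
  by rewrite coprimep_XsubC root_XsubC eq_sym.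
have [[u v] /= uv] := Bezout_eq1_coprimepP _ _ cop.
(* [v * e] is 1 modulo the new modulus and 0 modulo the others, so the correction changes only the
   residue at [b]. *)
exists (q + ((c b)%:P - q) * (v * e)) => a; rewrite inE => /orP[/eqP->|ains].
  apply/dvdpP; exists ((q - (c b)%:P) * u).
  have -> : v * e = 1 - u * ('X - b%:P) ^+ m by rewrite -uv addrC addKr.
  move: (_ ^+ m) (c b)%:P => p d; ring.
rewrite addrAC dvdp_add ?qP // mulrA dvdp_mull //.
by rewrite /e (big_rem a) //= dvdp_mulIl.
Qed.

Section Replica.
Variables (F : fieldType) (V : lmodType F) (T S : {linear V -> V}).
Variables (I : eqType) (r : seq I) (xi : I -> V) (mu psi : I -> F).
Hypothesis mu_geneig : forall i, geneig T (mu i) (xi i).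
Hypothesis psi_eigen : forall i, S (xi i) = psi i *: xi i.
Hypothesis mu_psi : {in r &, forall i j, mu i = mu j -> psi i = psi j}.
Variables (f : V) (c : I -> F).
Hypothesis f_dec : f = \sum_(i <- r) c i *: xi i.

(** The list [r] is finite, so one exponent [m] annihilates all the [xi i], and a polynomial
    congruent to [g (mu i)] modulo the power [m] of ['X - mu i] acts on [xi i] as that scalar. The
    points of [s] need not be eigenvalues; [m] is taken positive so that the congruence fixes the
    value of [q] there. *)
Lemma papply_interpolation (s : seq F) (g : F -> F) :
  exists q : {poly F}, {in s, forall a, q.[a] = g a} /\
    papply T q f = \sum_(i <- r) c i *: (g (mu i) *: xi i).
Proof.
have [m m_gt0 mP] : exists2 m, (0 < m)%N &
    all (fun i => papply T (('X - (mu i)%:P) ^+ m) (xi i) == 0) r.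
  elim: r => [|i t [m m0 IHt]]; first by exists 1.
  have [m' m'P] := mu_geneig i; exists (m + m')%N; first by rewrite addn_gt0 m0.
  rewrite /= exprD papplyM m'P linear0 eqxx /=.
  apply: sub_all IHt => j /eqP jm.
  by rewrite addnC exprD papplyM jm linear0.
have [q qP] := interpolation ([seq mu i | i <- r] ++ s) m g.
exists q; split=> [a ains|].
  have /(_ a) := qP; rewrite mem_cat ains orbT => /(_ isT) dv.
  have : ('X - a%:P) %| q - (g a)%:P.
    by apply: dvdp_trans dv; rewrite -(prednK m_gt0) exprS dvdp_mulIl.
  by rewrite dvdp_XsubCl rootE !hornerE subr_eq0 => /eqP.
rewrite f_dec linear_sum; apply: eq_big_seq => i ir.
rewrite linearZ /=; congr (_ *: _); apply: papply_geneig (eqP (allP mP i ir)).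
by apply: qP; rewrite mem_cat map_f.
Qed.

Let val_psi : exists g, {in r, forall i, g (mu i) = psi i}.
Proof.
exists (fun a => if pselect (exists2 i, i \in r & a = mu i) is left e
  then psi (s2val (cid2 e)) else 0) => i ir.
case: pselect => [e|[]]; last by exists i.
by case: cid2 => j /= jr /esym/mu_psi ->.
Qed.

(* [S] acts on [f] as a polynomial in [T], so it preserves every [T]-stable subspace
   containing [f]. *)
Lemma replica_poly : exists q : {poly F}, S f = papply T q f.
Proof.
have [g gP] := val_psi; have [q [_ qf]] := papply_interpolation [::] g.
exists q; rewrite qf {1}f_dec linear_sum; apply: eq_big_seq => i ir.
by rewrite linearZ /= psi_eigen gP.
Qed.

Lemma replica_eigen a : f != 0 -> T f = a *: f ->
  exists2 i, i \in r & a = mu i /\ S f = psi i *: f.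
Proof.
move=> f0 Tf; have [[i ir ai]|nai] := pselect (exists2 i, i \in r & a = mu i).
  exists i => //; split=> //; have [g gP] := val_psi.
  have [q [qa qf]] := papply_interpolation [:: a] g.
  have -> : S f = papply T q f.
    rewrite qf {1}f_dec linear_sum; apply: eq_big_seq => j jr.
    by rewrite linearZ /= psi_eigen gP.
  by rewrite (papply_eigen _ Tf) qa ?inE // ai gP.
(* If [a] were none of the [mu i], a polynomial equal to 1 at [a] and to 0 at each [mu i] would send
   [f] both to itself and to 0. *)
have [q [qa qf]] := papply_interpolation [:: a] (fun b => (b == a)%:R).
case/eqP: f0; move: qf; rewrite (papply_eigen _ Tf) qa ?inE // eqxx scale1r => ->.
rewrite big1_seq // => i /= ir; case: eqP => [e|_]; last by rewrite scale0r scaler0.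
by case: nai; exists i.
Qed.

End Replica.

(** * Polynomials in the entries of a matrix *)


Section ChainRule.
Variables (R S : comNzRingType) (h : {rmorphism R -> S}).
Variables (d : {additive R -> R}) (delta : {additive S -> S}).
Hypothesis deltaM : forall x y, delta (x * y) = delta x * y + x * delta y.
Hypothesis delta_h : forall c, delta (h c) = h (d c).
Variables (N : nat) (v : 'I_N -> S).

Lemma mmap_chain (f : {mpoly R[N]}) :
  delta (mmap h v f) = mmap h v (map_mpoly d f)
    + \sum_i mmap h v f^`M(i) * delta (v i).
Proof.
pose D (p : {mpoly R[N]}) := \sum_i mmap h v p^`M(i) * delta (v i).
have delta1 : delta 1 = 0.
  by apply: (addrI (delta 1)); rewrite addr0 -{3}[1]mulr1 deltaM mulr1 mul1r.
have DM p q : D (p * q) = D p * mmap h v q + mmap h v p * D q.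
  rewrite mulr_suml mulr_sumr -big_split; apply: eq_bigr => i _.
  by rewrite mderivM rmorphD !rmorphM /=; ring.
have DX m : delta (mmap h v 'X_[m]) = D 'X_[m].
  rewrite mpolyXE_id; pose Q p := delta (mmap h v p) = D p; rewrite -/(Q _).
  have Q1 : Q 1.
    by rewrite /Q rmorph1 delta1 /D big1 // => i _; rewrite -mpolyC1 mderivC rmorph0 mul0r.
  have QM p q : Q p -> Q q -> Q (p * q).
    by rewrite /Q rmorphM deltaM DM => -> ->.
  apply: big_ind => // i _; elim: (m i) => [|e IHe]; first by rewrite expr0.
  rewrite exprS; apply: QM => //; rewrite /Q mmapX mmap1U /D (bigD1 i) //=.
  rewrite mderivX mnmE eqxx scale1r.
  rewrite (_ : (U_(i) - U_(i))%MM = 0%MM) ?mpolyX0; last first.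
    by apply/mnmP => j; rewrite !mnmE subnn.
  rewrite rmorph1 mul1r big1 ?addr0 // => j ji.
  by rewrite mderivX mnmE eq_sym (negPf ji) scale0r rmorph0 mul0r.
rewrite -/(D f); elim/mpolyind: f => [|c m f _ _ IHf].
  by rewrite !raddf0 add0r /D big1 // => i _; rewrite linear0 rmorph0 mul0r.
have DD p q : D (p + q) = D p + D q.
  by rewrite /D -big_split; apply: eq_bigr => i _; rewrite linearD rmorphD mulrDl.
rewrite DD mmapD !raddfD /= IHf addrACA; congr (_ + _).
have Dc : D c%:MP = 0 by rewrite /D big1 // => i _; rewrite mderivC rmorph0 mul0r.
have -> : map_mpoly d (c *: 'X_[m]) = (d c) *: 'X_[m].
  apply/mpolyP => m'; rewrite mcoeff_map_mpoly !mcoeffZ !mcoeffX.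
  by case: eqP; rewrite ?mulr1 ?mulr0 ?raddf0.
rewrite -!mul_mpolyC !rmorphM deltaM /= !mmapC delta_h DX DM Dc.
by rewrite mul0r add0r mmapC.
Qed.
End ChainRule.

Lemma eq_mmap (R S : comNzRingType) (h h' : R -> S) N (v v' : 'I_N -> S) f :
  h =1 h' -> v =1 v' -> mmap h v f = mmap h' v' f.
Proof.
move=> hh vv; rewrite /mmap; apply: eq_bigr => m _; rewrite hh; congr (_ * _).
by apply: eq_bigr => i _; rewrite vv.
Qed.

Lemma rmorph_mmap (R S T : comNzRingType) (h : R -> S) (g : {rmorphism S -> T})
    N (v : 'I_N -> S) f :
  g (mmap h v f) = mmap (g \o h) (g \o v) f.
Proof.
rewrite /mmap rmorph_sum; apply: eq_bigr => m _; rewrite rmorphM.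
by congr (_ * _); rewrite rmorph_prod; apply: eq_bigr => i _; rewrite rmorphXn.
Qed.

Lemma mmap_map_mpoly (R S T : comNzRingType) (h : {rmorphism R -> S})
    (g : {rmorphism S -> T}) N (v : 'I_N -> T) f :
  mmap g v (map_mpoly h f) = mmap (g \o h) v f.
Proof.
rewrite /map_mpoly rmorph_mmap; apply: eq_mmap => [c|i] /=; first exact: mmapC.
by rewrite mmapX mmap1U.
Qed.

Lemma rmorph_mpoly (R S : comNzRingType) N (g : {rmorphism {mpoly R[N]} -> S}) f :
  g f = mmap (g \o @mpolyC N R) (fun i => g 'X_i) f.
Proof.
rewrite -[f in LHS](comp_mpoly_id f) /comp_mpoly rmorph_mmap.
by apply: eq_mmap => // i /=; rewrite tnth_mktuple.
Qed.

Lemma eq_rmorph_mpoly (R S : comNzRingType) N (g g' : {rmorphism {mpoly R[N]} -> S}) :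
  (forall c, g c%:MP = g' c%:MP) -> (forall i, g 'X_i = g' 'X_i) -> g =1 g'.
Proof. by move=> gC gX f; rewrite (rmorph_mpoly g) (rmorph_mpoly g'); exact: eq_mmap. Qed.

Section LastVariable.
Variables (R : comNzRingType) (N : nat).
Implicit Types (f : {mpoly R[N.+1]}) (p : {poly {mpoly R[N]}}).

Definition mjoin p : {mpoly R[N.+1]} :=
  (map_poly (mmap (@mpolyC N.+1 R) (fun i => 'X_(widen_ord (leqnSn N) i))) p).['X_ord_max].

Lemma mjoin_is_monoid_morphism : monoid_morphism mjoin.
Proof. by split=> [|p q]; rewrite /mjoin ?rmorph1 ?hornerC // rmorphM hornerM. Qed.
Lemma mjoin_is_zmod_morphism : zmod_morphism mjoin.
Proof. by move=> p q; rewrite /mjoin rmorphB !hornerE. Qed.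
HB.instance Definition _ :=
  GRing.isZmodMorphism.Build {poly {mpoly R[N]}} {mpoly R[N.+1]} mjoin mjoin_is_zmod_morphism.
HB.instance Definition _ :=
  GRing.isMonoidMorphism.Build {poly {mpoly R[N]}} {mpoly R[N.+1]} mjoin mjoin_is_monoid_morphism.

Definition msplit f : {poly {mpoly R[N]}} :=
  mmap (polyC \o @mpolyC N R)
    (fun i => if unlift ord_max i is Some j then ('X_j)%:P else 'X) f.
Lemma msplit_is_monoid_morphism : monoid_morphism msplit.
Proof. by rewrite /msplit; split=> [|p q]; rewrite ?rmorph1 ?rmorphM. Qed.
Lemma msplit_is_zmod_morphism : zmod_morphism msplit.
Proof. by move=> p q; rewrite /msplit rmorphB. Qed.
HB.instance Definition _ :=
  GRing.isZmodMorphism.Build {mpoly R[N.+1]} {poly {mpoly R[N]}} msplit msplit_is_zmod_morphism.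
HB.instance Definition _ :=
  GRing.isMonoidMorphism.Build {mpoly R[N.+1]} {poly {mpoly R[N]}} msplit msplit_is_monoid_morphism.

Lemma msplitK : cancel msplit mjoin.
Proof.
move=> f; apply: (eq_rmorph_mpoly (g := mjoin \o msplit) (g' := idfun)) => [c|i] /=.
  by rewrite /msplit mmapC /= /mjoin map_polyC hornerC /= mmapC.
rewrite /msplit mmapX mmap1U /mjoin; case: unliftP => [j|] ->.
  rewrite map_polyC hornerC /= mmapX mmap1U; congr 'X__.
  by apply/val_inj; rewrite /= /bump leqNgt ltn_ord.
by rewrite map_polyX hornerX.
Qed.

Lemma mmap_mjoin (S : comNzRingType) (h : {rmorphism R -> S}) (v : 'I_N.+1 -> S) p :
  mmap h v (mjoin p) =
  (map_poly (mmap h (fun i => v (widen_ord (leqnSn N) i))) p).[v ord_max].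
Proof.
rewrite /mjoin -horner_map /= mmapX mmap1U -map_poly_comp; congr (_.[_]).
apply: eq_map_poly => f /=; rewrite rmorph_mmap; apply: eq_mmap => [c|i] /=.
  by rewrite mmapC.
by rewrite mmapX mmap1U.
Qed.

End LastVariable.

Lemma natr_inj (R : idomainType) :
  [pchar R] =i pred0 -> injective (fun j : nat => j%:R : R).
Proof.
move=> R0; have aux i j : (i <= j)%N -> i%:R = j%:R :> R -> i = j.
  move=> ij /eqP; rewrite eq_sym -subr_eq0 -natrB // (pcharf0P _).1 // subn_eq0.
  by move=> ji; apply/eqP; rewrite eqn_leq ij.
by move=> i j; case: (leqP i j) => [/aux//|/ltnW/aux e] /esym/e/esym.
Qed.

Lemma poly_natroots (R : idomainType) (p : {poly R}) :
  [pchar R] =i pred0 -> (forall j : nat, p.[j%:R] = 0) -> p = 0.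
Proof.
move=> R0 p0; apply: (roots_geq_poly_eq0 (rs := [seq j%:R | j <- iota 0 (size p)])).
- by apply/allP => _ /mapP[j _ ->]; rewrite rootE p0.
- by rewrite map_inj_uniq ?iota_uniq //; exact: natr_inj.
- by rewrite size_map size_iota.
Qed.

Lemma mpoly_natroots (F : fieldType) N (f : {mpoly F[N]}) :
  [pchar F] =i pred0 -> (forall v : 'I_N -> nat, f.@[fun i => (v i)%:R] = 0) -> f = 0.
Proof.
move=> F0; elim: N f => [|N IHN] f f0.
  have := f0 (fun=> 0%N); rewrite (_ : f = (f@_0)%:MP) ?mevalC => [->|]; first by rewrite mpolyC0.
  apply/mpolyP => m; rewrite mcoeffC (_ : m = 0%MM) ?eqxx ?mulr1 //.
  by apply/mnmP => -[].
rewrite -[f]msplitK (_ : msplit f = 0) ?rmorph0 //.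
apply/polyP => j; rewrite coef0; apply: IHN => v.
suff /(congr1 (fun p : {poly F} => p`_j)) :
    map_poly (meval (fun i => (v i)%:R)) (msplit f) = 0 by rewrite coef_map coef0.
apply: poly_natroots => // t.
pose w (i : 'I_N.+1) := if unlift ord_max i is Some j then v j else t.
have := f0 w; rewrite -{1}[f]msplitK /meval mmap_mjoin /w unlift_none => <-.
congr (_.[_]); apply: eq_map_poly => g; apply: eq_mmap => // i.
have -> : widen_ord (leqnSn N) i = lift ord_max i.
  by apply/val_inj; rewrite /= /bump leqNgt ltn_ord.
by rewrite liftK.
Qed.

Section MatrixEvaluation.
Variables (R S : comNzRingType) (n : nat).

(* [mev h M f] is the value at [M] of [f], with coefficients mapped by [h]; [dmev] is
   the derivative of [f] at [M] along [B]. *)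
Definition mev (h : R -> S) (M : 'M[S]_n) (f : {mpoly R[n * n]}) : S :=
  mmap h (fun i => mxvec M 0 i) f.

Definition gmx : 'M[{mpoly R[n * n]}]_n := vec_mx (\row_i 'X_i).

Lemma eq_mev (h h' : R -> S) M f : h =1 h' -> mev h M f = mev h' M f.
Proof. by move=> hh; apply: eq_mmap. Qed.

Section Morphism.
Variables (h : {rmorphism R -> S}) (M : 'M[S]_n).

Lemma mev_is_monoid_morphism : monoid_morphism (mev h M).
Proof. by rewrite /mev; split=> [|p q]; rewrite ?rmorph1 ?rmorphM. Qed.
Lemma mev_is_zmod_morphism : zmod_morphism (mev h M).
Proof. by move=> p q; rewrite /mev rmorphB. Qed.
HB.instance Definition _ :=
  GRing.isZmodMorphism.Build {mpoly R[n * n]} S (mev h M) mev_is_zmod_morphism.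
HB.instance Definition _ :=
  GRing.isMonoidMorphism.Build {mpoly R[n * n]} S (mev h M) mev_is_monoid_morphism.

Lemma mevC c : mev h M c%:MP = h c. Proof. exact: mmapC. Qed.
Lemma mevX i : mev h M 'X_i = mxvec M 0 i. Proof. by rewrite /mev mmapX mmap1U. Qed.
Lemma mevZ c f : mev h M (c *: f) = h c * mev h M f.
Proof. by rewrite -mul_mpolyC rmorphM /= mevC. Qed.
Lemma map_gmx : map_mx (mev h M) gmx = M.
Proof.
apply: (can_inj mxvecK); rewrite -map_mxvec vec_mxK.
by apply/rowP => i; rewrite !mxE mevX.
Qed.
Lemma map_mevC m p (N : 'M[R]_(m, p)) :
  map_mx (mev h M) (map_mx (@mpolyC _ _) N) = map_mx h N.
Proof. by apply/matrixP => i j; rewrite !mxE mevC. Qed.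

Definition dmev (B : 'M[S]_n) (f : {mpoly R[n * n]}) : S :=
  \sum_i mev h M f^`M(i) * mxvec B 0 i.

Lemma dmevM B f g : dmev B (f * g) = dmev B f * mev h M g + mev h M f * dmev B g.
Proof.
rewrite mulr_suml mulr_sumr -big_split; apply: eq_bigr => i _.
by rewrite mderivM rmorphD !rmorphM /=; ring.
Qed.

Lemma dmevC B c : dmev B c%:MP = 0.
Proof. by rewrite /dmev big1 // => i _; rewrite mderivC rmorph0 mul0r. Qed.

Lemma dmevD B f g : dmev B (f + g) = dmev B f + dmev B g.
Proof. by rewrite /dmev -big_split; apply: eq_bigr => i _; rewrite linearD rmorphD mulrDl. Qed.

Lemma dmevZ B c f : dmev B (c *: f) = h c * dmev B f.
Proof. by rewrite -mul_mpolyC dmevM dmevC mul0r add0r mevC. Qed.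

Lemma dmev_linear f : scalar (dmev^~ f).
Proof.
move=> a B B'; rewrite mulr_sumr -big_split; apply: eq_bigr => i _.
by rewrite linearP !mxE mulrDr mulrCA.
Qed.

End Morphism.
End MatrixEvaluation.
Arguments gmx {R n}.
Arguments mev : simpl never.
Arguments dmev : simpl never.

Lemma rmorph_mev (R S T : comNzRingType) (h : R -> S) (g : {rmorphism S -> T}) n
    (M : 'M[S]_n) f :
  g (mev h M f) = mev (g \o h) (map_mx g M) f.
Proof. by rewrite /mev rmorph_mmap; apply: eq_mmap => // i; rewrite /= -map_mxvec mxE. Qed.

Lemma mev_map_mpoly (R S T : comNzRingType) (h : {rmorphism R -> S})
    (g : {rmorphism S -> T}) n (M : 'M[T]_n) f :
  mev g M (map_mpoly h f) = mev (g \o h) M f.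
Proof. exact: mmap_map_mpoly. Qed.

Lemma mev_chain (R S : comNzRingType) (h : {rmorphism R -> S})
    (d : {additive R -> R}) (delta : {additive S -> S}) n (M : 'M[S]_n) f :
  (forall x y, delta (x * y) = delta x * y + x * delta y) ->
  (forall c, delta (h c) = h (d c)) ->
  delta (mev h M f) = mev h M (map_mpoly d f) + dmev h M (map_mx delta M) f.
Proof.
move=> dM dh; rewrite /mev (mmap_chain dM dh); congr (_ + _).
by apply: eq_bigr => i _; rewrite -map_mxvec mxE.
Qed.

Lemma mev_taylor0 (R S : comNzRingType) (h : {rmorphism R -> S}) n (M B : 'M[S]_n) f :
  (mev (polyC \o h) (map_mx polyC M + 'X *: map_mx polyC B) f)`_0 = mev h M f.
Proof.
rewrite -horner_coef0 -[LHS]/(horner_eval 0 _) rmorph_mev /=.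
rewrite (@eq_mev _ _ _ _ h) => [|c /=]; last by rewrite /horner_eval hornerC.
by congr (mev _ _ _); apply/matrixP => i j; rewrite !mxE /horner_eval !hornerE.
Qed.

Lemma mev_taylor1 (R S : comNzRingType) (h : {rmorphism R -> S}) n (M B : 'M[S]_n) f :
  (mev (polyC \o h) (map_mx polyC M + 'X *: map_mx polyC B) f)`_1 = dmev h M B f.
Proof.
have -> (p : {poly S}) : p`_1 = (deriv p)`_0 by rewrite coef_deriv mulr1n.
have dM (x y : {poly S}) : deriv (x * y) = deriv x * y + x * deriv y.
  exact: derivM.
rewrite (mev_chain (d := (GRing.null_fun R)) _ _ dM) => [|c]; last first.
  by rewrite /= derivC raddf0.
have -> : map_mpoly (GRing.null_fun R) f = 0.
  by apply/mpolyP => m; rewrite mcoeff_map_mpoly mcoeff0.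
rewrite rmorph0 add0r coef_sum; apply: eq_bigr => i _.
rewrite coefM big_ord1 mev_taylor0; congr (_ * _).
rewrite -map_mxvec mxE; case/mxvec_indexP: i => i j; rewrite mxvecE.
rewrite !mxE /= derivD derivC add0r derivM derivC derivX mulr0 addr0 mul1r.
by rewrite coefC mxvecE.
Qed.

(* For a polynomial [f] in the entries of [X], [Rm x f] is [f (X x)], [Lm x f] is
   [f (x X)], and [Dm x f] is the derivative of [f] at [X] along [X x].  They are
   locked because unification otherwise unfolds them down to [mmap]. *)
HB.lock Definition Rm (F : fieldType) n (x : 'M[F]_n) (f : {mpoly F[n * n]}) : {mpoly F[n * n]} :=
  mev (@mpolyC _ F) (gmx *m map_mx (@mpolyC _ F) x) f.
HB.lock Definition Lm (F : fieldType) n (x : 'M[F]_n) (f : {mpoly F[n * n]}) : {mpoly F[n * n]} :=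
  mev (@mpolyC _ F) (map_mx (@mpolyC _ F) x *m gmx) f.
HB.lock Definition Dm (F : fieldType) n (x : 'M[F]_n) (f : {mpoly F[n * n]}) : {mpoly F[n * n]} :=
  dmev (@mpolyC _ F) gmx (gmx *m map_mx (@mpolyC _ F) x) f.

Arguments Rm {F n} x f.
Arguments Lm {F n} x f.
Arguments Dm {F n} x f.

Section Translations.
Variables (F : fieldType) (n : nat).
Local Notation Pol := {mpoly F[n * n]}.
Local Notation mC := (@mpolyC (n * n) F).
Implicit Types (x y : 'M[F]_n) (f g : Pol).

Lemma Rm_is_monoid_morphism x : monoid_morphism (Rm x).
Proof. by rewrite unlock; split=> [|p q]; rewrite ?rmorph1 ?rmorphM. Qed.
Lemma Rm_is_linear x : linear (Rm x).
Proof. by move=> a f g; rewrite unlock rmorphD /= mevZ mul_mpolyC. Qed.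
HB.instance Definition _ x :=
  GRing.isLinear.Build F Pol Pol *:%R (Rm x) (Rm_is_linear x).
HB.instance Definition _ x :=
  GRing.isMonoidMorphism.Build Pol Pol (Rm x) (Rm_is_monoid_morphism x).

Lemma Lm_is_monoid_morphism x : monoid_morphism (Lm x).
Proof. by rewrite unlock; split=> [|p q]; rewrite ?rmorph1 ?rmorphM. Qed.
Lemma Lm_is_linear x : linear (Lm x).
Proof. by move=> a f g; rewrite unlock rmorphD /= mevZ mul_mpolyC. Qed.
HB.instance Definition _ x :=
  GRing.isLinear.Build F Pol Pol *:%R (Lm x) (Lm_is_linear x).
HB.instance Definition _ x :=
  GRing.isMonoidMorphism.Build Pol Pol (Lm x) (Lm_is_monoid_morphism x).

Lemma Dm_is_linear x : linear (Dm x).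
Proof. by move=> a f g; rewrite unlock dmevD dmevZ mul_mpolyC. Qed.
HB.instance Definition _ x :=
  GRing.isLinear.Build F Pol Pol *:%R (Dm x) (Dm_is_linear x).

Lemma mev_id_mC : mev mC gmx =1 id.
Proof.
apply: (eq_rmorph_mpoly (g := mev mC gmx) (g' := idfun)) => [c|i].
  by rewrite /= mevC.
by rewrite /= mevX vec_mxK mxE.
Qed.

Lemma DmM x f g : Dm x (f * g) = Dm x f * g + f * Dm x g.
Proof. by rewrite unlock dmevM !mev_id_mC. Qed.

Lemma Dm_linear f : linear (Dm^~ f).
Proof.
move=> a x y; rewrite unlock map_mxD map_mxZ mulmxDr -scalemxAr.
by rewrite dmev_linear mul_mpolyC.
Qed.

Section Eval.
Variables (S : comNzRingType) (h : {rmorphism F -> S}) (M : 'M[S]_n).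

Lemma mev_Rm x f : mev h M (Rm x f) = mev h (M *m map_mx h x) f.
Proof.
rewrite unlock rmorph_mev map_mxM map_gmx map_mevC.
by apply: eq_mev => c /=; rewrite mevC.
Qed.

Lemma mev_Lm x f : mev h M (Lm x f) = mev h (map_mx h x *m M) f.
Proof.
rewrite unlock rmorph_mev map_mxM map_gmx map_mevC.
by apply: eq_mev => c /=; rewrite mevC.
Qed.

Lemma mev_Dm x f : mev h M (Dm x f) = dmev h M (M *m map_mx h x) f.
Proof.
rewrite unlock; rewrite /dmev rmorph_sum; apply: eq_bigr => i _; rewrite rmorphM /= mev_id_mC.
congr (_ * _); have <- : map_mx (mev h M) (gmx *m map_mx mC x) = M *m map_mx h x.
  by rewrite map_mxM map_gmx map_mevC.
by rewrite -map_mxvec mxE.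
Qed.

End Eval.

(** Reads the coefficient of ['X] in an equality of values along two lines; the derivative of a
    translate follows without differentiating a composition. *)
Lemma mev_taylorP (S : comNzRingType) (h : {rmorphism F -> S}) (M B M' B' : 'M[S]_n) f g :
  (mev (polyC \o h) (map_mx polyC M + 'X *: map_mx polyC B) f =
   mev (polyC \o h) (map_mx polyC M' + 'X *: map_mx polyC B') g) ->
  dmev h M B f = dmev h M' B' g.
Proof. by rewrite -!mev_taylor1 => ->. Qed.

Lemma dmev_Rm (S : comNzRingType) (h : {rmorphism F -> S}) (M B : 'M[S]_n) x f :
  dmev h M B (Rm x f) = dmev h (M *m map_mx h x) (B *m map_mx h x) f.
Proof.
apply: mev_taylorP; rewrite mev_Rm; congr mev.
by rewrite mulmxDl -scalemxAl !map_mxM -!map_mx_comp.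
Qed.

Lemma dmev_Lm (S : comNzRingType) (h : {rmorphism F -> S}) (M B : 'M[S]_n) x f :
  dmev h M B (Lm x f) = dmev h (map_mx h x *m M) (map_mx h x *m B) f.
Proof.
apply: mev_taylorP; rewrite mev_Lm; congr mev.
by rewrite mulmxDr -scalemxAr !map_mxM -!map_mx_comp.
Qed.

(** Points with natural coordinates are Zariski dense in characteristic zero, and they come from
    [F]: an identity over the large field [L] may be tested on matrices over the small field. *)
Lemma mev_eq (L : fieldType) (h : {rmorphism F -> L}) (f g : {mpoly L[n * n]}) :
  [pchar L] =i pred0 ->
  (forall N : 'M[F]_n, mev idfun (map_mx h N) f = mev idfun (map_mx h N) g) -> f = g.
Proof.
move=> L0 fg; apply/eqP; rewrite -subr_eq0; apply/eqP; apply: mpoly_natroots => // v.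
have := fg (vec_mx (\row_i (v i)%:R)) => /eqP; rewrite -subr_eq0 -rmorphB => /eqP <-.
apply: eq_mmap => // i; rewrite -map_mxvec mxE vec_mxK mxE.
by rewrite rmorph_nat.
Qed.

End Translations.

(** * Generalized eigenbases *)


Section ClosedField.
Variable F : fieldType.
Hypothesis F_closed : GRing.closed_field_axiom F.

Lemma closed_monic_root (p : {poly F}) :
  p \is monic -> (1 < size p)%N -> exists x, root p x.
Proof.
move=> pm sp; have [x xP] := F_closed (fun i => - p`_i) (n := (size p).-1) ltac:(by rewrite -ltnS prednK // ltnW).
exists x; rewrite rootE horner_coef; case E : (size p) sp xP => [|m] // sp xP.
rewrite big_ord_recr /= -[m]/(m.+1.-1) -E -lead_coefE (monicP pm) mul1r E xP.
by rewrite -big_split big1 //= => i _; rewrite mulNr subrr.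
Qed.

Lemma closed_root (p : {poly F}) : (1 < size p)%N -> exists x, root p x.
Proof.
move=> sp; have lp : lead_coef p != 0 by rewrite lead_coef_eq0 -size_poly_gt0 ltnW.
have [||x] := @closed_monic_root ((lead_coef p)^-1 *: p).
- by rewrite monicE lead_coefZ mulVf.
- by rewrite size_scale ?invr_eq0.
- by rewrite rootZ ?invr_eq0 //; exists x.
Qed.

Lemma closed_monic_split (p : {poly F}) :
  p \is monic -> exists s, p = \prod_(a <- s) ('X - a%:P).
Proof.
move: {2}(size p) (leqnn (size p)) => m; elim: m p => [|m IHm] p.
  by rewrite leqn0 size_poly_eq0 => /eqP -> /monic_neq0; rewrite eqxx.
move=> pm monp; have [sp|sp] := leqP (size p) 1.
  exists [::]; rewrite big_nil; move: sp monp => /size1_polyC ->.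
  by rewrite monicE lead_coefC => /eqP ->.
have [a /factor_theorem[q pq]] := closed_monic_root monp sp.
have monq : q \is monic by move: monp; rewrite pq monicMr ?monicXsubC.
have [|s qs] := IHm q _ monq; last by exists (rcons s a); rewrite big_rcons pq qs.
by move: pm; rewrite pq size_Mmonic ?monic_neq0 ?monicXsubC // size_XsubC addn2.
Qed.

Lemma nilpotent_trace n (x : 'M[F]_n) m : x ^+ m = 0 -> \tr x = 0.
Proof.
case: n x => [|n] x xm; first by rewrite /mxtrace big_ord0.
have [s sP] := closed_monic_split (char_poly_monic x).
have s0 a : a \in s -> a = 0.
  rewrite -root_prod_XsubC -sP -eigenvalue_root_char => /eigenvalueP[v xv v0].
  have : v *m x ^+ m = a ^+ m *: v.
    elim: (m) => [|j IHj]; first by rewrite !expr0 mulmx1 scale1r.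
    by rewrite exprSr -mulmxE mulmxA IHj -scalemxAl xv scalerA exprSr.
  rewrite xm mulmx0 => /esym/eqP; rewrite scaler_eq0 (negPf v0) orbF.
  by rewrite expf_eq0 => /andP[_ /eqP].
have cX : char_poly x = 'X^(n.+1).
  have ss : size s = n.+1 by apply/eqP; rewrite -eqSS -(size_prod_XsubC _ id) /= -sP size_char_poly.
  rewrite sP -ss big_seq (eq_bigr (fun=> 'X)) => [|a /s0 ->]; last by rewrite subr0.
  by rewrite -big_seq big_const_seq count_predT iter_mulr_1.
by apply/eqP; rewrite -oppr_eq0 -char_poly_trace // cX coefXn /= ltn_eqF.
Qed.

(** Exchange argument: while fewer than [n] independent rows are chosen, some row of some [A] in [W]
    lies outside their span. The sum need not be direct. *)
Lemma row_basis n (W : seq 'M[F]_n) : (1%:M <= \sum_(A <- W) A)%MS ->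
  exists P, P \in unitmx /\ forall i, exists2 A, A \in W & (row i P <= A)%MS.
Proof.
move=> W1; suff /(_ n (leqnn n))[P [Pf PW]] : forall r, (r <= n)%N ->
    exists B : 'M[F]_(r, n), row_free B /\
      forall i, exists2 A, A \in W & (row i B <= A)%MS.
  by exists P; rewrite -row_free_unit.
elim=> [|r IHr] rn.
  by exists 0; split=> [|[]//]; rewrite /row_free mxrank0.
have [B [Bf BW]] := IHr (ltnW rn).
have [v vP vB] : exists2 v : 'rV_n, (exists2 A, A \in W & (v <= A)%MS) & ~~ (v <= B)%MS.
  apply: contrapT => nv; have : (1%:M <= B)%MS.
    apply: submx_trans W1 _; rewrite big_seq.
    apply: (big_ind (fun A => (A <= B)%MS)) => [|X Y XB YB|A AW]; first exact: sub0mx.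
      by rewrite addsmx_sub XB.
    apply/row_subP => i; apply: contrapT => /negP nB; apply: nv.
    by exists (row i A) => //; exists A => //; exact: row_sub.
  move=> /mxrankS; rewrite mxrank1 => nB.
  by move: rn; rewrite -(eqP Bf) ltnNge nB.
exists (col_mx v B : 'M_(1 + r, n)); split.
  apply/eqP; transitivity (\rank (v + B)%MS); first by rewrite addsmxE.
  have := mxrank_sum_cap v B.
  have -> : (\rank (v :&: B) = 0)%N.
    apply/eqP; rewrite mxrank_eq0; apply: contraR vB => /rowV0Pn[w wvB w0].
    move: wvB; rewrite sub_capmx => /andP[/sub_rVP[a wa] wB].
    move: w0 wB; rewrite wa scaler_eq0 negb_or => /andP[a0 _].
    by rewrite (eqmx_scale _ a0).
  rewrite addn0 => ->; rewrite (eqP Bf) rank_rV.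
  by case: eqP vB => // ->; rewrite sub0mx.
suff H (i : 'I_(1 + r)) : exists2 A, A \in W & (row i (col_mx v B) <= A)%MS by exact: H.
case: (split_ordP i) => j ->; first by rewrite rowKu (ord1 j) row_id.
by rewrite rowKd.
Qed.

Definition geneigen_basis n (x P : 'M[F]_n) (al : 'I_n -> F) : Prop :=
  P \in unitmx /\
  forall i, papply (mulmx x) (('X - (al i)%:P) ^+ n) (col i P) = 0.

Lemma papply_horner_mx n (x : 'M[F]_n.+1) q p (v : 'M_(n.+1, p)) :
  papply (mulmx x) q v = horner_mx x q *m v.
Proof.
elim/poly_ind: q v => [|q c IHq] v; first by rewrite rmorph0 -[0]/(0%:P) papplyC scale0r mul0mx.
rewrite papplyD papplyC papplyMX IHq rmorphD rmorphM /= horner_mx_X horner_mx_C.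
by rewrite mulmxDl mul_scalar_mx mulmxA.
Qed.

Lemma trmx_horner_mx n (x : 'M[F]_n.+1) q : horner_mx x^T q = (horner_mx x q)^T.
Proof.
elim/poly_ind: q => [|q c IHq]; first by rewrite !rmorph0 trmx0.
rewrite !(rmorphD, rmorphM) /= !horner_mx_X !horner_mx_C IHq linearD /= tr_scalar_mx.
rewrite -!mulmxE -trmx_mul; congr (_^T + _).
by rewrite (comm_horner_mx q (erefl (x *m x))).
Qed.

Lemma geneigen_basis_exists n (x : 'M[F]_n) : exists P al, geneigen_basis x P al.
Proof.
case: n x => [|n] x; first by exists 1%:M, (fun=> 0); split; [exact: unitmx1 | case].
(* Generalized eigenspaces are spaces of rows here, whereas the basis sought consists of columns. *)
pose y := x^T; have [r rP] := closed_monic_split (char_poly_monic y).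
pose s := undup r.
have rs : size r = n.+1.
  by apply/eqP; rewrite -eqSS -(size_prod_XsubC _ id) /= -rP size_char_poly.
have ydiv : mxminpoly y %| \prod_(i < size s) ('X - (s`_i)%:P) ^+ n.+1.
  apply: dvdp_trans (mxminpoly_dvd_char y) _; rewrite rP.
  rewrite -(big_undup_iterop_count _ r predT (fun a => 'X - a%:P)).
  rewrite (big_nth 0) big_mkord; apply: (big_ind2 (fun p q => p %| q)) => //.
    by move=> a b c d; exact: dvdp_mul.
  by move=> i _; rewrite Monoid.iteropE iter_mulr_1 dvdp_exp2l // -rs count_size.
have W1 : (1%:M <= \sum_(A <- [seq geigenspace y a | a <- s]) A)%MS.
  rewrite big_map (big_nth 0) big_mkord -(kermxpoly_prod y) => [|i j _ _ ij].
    by rewrite (kermxpoly_min ydiv) submx_refl.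
  apply: coprimep_expl; apply: coprimep_expr.
  by rewrite coprimep_XsubC root_XsubC nth_uniq ?undup_uniq.
have [P [Pu PW]] := row_basis W1.
have PW' i : exists a, (row i P <= geigenspace y a)%MS.
  by have [_ /mapP[a _ ->] iP] := PW i; exists a.
exists P^T, (fun i => projT1 (cid (PW' i))); split; first by rewrite unitmx_tr.
move=> i; case: cid => a /= /sub_kermxP.
rewrite /y trmx_horner_mx papply_horner_mx -tr_row => e.
by apply: trmx_inj; rewrite trmx_mul trmxK e trmx0.
Qed.

Section Rep.
Variables (n : nat) (P : 'M[F]_n).
Hypothesis Pu : P \in unitmx.
Implicit Types (th : 'I_n -> F).

Definition rep th : 'M[F]_n := P *m diag_mx (\row_i th i) *m invmx P.

Lemma repP th : rep th *m P = P *m diag_mx (\row_i th i).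
Proof. by rewrite /rep mulmxKV. Qed.

Lemma col_mulmx m p (X : 'M[F]_(m, n)) (Y : 'M[F]_(n, p)) i : col i (X *m Y) = X *m col i Y.
Proof. by rewrite !colE mulmxA. Qed.

Lemma rep_col th i : rep th *m col i P = th i *: col i P.
Proof.
rewrite -col_mulmx repP; apply/colP => j.
by rewrite mul_mx_diag !mxE mulrC.
Qed.

Lemma eq_col_basis (X Y : 'M[F]_n) : (forall i, X *m col i P = Y *m col i P) -> X = Y.
Proof.
move=> XY; apply: (can_inj (mulmxK Pu)); apply/matrixP => i j.
by have /colP/(_ i) := XY j; rewrite -!col_mulmx !mxE.
Qed.

Lemma repM th th' : rep th *m rep th' = rep (fun i => th i * th' i).
Proof.
apply: eq_col_basis => i.
by rewrite -mulmxA !rep_col -scalemxAr rep_col scalerA mulrC.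
Qed.

Lemma rep_linear a th th' : a *: rep th + rep th' = rep (fun i => a * th i + th' i).
Proof.
apply: eq_col_basis => i.
by rewrite mulmxDl -scalemxAl !rep_col scalerA scalerDl.
Qed.

Lemma rep_const a : rep (fun=> a) = a%:M.
Proof. by apply: eq_col_basis => i; rewrite rep_col mul_scalar_mx. Qed.

Lemma eq_rep th th' : th =1 th' -> rep th = rep th'.
Proof. by move=> e; apply: eq_col_basis => i; rewrite !rep_col e. Qed.

Lemma trace_rep th : \tr (rep th) = \sum_i th i.
Proof.
rewrite /rep mxtrace_mulC mulmxA mulVmx // mul1mx mxtrace_diag.
by apply: eq_bigr => i _; rewrite mxE.
Qed.

Lemma comm_rep x th (D : 'I_n -> F) : (forall i j, D i = D j -> th i = th j) ->
  x *m rep D = rep D *m x -> x *m rep th = rep th *m x.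
Proof.
move=> Dth cx; pose y := invmx P *m x *m P.
have xE : x = P *m y *m invmx P by rewrite /y !mulmxA mulmxV // mul1mx mulmxK.
move: y xE => y xE; have cy : y *m diag_mx (\row_i D i) = diag_mx (\row_i D i) *m y.
  apply: (can_inj (mulKmx Pu)); apply: (can_inj (mulmxK (_ : invmx P \in unitmx))).
    by rewrite unitmx_inv.
  by move: cx; rewrite /rep xE !mulmxA !(mulmxKV Pu).
rewrite /rep xE !mulmxA !(mulmxKV Pu) -!mulmxA; congr (_ *m _); rewrite !mulmxA.
congr (_ *m _); apply/matrixP => i j.
have /matrixP/(_ i j) := cy; rewrite !mul_mx_diag !mul_diag_mx !mxE.
move=> /eqP; rewrite mulrC -subr_eq0 -mulrBl mulf_eq0 subr_eq0 => /orP[/eqP/Dth ->|/eqP ->].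
  by rewrite mulrC.
by rewrite !(mulr0, mul0r).
Qed.

Variables (x : 'M[F]_n) (al : 'I_n -> F).
Hypothesis x_gen : forall i, papply (mulmx x) (('X - (al i)%:P) ^+ n) (col i P) = 0.

Lemma papply_mulmx q m p (v : 'M[F]_(n, m)) (w : 'M[F]_(m, p)) :
  papply (mulmx x) q v *m w = papply (mulmx x) q (v *m w).
Proof.
rewrite /papply mulmx_suml; apply: eq_bigr => j _; rewrite -scalemxAl; congr (_ *: _).
by elim: (nat_of_ord j) => //= l <-; rewrite mulmxA.
Qed.

Lemma rep_papply th : (forall i j, al i = al j -> th i = th j) ->
  exists q, rep th = papply (mulmx x) q 1%:M.
Proof.
move=> alth; have [q qP] := interpolation (codom al) n
  (fun a => if [pick i | al i == a] is Some i then th i else 0).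
exists q; apply: eq_col_basis => i; rewrite rep_col papply_mulmx mul1mx.
rewrite (papply_geneig (c := th i) _ (x_gen i)) //.
have := qP _ (codom_f al i); case: pickP => [j /eqP/alth ->//|/(_ i)].
by rewrite eqxx.
Qed.

Lemma comm_papply y q : y *m x = x *m y ->
  y *m papply (mulmx x) q 1%:M = papply (mulmx x) q 1%:M *m y.
Proof.
move=> yx; rewrite /papply mulmx_sumr mulmx_suml; apply: eq_bigr => j _.
rewrite -scalemxAl -scalemxAr; congr (_ *: _).
elim: (nat_of_ord j) => [|l IHl] /=; first by rewrite mulmx1 mul1mx.
by rewrite mulmxA yx -!mulmxA IHl.
Qed.

Lemma comm_rep_gen y th : (forall i j, al i = al j -> th i = th j) ->
  y *m x = x *m y -> y *m rep th = rep th *m y.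
Proof. by move=> /rep_papply[q ->]; exact: comm_papply. Qed.

(** Jordan decomposition: [rep P al] is the semisimple part of [x]. It is a polynomial in [x], so it
    commutes with [x], and on [col i P] each power of the difference is that of [x - al i]. *)
Lemma nilpart : (x - rep al) ^+ n = 0.
Proof.
set nu := x - rep al; have cx : nu *m x = x *m nu.
  by rewrite mulmxBl mulmxBr (comm_rep_gen (th := al)).
apply: eq_col_basis => i; rewrite mul0mx -[RHS](x_gen i).
suff H m : nu ^+ m *m col i P = papply (mulmx x) (('X - (al i)%:P) ^+ m) (col i P) by exact: H.
elim: m => [|m IHm]; first by rewrite !expr0 mul1mx papplyC scale1r.
rewrite exprSr -mulmxE -mulmxA mulmxBl rep_col exprS papplyM papplyXsub -IHm.
rewrite mulmxBr -scalemxAr; congr (_ - _); rewrite /= !mulmxA; congr (_ *m _).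
elim: (m) => [|l IHl]; first by rewrite !expr0 !mulmxE mul1r mulr1.
by rewrite exprSr -mulmxE -mulmxA cx mulmxA IHl mulmxA.
Qed.

Lemma comm_nilpotent_trace (y z : 'M[F]_n) m : y *m z = z *m y -> y ^+ m = 0 -> \tr (y *m z) = 0.
Proof.
move=> yz ym; apply: (@nilpotent_trace _ _ m).
by rewrite mulmxE exprMn_comm ?ym ?mul0r //; exact: yz.
Qed.

Lemma trace_mul_rep th : (forall i j, al i = al j -> th i = th j) ->
  \tr (x *m rep th) = \sum_i al i * th i.
Proof.
move=> alth; have cx : rep th *m x = x *m rep th by rewrite (comm_rep_gen (th := th)).
rewrite -{1}[x](subrK (rep al)) mulmxDl mxtraceD repM trace_rep.
rewrite (comm_nilpotent_trace (m := n)) ?add0r //; last exact: nilpart.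
by rewrite mulmxBl mulmxBr repM cx repM; congr (_ - _); apply: eq_rep => i; rewrite mulrC.
Qed.

Lemma nilpotent_of_eigen0 : (forall i, al i = 0) -> x ^+ n = 0.
Proof.
move=> al0; rewrite -nilpart (_ : rep al = 0) ?subr0 //.
by rewrite (eq_rep al0) rep_const; exact: raddf0.
Qed.

End Rep.
End ClosedField.

Section LeibnizEigen.
Variables (F : fieldType) (A : comAlgType F) (D : {linear A -> A}).

(** [D - (a + b)] sends [f * g] to [(D - a) f * g + f * (D - b) g], and each application lowers one
    of the two exponents. *)
Lemma geneig_derivation (a b : F) (f g : A) :
  (forall x y, D (x * y) = D x * y + x * D y) ->
  geneig D a f -> geneig D b g -> geneig D (a + b) (f * g).
Proof.
move=> DM [N fN] [N' gN']; exists (N + N')%N.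
move: {-1}(N + N')%N (leqnn (N + N')) => s; elim: s N N' f g fN gN' => [|s IHs] N N' f g.
  by case: N => [|//]; rewrite expr0 papplyC scale1r => -> _ _; rewrite mul0r linear0.
case: N => [|N]; first by rewrite expr0 papplyC scale1r => -> _ _; rewrite mul0r linear0.
case: N' => [|N']; first by rewrite expr0 papplyC scale1r => _ -> _; rewrite mulr0 linear0.
move=> fN gN sN; rewrite exprSr papplyM papplyXsub DM.
have -> : D f * g + f * D g - (a + b) *: (f * g) =
    papply D ('X - a%:P) f * g + f * papply D ('X - b%:P) g.
  rewrite !papplyXsub mulrBl mulrBr -scalerAl -scalerAr scalerDl opprD.
  by rewrite addrACA.
rewrite linearD /=; have -> : papply D (('X - (a + b)%:P) ^+ s) (papply D ('X - a%:P) f * g) = 0.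
  apply: (IHs N N'.+1) => //; by rewrite -papplyM -exprSr.
rewrite add0r; apply: (IHs N.+1 N') => //; first by rewrite -papplyM -exprSr.
by move: sN; rewrite addnS ltnS.
Qed.

Lemma geneig_endomorphism (a b : F) (f g : A) :
  (forall x y, D (x * y) = D x * D y) ->
  geneig D a f -> geneig D b g -> geneig D (a * b) (f * g).
Proof.
move=> DM [N fN] [N' gN']; exists (N + N')%N.
move: {-1}(N + N')%N (leqnn (N + N')) => s; elim: s N N' f g fN gN' => [|s IHs] N N' f g.
  by case: N => [|//]; rewrite expr0 papplyC scale1r => -> _ _; rewrite mul0r linear0.
case: N => [|N]; first by rewrite expr0 papplyC scale1r => -> _ _; rewrite mul0r linear0.
case: N' => [|N']; first by rewrite expr0 papplyC scale1r => _ -> _; rewrite mulr0 linear0.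
move=> fN gN sN; rewrite exprSr papplyM papplyXsub DM.
have -> : D f * D g - (a * b) *: (f * g) =
    papply D ('X - a%:P) f * D g + (a *: f) * papply D ('X - b%:P) g.
  rewrite !papplyXsub mulrBl mulrBr -!scalerAl -!scalerAr scalerA mulrC.
  by rewrite addrA subrK mulrC.
rewrite linearD /=; have -> : papply D (('X - (a * b)%:P) ^+ s) (papply D ('X - a%:P) f * D g) = 0.
  apply: (IHs N N'.+1); first by rewrite -papplyM -exprSr.
    by rewrite papply_comm gN linear0.
  by move: sN; rewrite addSn ltnS.
rewrite add0r; apply: (IHs N.+1 N'); first by rewrite linearZ /= fN scaler0.
  by rewrite -papplyM -exprSr.
by move: sN; rewrite addnS ltnS.
Qed.

End LeibnizEigen.

(** * Eigenvectors of translations among polynomials *)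

Section MonomialBasis.
Variables (F : fieldType) (n : nat).
Local Notation Pol := {mpoly F[n * n]}.
Local Notation mC := (@mpolyC (n * n) F).
Implicit Types (x P : 'M[F]_n) (f g : Pol) (m : 'X_{1..n * n}).

(** The linear form [(X v)_b]: on each row of [X], a right translation by [x] acts as [x] acts on
    columns. *)
Definition lin (b : 'I_n) (v : 'cV[F]_n) : Pol := \sum_h v h 0 *: (gmx b h : Pol).

Lemma lin_is_linear b : linear (lin b).
Proof.
move=> a u v; rewrite scaler_sumr -big_split; apply: eq_bigr => h _.
by rewrite !mxE scalerDl scalerA.
Qed.
HB.instance Definition _ b :=
  GRing.isLinear.Build F 'cV[F]_n Pol *:%R (lin b) (lin_is_linear b).

Lemma gmxE b i : gmx b i = 'X_(mxvec_index b i) :> Pol.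
Proof. by rewrite !mxE. Qed.

Lemma lin_delta b i : lin b (delta_mx i 0) = gmx b i.
Proof.
rewrite /lin (bigD1 i) //= mxE !eqxx scale1r big1 ?addr0 // => h hi.
by rewrite mxE (negPf hi) scale0r.
Qed.

Lemma lin_mulmx b x v : lin b (x *m v) = \sum_h v h 0 *: (gmx *m map_mx mC x) b h.
Proof.
transitivity (\sum_h \sum_l (v h 0 * x l h) *: (gmx b l : Pol)).
  rewrite exchange_big; apply: eq_bigr => l _.
  by rewrite mxE scaler_suml; apply: eq_bigr => h _; rewrite mulrC.
apply: eq_bigr => h _; rewrite mxE scaler_sumr; apply: eq_bigr => l _.
by rewrite [map_mx _ _ _ _]mxE [_ * _%:MP]mulrC mul_mpolyC scalerA.
Qed.

Lemma Rm_lin x b v : Rm x (lin b v) = lin b (x *m v).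
Proof.
rewrite lin_mulmx linear_sum; apply: eq_bigr => h _; rewrite linearZ /=.
by rewrite gmxE unlock mevX mxvecE.
Qed.

Lemma Dm_lin x b v : Dm x (lin b v) = lin b (x *m v).
Proof.
rewrite lin_mulmx linear_sum; apply: eq_bigr => h _; rewrite linearZ /=; congr (_ *: _).
rewrite gmxE unlock /dmev (bigD1 (mxvec_index b h)) //= mxvecE big1 ?addr0 => [|j jn].
  rewrite mderivX mnmE eqxx scale1r (_ : (_ - _)%MM = 0%MM) ?mpolyX0 ?rmorph1 ?mul1r //.
  by apply/mnmP => j; rewrite !mnmE subnn.
by rewrite mderivX mnmE eq_sym (negPf jn) scale0r rmorph0 mul0r.
Qed.

Lemma Dm1 x : Dm x 1 = 0. Proof. by rewrite unlock dmevC. Qed.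

(** The variable of index [(b, i)] carries the value of its column [i], whatever its row, since
    right translations treat all rows alike. *)
Definition colval T (th : 'I_n -> T) (k : 'I_(n * n)) : T := mxvec (\matrix_(b < n, i < n) th i) 0 k.

Lemma colvalE T (th : 'I_n -> T) b i : colval th (mxvec_index b i) = th i.
Proof. by rewrite /colval mxvecE mxE. Qed.

Definition wt (th : 'I_n -> F) m : F := \sum_k colval th k *+ m k.
Definition mwt (th : 'I_n -> F) m : F := \prod_k colval th k ^+ m k.

(** Monomials in the linear forms [lin b (col i P)]. By the product rules they are generalized
    eigenvectors, of weight [wt al m] for the derivation and [mwt al m] for the translation. *)
Definition eigenmon P m : Pol := Rm P 'X_[m].

Lemma eigenmonE P m : eigenmon P m = \prod_k (Rm P 'X_k) ^+ m k.
Proof. by rewrite /eigenmon mpolyXE_id rmorph_prod; apply: eq_bigr => k _; rewrite rmorphXn. Qed.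

Lemma eigenmonU P b i : Rm P 'X_(mxvec_index b i) = lin b (col i P).
Proof.
by rewrite -gmxE -lin_delta Rm_lin -colE.
Qed.

Lemma RmE x f : Rm x f = mev mC (gmx *m map_mx mC x) f. Proof. by rewrite unlock. Qed.

Lemma Rm_mulmx x y f : Rm x (Rm y f) = Rm (x *m y) f.
Proof. by rewrite RmE mev_Rm -mulmxA -map_mxM -RmE. Qed.

Lemma Rm1 f : Rm 1%:M f = f.
Proof. by rewrite unlock map_mx1 mulmx1 mev_id_mC. Qed.

Lemma eigenmon_dec P f : P \in unitmx ->
  f = \sum_(m <- msupp (Rm (invmx P) f)) (Rm (invmx P) f)@_m *: eigenmon P m.
Proof.
move=> Pu; rewrite -{1}[f]Rm1 -(mulmxV Pu) -Rm_mulmx.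
by rewrite {1}[Rm (invmx P) f]mpolyE linear_sum; apply: eq_bigr => m _; rewrite linearZ.
Qed.

Lemma Rm_homog x f d : f \is d.-homog -> Rm x f \is d.-homog.
Proof.
move=> fd; rewrite [f]mpolyE linear_sum big_seq; apply: rpred_sum => m mf.
rewrite linearZ rpredZ // -(dhomog_mf fd mf) /= -/(eigenmon x m) eigenmonE mdegE.
apply: (big_ind2 (fun f d => f \is d.-homog)) => [|p e q e' pe qe'|k _].
- exact: dhomog1.
- exact: dhomogM.
suff : Rm x 'X_k \is 1.-homog by move/(dhomogMn (m k)); rewrite mul1n.
case/mxvec_indexP: k => b i; rewrite eigenmonU; apply: rpred_sum => h _.
by rewrite rpredZ // gmxE dhomogX /= mdeg1.
Qed.

Lemma Rm_deg x f d : (forall m, m \in msupp f -> (mdeg m <= d)%N) ->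
  forall m, m \in msupp (Rm x f) -> (mdeg m <= d)%N.
Proof.
move=> fd m; rewrite mcoeff_msupp leqNgt; apply: contra => dm; apply/eqP.
rewrite {1}[f]mpolyE (linear_sum (Rm x)) (raddf_sum (mcoeff m)) big_seq big1 // => m' m'f.
have hm : Rm x 'X_[m'] \is (mdeg m').-homog by apply: Rm_homog; rewrite dhomogX.
rewrite linearZ /= mcoeffZ (dhomog_nemf_coeff hm) ?mulr0 //.
by rewrite gtn_eqF // (leq_ltn_trans (fd _ m'f)).
Qed.

Lemma papply_lin (D : {linear Pol -> Pol}) x b q v :
  (forall w, D (lin b w) = lin b (x *m w)) ->
  papply D q (lin b v) = lin b (papply (mulmx x) q v).
Proof.
move=> Dx; elim/poly_ind: q v => [|q c IHq] v.
  by rewrite -[0]/(0%:P) !papplyC !scale0r linear0.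
by rewrite !papplyD !papplyC !papplyMX Dx IHq linearD linearZ.
Qed.

Section Eigen.
Variables (x P : 'M[F]_n) (al : 'I_n -> F).
Hypothesis x_gen : geneigen_basis x P al.

Lemma geneig_lin (D : {linear Pol -> Pol}) b i :
  (forall w, D (lin b w) = lin b (x *m w)) -> geneig D (al i) (lin b (col i P)).
Proof. by move=> Dx; exists n; rewrite (papply_lin _ _ Dx) x_gen.2 linear0. Qed.

Lemma geneig_Dm m : geneig (Dm x) (wt al m) (eigenmon P m).
Proof.
rewrite eigenmonE /wt.
have g0 : geneig (Dm x) 0 1 by exists 1%N; rewrite expr1 papplyXsub /= Dm1 scale0r subrr.
apply: (big_ind2 (fun f w => geneig (Dm x) w f)) => // [f w g w' fw gw'|k _].
  exact: geneig_derivation (@DmM _ _ x) fw gw'.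
elim: (m k) => [|e IHe] //; rewrite exprS mulrS.
apply: geneig_derivation (@DmM _ _ x) _ IHe.
case/mxvec_indexP: k => b i; rewrite eigenmonU colvalE.
by apply: geneig_lin => w; exact: Dm_lin.
Qed.

Lemma geneig_Rm m : geneig (Rm x) (mwt al m) (eigenmon P m).
Proof.
rewrite eigenmonE /mwt; have RM : forall f g, Rm x (f * g) = Rm x f * Rm x g.
  exact: rmorphM.
have g0 : geneig (Rm x) 1 1 by exists 1%N; rewrite expr1 papplyXsub /= rmorph1 scale1r subrr.
apply: (big_ind2 (fun f w => geneig (Rm x) w f)) => // [f w g w' fw gw'|k _].
  exact: geneig_endomorphism RM fw gw'.
elim: (m k) => [|e IHe] //; rewrite !exprS; apply: geneig_endomorphism RM _ IHe.
case/mxvec_indexP: k => b i; rewrite eigenmonU colvalE.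
by apply: geneig_lin => w; exact: Rm_lin.
Qed.

Lemma Dm_rep_eigenmon th m : Dm (rep P th) (eigenmon P m) = wt th m *: eigenmon P m.
Proof.
rewrite eigenmonE /wt; set D := Dm _.
have g0 : D 1 = 0 *: 1 by rewrite /D Dm1 scale0r.
have gM f w g w' : D f = w *: f -> D g = w' *: g -> D (f * g) = (w + w') *: (f * g).
  by move=> fw gw'; rewrite /D DmM -/D fw gw' -scalerAl -scalerAr scalerDl.
apply: (big_ind2 (fun f w => D f = w *: f)) => // k _.
elim: (m k) => [|e IHe] //; rewrite exprS mulrS; apply: gM IHe.
case/mxvec_indexP: k => b i; rewrite eigenmonU colvalE.
by rewrite /D Dm_lin rep_col ?x_gen.1 // linearZ.
Qed.

Section Dreplica.
Variables (th : 'I_n -> F) (f : Pol).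
Hypothesis al_th : forall m m', wt al m = wt al m' -> wt th m = wt th m'.

Lemma Dm_replica : exists q, Dm (rep P th) f = papply (Dm x) q f.
Proof.
apply: (replica_poly geneig_Dm (Dm_rep_eigenmon th) _ (eigenmon_dec f x_gen.1)).
by move=> m m' _ _; exact: al_th.
Qed.

Lemma Dm_replica_eigen a : f != 0 -> Dm x f = a *: f ->
  exists m, a = wt al m /\ Dm (rep P th) f = wt th m *: f.
Proof.
move=> f0 fa.
have [//|m _ mP] := replica_eigen geneig_Dm (Dm_rep_eigenmon th) _ (eigenmon_dec f x_gen.1) f0 fa.
  by move=> m m' _ _; exact: al_th.
by exists m.
Qed.
End Dreplica.

Section Rreplica.
Variables (th : 'I_n -> F) (f : Pol) (d : nat).
Hypothesis f_deg : forall m, m \in msupp f -> (mdeg m <= d)%N.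
Hypothesis al_th : forall m m', (mdeg m <= d)%N -> (mdeg m' <= d)%N ->
  mwt al m = mwt al m' -> wt th m = wt th m'.

(** Only the relations between monomials of degree at most [d] matter for [f]; there are finitely
    many of them, which later bounds an order uniformly in [x]. *)
Lemma Rm_replica : exists q, Dm (rep P th) f = papply (Rm x) q f.
Proof.
apply: (replica_poly geneig_Rm (Dm_rep_eigenmon th) _ (eigenmon_dec f x_gen.1)).
by move=> m m' mf m'f; exact: al_th (Rm_deg f_deg mf) (Rm_deg f_deg m'f).
Qed.

Lemma Rm_replica_eigen a : f != 0 -> Rm x f = a *: f ->
  exists2 m, (mdeg m <= d)%N & a = mwt al m /\ Dm (rep P th) f = wt th m *: f.
Proof.
move=> f0 fa.
have [|m mf mP] := replica_eigen geneig_Rm (Dm_rep_eigenmon th) _ (eigenmon_dec f x_gen.1) f0 fa.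
  by move=> m m' mf m'f; exact: al_th (Rm_deg f_deg mf) (Rm_deg f_deg m'f).
by exists m => //; exact: (Rm_deg f_deg mf).
Qed.
End Rreplica.

End Eigen.
End MonomialBasis.

(** * Linear algebraic groups and their Lie algebras *)


Section BaseField.
Variables (F L : fieldType) (h : {rmorphism F -> L}).
Implicit Types (c : seq L) (y : L) (a : nat -> F).

(* [hfree c]: the family [c] of [L] is linearly independent over [F]. *)
Definition comb c a : L := \sum_(j < size c) h (a j) * c`_j.
Definition hfree c : Prop := forall a, comb c a = 0 -> forall j, (j < size c)%N -> a j = 0.

Lemma comb_rcons c y a : comb (rcons c y) a = comb c a + h (a (size c)) * y.
Proof.
rewrite /comb size_rcons big_ord_recr /= nth_rcons ltnn eqxx; congr (_ + _).
by apply: eq_bigr => j _; rewrite nth_rcons ltn_ord.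
Qed.

Lemma comb_sub c a b : comb c (fun j => a j - b j) = comb c a - comb c b.
Proof. by rewrite -sumrB; apply: eq_bigr => j _; rewrite rmorphB mulrBl. Qed.

Lemma comb_scale c b a : comb c (fun j => b * a j) = h b * comb c a.
Proof. by rewrite mulr_sumr; apply: eq_bigr => j _; rewrite rmorphM mulrA. Qed.

Lemma hfree_inj c a b : hfree c -> comb c a = comb c b ->
  forall j, (j < size c)%N -> a j = b j.
Proof.
move=> cf ab j jc; apply/eqP; rewrite -subr_eq0; apply/eqP.
by apply: (cf (fun j => a j - b j)) => //; rewrite comb_sub ab subrr.
Qed.

Lemma hfree_extend c (ys : seq L) : hfree c ->
  exists c', hfree (c ++ c') /\ forall y, y \in ys -> exists a, y = comb (c ++ c') a.
Proof.
elim: ys c => [|y ys IHys] c cf; first by exists [::]; rewrite cats0.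
have [c' [cf' ysP]] := IHys c cf.
have [[a ya]|ny] := pselect (exists a, y = comb (c ++ c') a).
  by exists c'; split=> // z; rewrite inE => /predU1P[->|/ysP//]; exists a.
exists (rcons c' y); rewrite -rcons_cat; set d := c ++ c' in cf' ysP ny *; split.
  move=> a; rewrite comb_rcons => a0.
  have ad : a (size d) = 0.
    apply: contrapT => /eqP ad; apply: ny; exists (fun j => - (a (size d))^-1 * a j).
    rewrite comb_scale (_ : comb d a = - (h (a (size d)) * y)).
      by rewrite rmorphN fmorphV mulrNN mulKf // fmorph_eq0.
    by apply/eqP; rewrite -addr_eq0 a0.
  move: a0; rewrite ad rmorph0 mul0r addr0 => /cf' a0 j; rewrite size_rcons ltnS leq_eqVlt.
  by case/predU1P => [->|/a0].
move=> z; rewrite inE => /predU1P[->|/ysP[a ->]].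
  exists (fun j => (j == size d)%:R); rewrite comb_rcons eqxx rmorph1 mul1r /comb big1 ?add0r // => j _.
  by rewrite ltn_eqF ?rmorph0 ?mul0r.
exists (fun j => if j == size d then 0 else a j); rewrite comb_rcons eqxx rmorph0 mul0r addr0.
by apply: eq_bigr => j _; rewrite ltn_eqF.
Qed.

End BaseField.

Section LieAlgebra.
Variables (F : fieldType) (n : nat).
Local Notation Pol := {mpoly F[n * n]}.
Implicit Types (f g : Pol) (x y M N : 'M[F]_n).

Definition evalm M : Pol -> F := mev idfun M.
Definition devalm M x f : F := dmev idfun M x f.

HB.instance Definition _ M := GRing.RMorphism.copy (evalm M) (mev idfun M).

Lemma map_mx_idfun m p (X : 'M[F]_(m, p)) : map_mx idfun X = X.
Proof. by apply/matrixP => i j; rewrite mxE. Qed.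

Lemma evalmC M c : evalm M c%:MP = c. Proof. exact: mevC. Qed.
Lemma evalmB M f g : evalm M (f - g) = evalm M f - evalm M g. Proof. exact: rmorphB. Qed.
Lemma evalmM M f g : evalm M (f * g) = evalm M f * evalm M g. Proof. exact: rmorphM. Qed.
Lemma evalmZ M c f : evalm M (c *: f) = c * evalm M f. Proof. exact: mevZ. Qed.
Lemma evalm_Rm M x f : evalm M (Rm x f) = evalm (M *m x) f.
Proof. by rewrite /evalm mev_Rm map_mx_idfun. Qed.
Lemma evalm_Lm M x f : evalm M (Lm x f) = evalm (x *m M) f.
Proof. by rewrite /evalm mev_Lm map_mx_idfun. Qed.
Lemma evalm_Dm M x f : evalm M (Dm x f) = devalm M (M *m x) f.
Proof. by rewrite /evalm mev_Dm map_mx_idfun. Qed.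
Lemma devalm_Rm M B x f : devalm M B (Rm x f) = devalm (M *m x) (B *m x) f.
Proof. by rewrite /devalm dmev_Rm !map_mx_idfun. Qed.
Lemma devalm_Lm M B x f : devalm M B (Lm x f) = devalm (x *m M) (x *m B) f.
Proof. by rewrite /devalm dmev_Lm !map_mx_idfun. Qed.

Lemma devalmZ M x c f : devalm M x (c *: f) = c * devalm M x f.
Proof. exact: dmevZ. Qed.
Lemma devalmD M x f g : devalm M x (f + g) = devalm M x f + devalm M x g.
Proof. exact: dmevD. Qed.
Lemma devalmB M x f g : devalm M x (f - g) = devalm M x f - devalm M x g.
Proof. by rewrite devalmD -scaleN1r devalmZ mulN1r. Qed.
Lemma devalm_scalar M f : scalar ((devalm M)^~ f).
Proof. exact: dmev_linear. Qed.

Lemma evalm_eq f g : [pchar F] =i pred0 -> (forall M, evalm M f = evalm M g) -> f = g.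
Proof. by move=> F0 fg; apply: (mev_eq (h := idfun)) => // N; rewrite map_mx_idfun; apply: fg. Qed.

Definition detp : Pol := \det gmx.
Lemma mev_detp (S : comNzRingType) (h : {rmorphism F -> S}) (M : 'M[S]_n) : mev h M detp = \det M.
Proof. by rewrite /detp -det_map_mx map_gmx. Qed.

Variable G : 'M[F]_n -> Prop.
Hypothesis G_group : is_subgroup G.

Definition van f : Prop := forall M, G M -> evalm M f = 0.

Lemma subgroup_one : G 1%:M. Proof. by case: G_group. Qed.
Lemma subgroup_unit M : G M -> M \in unitmx. Proof. by case: G_group => h _ _ _; exact: h. Qed.
Lemma subgroup_mul M N : G M -> G N -> G (M *m N). Proof. by case: G_group => _ _ h _; exact: h. Qed.
Lemma subgroup_inv M : G M -> G (invmx M). Proof. by case: G_group => _ _ _; exact. Qed.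

Lemma van_Rm M f : G M -> van f -> van (Rm M f).
Proof. by move=> GM' vf N GN; rewrite evalm_Rm vf //; exact: subgroup_mul. Qed.
Lemma van_Lm M f : G M -> van f -> van (Lm M f).
Proof. by move=> GM' vf N GN; rewrite evalm_Lm vf //; exact: subgroup_mul. Qed.

Lemma LieE x : Lie G x <-> forall f, van f -> devalm 1%:M x f = 0.
Proof. by []. Qed.

(** [Dm x] is a left-invariant derivation: left translation by [M] moves the tangent condition from
    the identity to [M]. *)
Lemma van_Dm x f : Lie G x -> van f -> van (Dm x f).
Proof.
move=> /LieE Lx vf M GM'; rewrite evalm_Dm.
by have := Lx _ (van_Lm GM' vf); rewrite devalm_Lm mulmx1.
Qed.

Lemma Lie_of_Dm x : (forall f, van f -> van (Dm x f)) -> Lie G x.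
Proof.
by move=> Dx f /Dx /(_ _ subgroup_one); rewrite evalm_Dm mul1mx.
Qed.

Lemma Lie_lin a x y : Lie G x -> Lie G y -> Lie G (a *: x + y).
Proof.
move=> /LieE Lx /LieE Ly; apply/LieE => f vf.
by rewrite /devalm dmev_linear -!/(devalm _ _ _) Lx // Ly // mulr0 addr0.
Qed.

Lemma Lie0 : Lie G 0.
Proof.
apply/LieE => f _; rewrite /devalm -[0](subrr 1%:M) -[_ - _]addrC -scaleN1r.
by rewrite dmev_linear mulN1r addNr.
Qed.

Lemma Lie_sub x y : Lie G x -> Lie G y -> Lie G (x - y).
Proof. by move=> Lx Ly; rewrite addrC -scaleN1r; exact: Lie_lin. Qed.

Lemma Lie_conj M x : G M -> Lie G x -> Lie G (M *m x *m invmx M).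
Proof.
move=> GM' Lx; apply/LieE => f vf.
have /LieE/(_ _ (van_Lm GM' (van_Rm (subgroup_inv GM') vf))) := Lx.
by rewrite devalm_Lm devalm_Rm mulmx1 mulmxV // subgroup_unit.
Qed.

Lemma derivation_ext (D D' : {linear Pol -> Pol}) :
  (forall f g, D (f * g) = D f * g + f * D g) ->
  (forall f g, D' (f * g) = D' f * g + f * D' g) ->
  (forall b v, D (lin b v) = D' (lin b v)) -> D =1 D'.
Proof.
move=> DM D'M DD' f.
have chain (E : {linear Pol -> Pol}) : (forall f g, E (f * g) = E f * g + f * E g) ->
    E f = \sum_i f^`M(i) * E 'X_i.
  move=> EM; have E1 : E 1 = 0.
    by apply: (addrI (E 1)); rewrite addr0 -{3}[1]mulr1 EM mulr1 mul1r.
  have EC c : E (mpolyC (n * n) c) = mpolyC (n * n) ((GRing.null_fun F) c).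
    by rewrite /= mpolyC0 -[c%:MP]mulr1 mul_mpolyC linearZ /= E1 scaler0.
  have idm g : mmap (@mpolyC (n * n) F) (fun i => 'X_i) g = g.
    by rewrite -[RHS]comp_mpoly_id; apply: eq_mmap => // i; rewrite tnth_mktuple.
  have := mmap_chain EM EC (fun i => 'X_i) f; rewrite idm => ->.
  rewrite (_ : map_mpoly _ f = 0) ?rmorph0 ?add0r; last first.
    by apply/mpolyP => m; rewrite mcoeff_map_mpoly mcoeff0.
  by apply: eq_bigr => i _; rewrite idm.
rewrite (chain D) // (chain D') //; apply: eq_bigr => k _; congr (_ * _).
by case/mxvec_indexP: k => b i; rewrite -gmxE -lin_delta.
Qed.

Lemma Dm_bracket x y f : Dm (x *m y - y *m x) f = Dm x (Dm y f) - Dm y (Dm x f).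
Proof.
pose D g := Dm x (Dm y g) - Dm y (Dm x g).
have Dlin : linear D.
  move=> a g g'; rewrite /D !(linearD, linearZ) /=. by rewrite addrACA.
pose DL := GRing.isLinear.Build F Pol Pol *:%R D Dlin.
pose D' : {linear Pol -> Pol} := HB.pack D DL.
have bracketM (d e : Pol -> Pol) g g' :
    (forall p q, d (p + q) = d p + d q) -> (forall p q, d (p * q) = d p * q + p * d q) ->
    (forall p q, e (p + q) = e p + e q) -> (forall p q, e (p * q) = e p * q + p * e q) ->
    d (e (g * g')) - e (d (g * g')) = (d (e g) - e (d g)) * g' + g * (d (e g') - e (d g')).
  by move=> dD dM eD eM; rewrite dM eM !dD !eD !dM !eM; ring.
apply: (derivation_ext (D' := D')) => [g g'|g g'|b v]; first exact: DmM.
  exact: bracketM (linearD (Dm x)) (DmM x) (linearD (Dm y)) (DmM y).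
by rewrite /= /D !Dm_lin !mulmxA mulmxBl linearB.
Qed.

Lemma Lie_bracket x y : Lie G x -> Lie G y -> Lie G (x *m y - y *m x).
Proof.
move=> Lx Ly; apply: Lie_of_Dm => f vf M GM'; rewrite Dm_bracket evalmB.
have vD z z' : Lie G z -> Lie G z' -> evalm M (Dm z (Dm z' f)) = 0.
  by move=> Lz Lz'; apply: (van_Dm Lz (van_Dm Lz' vf)).
by rewrite (vD x y Lx Ly) (vD y x Ly Lx) subrr.
Qed.

Lemma van_papply (D : {linear Pol -> Pol}) q f :
  (forall g, van g -> van (D g)) -> van f -> van (papply D q f).
Proof.
move=> Dv vf M GM'; rewrite rmorph_sum big1 // => j _ /=; rewrite evalmZ.
suff -> : evalm M (iter j D f) = 0 by rewrite mulr0.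
have : van (iter j D f) by elim: (nat_of_ord j) => //= l; exact: Dv.
exact.
Qed.

(* The replica [rep P th] of [x] has eigenvalues satisfying the same additive relations
   as those of [x], hence acts on each space of polynomials as a polynomial in [Dm x]. *)
Lemma Lie_replica x P al th : geneigen_basis x P al ->
  (forall m m', wt al m = wt al m' -> wt th m = wt th m') ->
  Lie G x -> Lie G (rep P th).
Proof.
move=> xP al_th Lx; apply: Lie_of_Dm => f vf.
have [q ->] := Dm_replica xP f al_th.
by apply: van_papply => // g; exact: van_Dm.
Qed.

Definition semiinv (w : Pol) (chi : 'M[F]_n -> F) : Prop :=
  forall M, G M -> Rm M w = chi M *: w.

Hypothesis F0 : [pchar F] =i pred0.

(** For every [N], the polynomial [w (N0) w (N X) - w (N) w (N0 X)] vanishes on [G]; its derivative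
    at the identity says that [Dm x w] is a multiple of [w], with the ratio read at a point [N0]
    where [w] is not zero. *)
Lemma semiinv_Lie w chi : w != 0 -> semiinv w chi ->
  exists dchi : 'M[F]_n -> F, scalar dchi /\ forall x, Lie G x -> Dm x w = dchi x *: w.
Proof.
move=> w0 wchi; have [N0 wN0] : exists N0, evalm N0 w != 0.
  apply: contrapT => nw; case/eqP: w0; apply: evalm_eq => // M; rewrite rmorph0.
  by apply: contrapT => /eqP wM; apply: nw; exists M.
exists (fun x => evalm N0 (Dm x w) / evalm N0 w); split=> [a x y|x Lx].
  by rewrite Dm_linear rmorphD /= evalmZ mulrDl mulrA.
apply: evalm_eq => // N; rewrite evalmZ.
have : van (evalm N0 w *: Lm N w - evalm N w *: Lm N0 w).
  move=> M GM'; rewrite evalmB !evalmZ !evalm_Lm -!evalm_Rm wchi // !evalmZ.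
  by rewrite mulrCA [X in _ - X]mulrCA [evalm N w * _]mulrC subrr.
move=> /((LieE x).1 Lx); rewrite devalmB !devalmZ.
rewrite !devalm_Lm !mulmx1 -!evalm_Dm => /eqP; rewrite subr_eq0 => /eqP e.
by apply: (mulfI wN0); rewrite e [RHS]mulrA [X in _ = X * _]mulrC divfK // mulrC.
Qed.

End LieAlgebra.

(** * Rational coordinates of eigenvalues *)

Section RationalReplica.
Variables (F : fieldType) (qF : {rmorphism rat -> F}) (n : nat).

Lemma pchar_ratr_morph : [pchar F] =i pred0.
Proof.
apply/pcharf0P => j; rewrite -(rmorph_nat qF) fmorph_eq0.
by rewrite -[j%:R]/(j%:~R) intr_eq0.
Qed.

Definition wtz (a : 'I_n -> rat) (m : 'X_{1..n * n}) : rat := \sum_k colval a k *+ m k.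

Lemma wt_rat (a : 'I_n -> rat) m : wt (fun i => qF (a i)) m = qF (wtz a m).
Proof.
rewrite rmorph_sum; apply: eq_bigr => k _; rewrite rmorphMn.
by case/mxvec_indexP: k => b i; rewrite !colvalE.
Qed.

Lemma wtU (al : 'I_n -> F) b i : wt al U_(mxvec_index b i) = al i.
Proof.
rewrite /wt (bigD1 (mxvec_index b i)) //= colvalE mnmE eqxx mulr1n big1 ?addr0 // => k kn.
by rewrite mnmE eq_sym (negPf kn).
Qed.

Lemma wt_compat (al th : 'I_n -> F) :
  (forall m m', wt al m = wt al m' -> wt th m = wt th m') ->
  forall i j, al i = al j -> th i = th j.
Proof. by move=> al_th i j aij; rewrite -(wtU th i i) -(wtU th i j); apply: al_th; rewrite !wtU. Qed.

Lemma wt_comb (c : seq F) (a : 'I_n -> nat -> rat) (al : 'I_n -> F) m :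
  (forall i, al i = comb qF c (a i)) ->
  wt al m = comb qF c (fun j => wtz (a^~ j) m).
Proof.
move=> alE; rewrite /wt /comb.
transitivity (\sum_k \sum_(j < size c) (qF (colval (a^~ j) k *+ m k) * c`_j)).
  apply: eq_bigr => k _; case/mxvec_indexP: k => b i; rewrite colvalE alE -sumrMnl.
  by apply: eq_bigr => j _; rewrite colvalE rmorphMn mulrnAl.
by rewrite exchange_big; apply: eq_bigr => j _; rewrite rmorph_sum mulr_suml.
Qed.

(** Relations between weights have natural coefficients, so they pass to each rational coordinate of
    the eigenvalues: each coordinate family defines a replica with rational eigenvalues. *)
Lemma wt_comb_replica (c : seq F) (a : 'I_n -> nat -> rat) (al : 'I_n -> F) j :
  hfree qF c -> (forall i, al i = comb qF c (a i)) -> (j < size c)%N ->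
  forall m m', wt al m = wt al m' ->
    wt (fun i => qF (a i j)) m = wt (fun i => qF (a i j)) m'.
Proof.
move=> cf alE jc m m'; rewrite !(wt_comb _ alE) !wt_rat => /(hfree_inj cf)/(_ _ jc).
by move=> ->.
Qed.

(** The prefix [c0] prescribes the start of the basis: with [[:: 1]], the coordinate of index 0 is
    the rational part of an eigenvalue. *)
Lemma comb_family (c0 : seq F) (al : 'I_n -> F) : hfree qF c0 ->
  exists c (a : 'I_n -> nat -> rat), hfree qF (c0 ++ c) /\ forall i, al i = comb qF (c0 ++ c) (a i).
Proof.
move=> c0f; have [c [cf cP]] := hfree_extend (codom al) c0f; exists c.
have H i : exists a, al i = comb qF (c0 ++ c) a by apply/cP/codom_f.
by exists (fun i => projT1 (cid (H i))); split=> // i; case: cid.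
Qed.

Lemma rat_sum_sqr_eq0 (a : 'I_n -> rat) : \sum_i a i * a i = 0 -> forall i, a i = 0.
Proof.
move=> /eqP; rewrite Num.Theory.psumr_eq0 => [/allP a0 i|i _]; last by rewrite -expr2 Num.Theory.sqr_ge0.
by have := a0 i (mem_index_enum _); rewrite /= mulf_eq0 orbb => /eqP.
Qed.

End RationalReplica.

(** * The trace form of a reductive group is nondegenerate *)


Lemma char0_deriv_eq0 (F : fieldType) (p : {poly F}) :
  [pchar F] =i pred0 -> p^`() = 0 -> p.[0] = 0 -> p = 0.
Proof.
move=> F0 dp p0; apply/polyP => -[|j]; rewrite coef0; first by rewrite -horner_coef0.
have /(congr1 (fun q : {poly F} => q`_j)) := dp; rewrite coef_deriv coef0 => /eqP.
by rewrite -mulr_natr mulf_eq0 (pcharf0P _).1 // orbF => /eqP.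
Qed.

(** Otherwise some polynomial in [x] without constant term is the projection onto the generalized
    eigenspace of a nonzero eigenvalue; its trace is both zero and a positive integer. Listing 0
    among the interpolation points removes the constant term. *)
Lemma nilpotent_of_traces (F : fieldType) n (x : 'M[F]_n) :
  GRing.closed_field_axiom F -> [pchar F] =i pred0 ->
  (forall j, (0 < j)%N -> \tr (x ^+ j) = 0) -> x ^+ n = 0.
Proof.
move=> F_closed F0 trx; have [P [al [Pu xP]]] := geneigen_basis_exists F_closed x.
apply: (nilpotent_of_eigen0 Pu xP) => i0; apply: contrapT => /eqP ali0.
have n_gt0 : (0 < n)%N by exact: leq_ltn_trans (leq0n i0) (ltn_ord i0).
have [q qP] := interpolation (0 :: codom al) n (fun a => (a == al i0)%:R).
have q0 : q`_0 = 0.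
  have : ('X - 0%:P) %| q - (0 == al i0)%:R%:P.
    apply: dvdp_trans (qP 0 _); last by rewrite inE eqxx.
    by rewrite -(prednK n_gt0) exprS dvdp_mulIl.
  rewrite dvdp_XsubCl rootE !hornerE subr_eq0 => /eqP; rewrite horner_coef0 => ->.
  by rewrite eq_sym (negPf ali0).
have qx : papply (mulmx x) q 1%:M = rep P (fun i => (al i == al i0)%:R).
  apply: (eq_col_basis Pu) => i; rewrite rep_col // papply_mulmx mul1mx.
  by apply: papply_geneig (xP i); apply: qP; rewrite inE codom_f orbT.
have : \tr (papply (mulmx x) q 1%:M) = 0.
  rewrite /papply raddf_sum big1 // => j _; rewrite /= mxtraceZ.
  have -> : iter j (mulmx x) 1%:M = x ^+ j.
    by elim: (nat_of_ord j) => [|l IHl] //=; rewrite IHl exprS.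
  by case: (nat_of_ord j) => [|l]; rewrite ?q0 ?mul0r // trx ?mulr0.
rewrite qx trace_rep // -natr_sum => /eqP; rewrite (pcharf0P _).1 // sum_nat_eq0.
by move=> /forallP/(_ i0); rewrite eqxx.
Qed.

(** * Traces of words in a Lie algebra of matrices *)

Section Words.
Variables (F : fieldType) (n : nat) (R : 'M[F]_n -> Prop).
Hypothesis F_closed : GRing.closed_field_axiom F.
Hypothesis F0 : [pchar F] =i pred0.
Hypothesis R_lin : forall a x y, R x -> R y -> R (a *: x + y).
Hypothesis R_bracket : forall x y, R x -> R y -> R (x *m y - y *m x).
Hypothesis R_nilp : forall x, R x -> x ^+ n = 0.

Definition word (w : seq 'M[F]_n) : 'M[F]_n := foldr mulmx 1%:M w.

Lemma poly_coef1 (B x y : 'M[F]_n) m : exists p : {poly F},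
  p`_1 = \sum_(i < m) \tr (B *m (y ^+ i *m x *m y ^+ (m.-1 - i))) /\
  forall t, p.[t] = \tr (B *m (t *: x + y) ^+ m).
Proof.
pose yx : 'M[{poly F}]_n := 'X *: map_mx polyC x + map_mx polyC y.
exists (\tr (map_mx polyC B *m yx ^+ m)); split; last first.
  move=> t; rewrite -[LHS]/(horner_eval t _) -trace_map_mx; congr (\tr _).
  rewrite map_mxM -map_mx_comp; congr (_ *m _).
    by apply/matrixP => i j; rewrite !mxE /= /horner_eval hornerC.
  elim: m => [|m IHm]; first by rewrite !expr0 map_mx1.
  rewrite !exprS -!mulmxE map_mxM IHm; congr (_ *m _).
  by apply/matrixP => i j; rewrite /yx !mxE /= /horner_eval !hornerE.
have c01 l : map_mx (coefp 0) (yx ^+ l) = y ^+ l /\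
    map_mx (coefp 1) (yx ^+ l) = \sum_(i < l) y ^+ i *m x *m y ^+ (l.-1 - i).
  have yx0 : map_mx (coefp 0) yx = y.
    by apply/matrixP => i j; rewrite /yx !mxE /= coefD coefC coefXM add0r.
  have yx1 : map_mx (coefp 1) yx = x.
    by apply/matrixP => i j; rewrite /yx !mxE /= coefD coefC coefXM coefC addr0.
  have cM (U V : 'M[{poly F}]_n) :
      map_mx (coefp 0) (U *m V) = map_mx (coefp 0) U *m map_mx (coefp 0) V /\
      map_mx (coefp 1) (U *m V) = map_mx (coefp 0) U *m map_mx (coefp 1) V
        + map_mx (coefp 1) U *m map_mx (coefp 0) V.
    split; apply/matrixP => i j; rewrite !mxE /= coef_sum -?big_split;
      apply: eq_bigr => h _; rewrite !mxE coefM.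
      by rewrite big_ord1.
    by rewrite !big_ord_recl big_ord0 addr0.
  elim: l => [|l [IH0 IH1]].
    split; last first.
      by rewrite big_ord0; apply/matrixP => i j; rewrite !mxE /= coefMn coef1 mul0rn.
    by apply/matrixP => i j; rewrite expr0 !mxE /= coefMn coef1.
  rewrite exprS -mulmxE (cM yx _).1 (cM yx _).2 IH0 IH1 yx0 yx1.
  split; first by rewrite exprS mulmxE.
  rewrite big_ord_recl subn0 mul1mx addrC; congr (_ + _).
  rewrite mulmx_sumr; apply: eq_bigr => i _.
  by rewrite !mulmxA /= /bump /= add1n subnS predn_sub exprS mulmxE.
set Y := yx ^+ m; transitivity (\tr (map_mx (coefp 1) (map_mx polyC B *m Y))).
  by rewrite /mxtrace coef_sum; apply: eq_bigr => i _; rewrite [in RHS]mxE.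
have -> : map_mx (coefp 1) (map_mx polyC B *m Y) = B *m map_mx (coefp 1) Y.
  apply/matrixP => i j; rewrite !mxE /= coef_sum; apply: eq_bigr => h _.
  by rewrite !mxE coefCM.
by rewrite (c01 m).2 mulmx_sumr raddf_sum.
Qed.

Lemma word_cat u v : word (u ++ v) = word u *m word v.
Proof. by elim: u => [|x u IHu] /=; rewrite ?mul1mx // IHu mulmxA. Qed.

(* Polarization: the traces of powers of a generic combination determine, modulo
   commutators, the traces of words. *)
Lemma words_traces B m : (forall x j, R x -> (0 < j <= m)%N -> \tr (B *m x ^+ j) = 0) ->
  forall w, (0 < size w <= m)%N -> (forall x, x \in w -> R x) -> \tr (B *m word w) = 0.
Proof.
elim: m B => [|m IHm] B BR w; first by case: w.
have IHB := IHm B (fun x j Rx jm => BR x j Rx ltac:(by move: jm => /andP[-> /leqW])).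
case: w => // x w /=; rewrite ltnS => wm Rw.
have Rx : R x by apply: Rw; rewrite mem_head.
have Rw' y : y \in w -> R y by move=> yw; apply: Rw; rewrite inE yw orbT.
have [w0|w_gt0] := posnP (size w).
  by rewrite (size0nil w0) /= mulmx1 -[x]expr1 BR.
(* The first letter is absorbed into [B]; the induction hypothesis reduces the remaining word to
   powers of a single [y]. *)
rewrite mulmxA; apply: IHm => //; last by rewrite w_gt0.
move=> y j Ry /andP[j_gt0 jm].
have wordn z l : word (nseq l z) = z ^+ l.
  by elim: l => //= l ->; rewrite exprS.
have shortw u : (0 < size u <= m)%N -> (forall z, z \in u -> R z) -> \tr (B *m word u) = 0.
  exact: IHB.
have [jm'|mj] := ltnP j m.
  rewrite -mulmxA -wordn -[x *m _]/(word (x :: nseq j y)).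
  apply: shortw; first by rewrite /= size_nseq.
  by move=> z; rewrite inE => /predU1P[->//|/nseqP[->]].
have {mj jm j_gt0} -> : j = m by apply/eqP; rewrite eqn_leq jm.
(* Moving [x] past one [y] costs a word of length [m] with a bracket as one letter, whose trace is
   already known to vanish. *)
have swap i l : (i + l = m)%N -> \tr (B *m (y ^+ i *m x *m y ^+ l)) = \tr (B *m x *m y ^+ m).
  elim: i l => [|i IHi] l il; first by rewrite mul1mx -il mulmxA.
  rewrite -(IHi l.+1) -?il ?addnS //.
  have -> : y ^+ i.+1 *m x *m y ^+ l = y ^+ i *m x *m y ^+ l.+1
      - word (nseq i y ++ (x *m y - y *m x) :: nseq l y).
    rewrite word_cat /= !wordn exprSr exprS -!mulmxE mulmxBl mulmxBr !mulmxA.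
    by rewrite opprB addrC subrK.
  rewrite mulmxBr raddfB /= shortw ?subr0 //.
    by rewrite size_cat /= !size_nseq addnS -il addSn leqnn.
  move=> z; rewrite mem_cat inE => /or3P[/nseqP[->]|/eqP->|/nseqP[->]] //.
  exact: R_bracket.
have [p [p1 pt]] := poly_coef1 B x y m.+1.
(* The trace of [B (t x + y)^(m+1)] vanishes for all natural [t], so its linear coefficient, which
   is [m + 1] times the trace sought, is zero. *)
have p0 : p = 0.
  by apply: poly_natroots => // t; rewrite pt BR ?leqnn //; exact: R_lin.
move: p1; rewrite p0 coef0 (eq_bigr (fun=> \tr (B *m x *m y ^+ m))) => [|i _]; last first.
  by apply: swap; rewrite subnKC // -ltnS.
rewrite sumr_const card_ord => /esym/eqP; rewrite -mulr_natr mulf_eq0.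
by rewrite [_.+1%:R == 0](pcharf0P _).1 // orbF => /eqP.
Qed.
End Words.

(** * Exponentials of nilpotent elements *)

Section Exponential.
Variables (F : fieldType) (n : nat).
Hypothesis F0 : [pchar F] =i pred0.
Variables (G : 'M[F]_n -> Prop) (G_group : is_subgroup G).

Definition expX (N : nat) (x : 'M[F]_n) : 'M[{poly F}]_n :=
  \sum_(j < N) ((j`!)%:R^-1 *: 'X^j) *: map_mx polyC (x ^+ j).

Lemma deriv_expX N x : x ^+ N = 0 ->
  map_mx (@deriv F) (expX N.+1 x) = expX N.+1 x *m map_mx polyC x.
Proof.
move=> xN; have -> : expX N.+1 x *m map_mx polyC x =
    \sum_(j < N) ((j`!)%:R^-1 *: 'X^j) *: map_mx polyC (x ^+ j.+1).
  rewrite /expX big_ord_recr /= mulmxDl [X in _ + X]( _ : _ = 0) ?addr0; last first.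
    by rewrite xN map_mx0 scaler0 mul0mx.
  rewrite mulmx_suml; apply: eq_bigr => j _.
  by rewrite -scalemxAl -map_mxM mulmxE exprSr.
rewrite /expX raddf_sum big_ord_recl /= addrC.
have -> : map_mx (@deriv F) (((0`!)%:R^-1 *: 'X^0) *: map_mx polyC (x ^+ 0)) = 0.
  apply/matrixP => i j; rewrite !expr0 map_mx1 fact0 invr1 !scale1r !mxE /=.
  by rewrite -(rmorph_nat polyC) derivC.
rewrite addr0; apply: eq_bigr => j _; apply/matrixP => h l; rewrite !mxE /= /bump /= add1n.
rewrite derivM derivC mulr0 addr0 derivZ derivXn /=; congr (_ * _).
rewrite factS natrM invfM -scaler_nat scalerA; congr (_ *: _).
by rewrite mulrAC mulVf ?mul1r // (pcharf0P _).1.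
Qed.

(** Induction on the size of [f (exp (t x))] as a polynomial in [t]: its value at 0 is [f (1)], and
    its derivative is the same expression for [Dm x f], which vanishes on [G] again. *)
Lemma van_expX N x f : Lie G x -> x ^+ N = 0 -> van G f ->
  mev polyC (expX N.+1 x) f = 0.
Proof.
move=> Lx xN; pose E := expX N.+1 x; move: {2}(size _) (leqnn (size (mev polyC E f))) => s.
elim: s f => [|s IHs] f; first by rewrite leqn0 size_poly_eq0 => /eqP.
move=> sf vf; apply: char0_deriv_eq0 => //; last first.
  rewrite -[LHS]/(horner_eval 0 _) rmorph_mev (_ : map_mx _ E = 1%:M).
    rewrite -[RHS](vf _ (subgroup_one G_group)); apply: eq_mev => c /=.
    by rewrite /horner_eval hornerC.
  rewrite /E /expX raddf_sum big_ord_recl /= big1 ?addr0 => [|j _].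
    apply/matrixP => i j; rewrite fact0 invr1 scale1r !expr0 scale1r !mxE /horner_eval.
    by rewrite hornerC.
  by apply/matrixP => i l; rewrite !mxE /= /horner_eval !hornerE expr0n /= mulr0 mul0r.
have dM (p q : {poly F}) : deriv (p * q) = deriv p * q + p * deriv q by exact: derivM.
have dC (c : F) : deriv c%:P = ((GRing.null_fun F) c)%:P by rewrite derivC.
have dE : (mev polyC E f)^`() = mev polyC E (Dm x f).
  rewrite (mev_chain _ _ dM dC) (_ : map_mpoly _ f = 0) ?rmorph0 ?add0r; last first.
    by apply/mpolyP => m; rewrite mcoeff_map_mpoly mcoeff0.
  by rewrite mev_Dm deriv_expX.
rewrite dE; apply: IHs; last exact: van_Dm.
rewrite -dE; have [->|p0] := eqVneq (mev polyC E f) 0; first by rewrite deriv0 size_poly0.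
by rewrite -ltnS (leq_trans (lt_size_deriv p0)).
Qed.

Hypothesis G_det : forall M, G M -> \det M = 1.
Hypothesis G_closed : forall M, M \in unitmx -> (forall f, van G f -> evalm M f = 0) -> G M.

Definition expm N t (x : 'M[F]_n) : 'M[F]_n := \sum_(j < N) ((j`!)%:R^-1 * t ^+ j) *: x ^+ j.

Lemma van_detp : van G (detp F n - 1).
Proof. by move=> M GM'; rewrite evalmB /evalm mev_detp G_det // rmorph1 subrr. Qed.

Lemma closed_det M : (forall f, van G f -> evalm M f = 0) -> G M.
Proof.
move=> vM; apply: G_closed => //; have := vM _ van_detp.
rewrite evalmB /evalm mev_detp rmorph1 => /eqP; rewrite subr_eq0 => /eqP e.
by rewrite unitmxE e unitr1.
Qed.

Lemma Lie_expm N x t : Lie G x -> x ^+ N = 0 -> G (expm N.+1 t x).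
Proof.
move=> Lx xN; apply: closed_det => f vf.
have := van_expX Lx xN vf => /(congr1 (horner_eval t)); rewrite rmorph0 => <-.
rewrite rmorph_mev; have -> : map_mx (horner_eval t) (expX N.+1 x) = expm N.+1 t x.
  rewrite raddf_sum; apply: eq_bigr => j _; apply/matrixP => h l.
  by rewrite !mxE /= /horner_eval !hornerE.
by apply: eq_mev => c /=; rewrite /horner_eval hornerC.
Qed.
End Exponential.

(** * Connectedness of unipotent groups *)

Section Connected.
Variables (F : fieldType) (n : nat).
Hypothesis F0 : [pchar F] =i pred0.

Definition binX j : {poly F} := (j`!)%:R^-1 *: \prod_(i < j) ('X - i%:R%:P).

Lemma binX_nat j m : (binX j).[m%:R] = 'C(m, j)%:R.
Proof.
rewrite hornerZ horner_prod; apply: (mulfI (_ : (j`!)%:R != 0)).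
  by rewrite (pcharf0P _).1 // -lt0n fact_gt0.
rewrite mulrA divff ?mul1r; last by rewrite (pcharf0P _).1 // -lt0n fact_gt0.
rewrite -natrM mulnC bin_ffact; elim: j => [|j IHj]; first by rewrite big_ord0 ffactn0.
rewrite big_ord_recr /= IHj ffactnSr natrM hornerXsubC.
have [jm|mj] := leqP j m; first by rewrite natrB.
by rewrite ffact_small // !mul0r.
Qed.

(** The power [(1 + N)^t] for a variable [t]: the binomial series stops at [e] when [N ^+ e = 0]. *)
Definition powX e (N : 'M[F]_n) : 'M[{poly F}]_n := \sum_(j < e) binX j *: map_mx polyC (N ^+ j).

Lemma powX_nat e (N : 'M[F]_n) m : N ^+ e = 0 -> map_mx (horner_eval m%:R) (powX e N) = (1%:M + N) ^+ m.
Proof.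
move=> Ne; have -> : map_mx (horner_eval m%:R) (powX e N) = \sum_(j < e) N ^+ j *+ 'C(m, j).
  rewrite raddf_sum; apply: eq_bigr => j _; apply/matrixP => h l.
  by rewrite !mxE /= /horner_eval hornerM hornerC binX_nat mulmxnE mulr_natl.
have cN : GRing.comm 1 N by apply: commr_sym; exact: commr1.
rewrite (exprDn_comm m cN); under [RHS]eq_bigr do rewrite expr1n mul1r.
pose f j := N ^+ j *+ 'C(m, j).
have ext a b : (forall j, (a <= j)%N -> f j = 0) -> \sum_(j < a + b) f j = \sum_(j < a) f j.
  move=> f0; rewrite big_split_ord /= [X in _ + X]big1 ?addr0 // => j _.
  by rewrite f0 // leq_addr.
rewrite -[LHS](ext e m.+1) => [|j ej]; last first.
  by rewrite /f -(subnK ej) exprD Ne mulr0 mul0rn.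
by rewrite addnC (ext m.+1 e) // => j mj; rewrite /f bin_small.
Qed.

Lemma closed_van (H : 'M[F]_n -> Prop) : closed_in_GL H ->
  forall M, M \in unitmx -> (forall f, van H f -> evalm M f = 0) -> H M.
Proof.
move=> [I HI] M Mu vM; apply/HI; split=> // f If; apply: vM => N /HI[_ NI].
exact: NI.
Qed.

(* The polynomial curve [t |-> N ^ t] through the integer powers of [N] is connected. *)
Lemma unipotent_connected (H : 'M[F]_n -> Prop) :
  is_subgroup H -> closed_in_GL H -> (forall M, H M -> \det M = 1) -> unipotent H ->
  Zariski_connected H.
Proof.
move=> Hg Hc Hdet Hu.
have curve M : H M -> exists C : 'M[{poly F}]_n,
    [/\ map_mx (horner_eval 0) C = 1%:M, map_mx (horner_eval 1) C = M
      & forall t, H (map_mx (horner_eval t) C)].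
  move=> HM; have [e Me] := Hu M HM; exists (powX e (M - 1%:M)).
  have Cm m : map_mx (horner_eval m%:R) (powX e (M - 1%:M)) = M ^+ m.
    by rewrite powX_nat // addrC subrK.
  split; [by rewrite (Cm 0) | by rewrite (Cm 1) expr1 | move=> t].
  have evC (h : F) f : (mev polyC (powX e (M - 1%:M)) f).[h] =
      evalm (map_mx (horner_eval h) (powX e (M - 1%:M))) f.
    rewrite -[LHS]/(horner_eval h _) rmorph_mev; apply: eq_mev => c /=.
    by rewrite /horner_eval hornerC.
  apply: (closed_det Hdet (closed_van Hc)) => f vf; rewrite -evC.
  rewrite (_ : mev _ _ _ = 0) ?horner0 //; apply: poly_natroots => // m.
  rewrite evC Cm vf //; elim: m => [|m IHm]; first by rewrite expr0; exact: subgroup_one.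
  by rewrite exprS -mulmxE; apply: subgroup_mul.
have main X Y : closed_in_GL X -> closed_in_GL Y ->
    (forall M, H M -> X M \/ Y M) -> (forall M, ~ [/\ H M, X M & Y M]) ->
    X 1%:M -> forall M, H M -> X M.
  move=> [IX XP] [IY YP] XY XnY X1 M HM; apply: contrapT => nX.
  have H1 : H 1%:M by exact: subgroup_one.
  have [f If fM] : exists2 f, IX f & evalm M f != 0.
    apply: contrapT => nf; apply: nX; apply/XP; split; first exact: (subgroup_unit Hg HM).
    by move=> f If; apply: contrapT => /eqP fM; apply: nf; exists f.
  have [g Ig g1] : exists2 g, IY g & evalm 1%:M g != 0.
    apply: contrapT => ng; apply: (XnY 1%:M); split=> //; apply/YP.
    split; first exact: unitmx1.
    by move=> g Ig; apply: contrapT => /eqP gM; apply: ng; exists g.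
  have [C [C0 C1 CH]] := curve M HM.
  have evC (h : F) f' : (mev polyC C f').[h] = evalm (map_mx (horner_eval h) C) f'.
    rewrite -[LHS]/(horner_eval h _) rmorph_mev; apply: eq_mev => c /=.
    by rewrite /horner_eval hornerC.
  (* One of the two polynomials in [t] must vanish identically, but [f] is nonzero at [t = 1] and
     [g] at [t = 0]. *)
  have : mev polyC C f * mev polyC C g = 0.
    apply: poly_natroots => // m; rewrite hornerM !evC.
    case: (XY _ (CH m%:R)) => [/XP[_ /(_ f If) e]|/YP[_ /(_ g Ig) e]].
      by rewrite [X in X * _]e mul0r.
    by rewrite [X in _ * X]e mulr0.
  move/eqP; rewrite mulf_eq0 => /orP[] /eqP p0.
    by move: fM; rewrite -C1 -evC p0 horner0 eqxx.
  by move: g1; rewrite -C0 -evC p0 horner0 eqxx.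
move=> X Y Xc Yc XY XnY; case: (XY 1%:M (subgroup_one Hg)) => [X1|Y1].
  by left; exact: (main X Y).
right; apply: (main Y X) => // [M HM|M [HM YM XM]]; first by case: (XY M HM); [right|left].
by apply: (XnY M).
Qed.
End Connected.

(** * The radical of the trace form *)

Section Radical.
Variables (F : fieldType) (n : nat) (qF : {rmorphism rat -> F}).
Hypothesis F_closed : GRing.closed_field_axiom F.
Variables (G : 'M[F]_n -> Prop) (G_group : is_subgroup G).
Hypothesis G_det : forall M, G M -> \det M = 1.
Hypothesis G_closed : forall M, M \in unitmx -> (forall f, van G f -> evalm M f = 0) -> G M.
Let F0 := pchar_ratr_morph qF.

Definition trace_rad x : Prop := Lie G x /\ forall y, Lie G y -> \tr (x *m y) = 0.

Lemma trace_rad_lin a x y : trace_rad x -> trace_rad y -> trace_rad (a *: x + y).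
Proof.
move=> [Lx x0] [Ly y0]; split=> [|z Lz]; first exact: Lie_lin.
by rewrite mulmxDl mxtraceD -scalemxAl mxtraceZ x0 // y0 // mulr0 addr0.
Qed.

Lemma trace_rad_bracket x y : trace_rad x -> trace_rad y -> trace_rad (x *m y - y *m x).
Proof.
move=> [Lx x0] [Ly y0]; split=> [|z Lz]; first exact: Lie_bracket.
rewrite mulmxBl raddfB /= -!mulmxA [\tr (y *m _)]mxtrace_mulC -mulmxA -raddfB /= -mulmxBr.
by rewrite x0 //; exact: Lie_bracket.
Qed.

Lemma trace_rad_conj M x : G M -> trace_rad x -> trace_rad (M *m x *m invmx M).
Proof.
move=> HM [Lx x0]; split=> [|y Ly]; first exact: Lie_conj.
have := x0 _ (Lie_conj G_group (subgroup_inv G_group HM) Ly); rewrite invmxK => <-.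
by rewrite -!mulmxA mxtrace_mulC -!mulmxA.
Qed.

(** Cartan's argument. Each rational coordinate family [a^~ j] of the eigenvalues gives a replica in
    [Lie G], hence orthogonal to [x]; expanding the trace in the basis [c] over the rationals, its
    coordinate of index [j] is the sum of the squares of the [a i j]. *)
Lemma trace_rad_nilp x : trace_rad x -> x ^+ n = 0.
Proof.
move=> [Lx x0]; have [P [al xP]] := geneigen_basis_exists F_closed x.
have f0 : hfree qF [::] by move=> a _ j.
have [c [a [cf alE]]] := comb_family al f0; rewrite cat0s in cf alE.
apply: (nilpotent_of_eigen0 xP.1 xP.2) => i; rewrite alE /comb big1 // => j _.
have relj := fun l (lc : (l < size c)%N) => wt_comb_replica cf alE lc.
suff -> : a i j = 0 by rewrite rmorph0 mul0r.
apply: (rat_sum_sqr_eq0 (a := fun i => a i j)) => {i}.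
have Lj := Lie_replica G_group xP (relj j (ltn_ord j)) Lx.
have := x0 _ Lj; rewrite (trace_mul_rep F_closed xP.1 xP.2 (wt_compat (relj j (ltn_ord j)))).
rewrite (eq_bigr (fun i => \sum_(l < size c) (qF (a i l * a i j) * c`_l))) => [|i _]; last first.
  rewrite {1}alE mulr_suml; apply: eq_bigr => l _; rewrite rmorphM; ring.
rewrite exchange_big /= => e0.
have := cf (fun l => \sum_i a i l * a i j); rewrite /comb.
rewrite (eq_bigr (fun l : 'I_(size c) => \sum_i (qF (a i l * a i j) * c`_l))) => [|l _].
  by move/(_ e0 j (ltn_ord j)).
by rewrite rmorph_sum mulr_suml.
Qed.

(* The span of the nonempty words in [trace_rad], written as a bi-annihilator for the
   trace pairing. *)
Definition word_closure (a : 'M[F]_n) : Prop :=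
  forall B, (forall w, (0 < size w)%N -> (forall x, x \in w -> trace_rad x) -> \tr (B *m word w) = 0) ->
  \tr (B *m a) = 0.

Lemma word_closure_lin c a b : word_closure a -> word_closure b -> word_closure (c *: a + b).
Proof.
by move=> ha hb B BW; rewrite mulmxDr -scalemxAr mxtraceD mxtraceZ ha // hb // mulr0 addr0.
Qed.

Lemma word_closure0 : word_closure 0.
Proof. by move=> B _; rewrite mulmx0 mxtrace0. Qed.

Lemma word_closureM a b : word_closure a -> word_closure b -> word_closure (a *m b).
Proof.
move=> ha hb B BW; rewrite mulmxA mxtrace_mulC mulmxA; apply: ha => u u0 ru.
rewrite -mulmxA mxtrace_mulC; apply: hb => w w0 rw.
rewrite -mulmxA -word_cat BW //; first by rewrite size_cat addn_gt0 u0.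
by move=> x; rewrite mem_cat => /orP[/ru|/rw].
Qed.

Lemma word_closure_trad x : trace_rad x -> word_closure x.
Proof.
move=> tx B /(_ [:: x] isT); rewrite /= mulmx1; apply => y; rewrite inE => /eqP ->.
by [].
Qed.

Lemma word_closure_conj M a : G M -> word_closure a -> word_closure (M *m a *m invmx M).
Proof.
move=> HM ha B BW; rewrite mulmxA mxtrace_mulC !mulmxA; apply: ha => w w0 rw.
have Mu := subgroup_unit G_group HM.
have conjw u : M *m word u *m invmx M = word [seq M *m x *m invmx M | x <- u].
  elim: u => [|x u IHu] /=; first by rewrite mulmx1 mulmxV.
  by rewrite -IHu !mulmxA mulmxKV.
rewrite -!mulmxA mxtrace_mulC -!mulmxA (mulmxA M) conjw BW ?size_map //.
by move=> _ /mapP[x xw ->]; apply: trace_rad_conj => //; exact: rw.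
Qed.

Lemma word_closure_expr a j : word_closure a -> (0 < j)%N -> word_closure (a ^+ j).
Proof.
move=> ha; case: j => // j _; elim: j => [|j IHj]; first by rewrite expr1.
by rewrite exprS -mulmxE; apply: word_closureM.
Qed.

(** The powers of [a] stay in the closure, and words in [trace_rad] have trace zero because the
    elements of [trace_rad] are nilpotent; a matrix whose positive powers have trace zero is
    nilpotent. *)
Lemma word_closure_nilp a : word_closure a -> a ^+ n = 0.
Proof.
move=> ha; apply: nilpotent_of_traces => // j j0.
have := word_closure_expr ha j0 (B := 1%:M); rewrite mul1mx; apply => w w0 rw.
apply: (words_traces F0 trace_rad_lin trace_rad_bracket (m := size w)) => //; last by rewrite w0 leqnn.
move=> x i tx /andP[i0 _]; rewrite mul1mx; apply: (@nilpotent_trace _ F_closed _ _ n).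
by rewrite -exprM mulnC exprM trace_rad_nilp // expr0n gtn_eqF.
Qed.

Definition trace_rad_group M : Prop := G M /\ word_closure (M - 1%:M).

Lemma trace_rad_group_subgroup : is_subgroup trace_rad_group.
Proof.
split=> [M [HM _]|||].
- exact: (subgroup_unit G_group HM).
- by split; [exact: subgroup_one | rewrite subrr; exact: word_closure0].
- move=> M N [HM cM] [HN cN]; split; first exact: subgroup_mul.
  have -> : M *m N - 1%:M = 1 *: ((M - 1%:M) *m (N - 1%:M)) + (1 *: (M - 1%:M) + (N - 1%:M)).
    by rewrite !scale1r mulmxBr mulmx1 addrA subrK mulmxBl mul1mx addrA subrK.
  by apply: word_closure_lin; [exact: word_closureM | exact: word_closure_lin].
move=> M [HM cM]; split; first exact: subgroup_inv.
set a := M - 1%:M in cM *; have aM : M = 1 - (- a) by rewrite opprK addrC subrK.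
have an := word_closure_nilp cM.
(* [M = 1 + a] with [a] nilpotent: the inverse is a finite geometric series, whose terms after the
   first lie in [word_closure]. *)
have MV : invmx M = \sum_(j < n) (- a) ^+ j.
  apply: (can_inj (mulKmx (subgroup_unit G_group HM))); rewrite mulmxV ?(subgroup_unit G_group HM) //.
  by rewrite {1}aM mulmxE -[1 - - a]opprB mulNr -subrX1 opprB exprNn an mulr0 subr0.
have [n0|n_gt0] := posnP n.
  have -> : invmx M - 1%:M = 0; last exact: word_closure0.
  by apply/matrixP => i; have := ltn_ord i; rewrite {2}n0.
rewrite MV (bigD1 (Ordinal n_gt0)) //= expr0 -[1%:M]/(1 : 'M[F]_n) addrC addrK.
apply: (big_ind word_closure) => [|x y hx hy|j j0]; first exact: word_closure0.
  by rewrite -[x]scale1r; exact: word_closure_lin.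
apply: word_closure_expr; last by rewrite lt0n.
by rewrite -scaleN1r -[_ *: _]addr0; apply: word_closure_lin => //; exact: word_closure0.
Qed.

Lemma trace_rad_group_closed : closed_in_GL trace_rad_group.
Proof.
exists (van trace_rad_group) => M; split=> [HM|[Mu vM]].
  split; first exact: (subgroup_unit trace_rad_group_subgroup HM).
  by move=> f vf; exact: vf.
have HM : G M by apply: G_closed => // f vf; apply: vM => N [GN _]; exact: vf.
split=> // B BW; pose f : {mpoly F[n * n]} :=
  \tr (map_mx (@mpolyC _ _) B *m (gmx - map_mx (@mpolyC _ _) 1%:M)).
have fE N : evalm N f = \tr (B *m (N - 1%:M)).
  rewrite /evalm /f -trace_map_mx map_mxM map_mxB map_gmx !map_mevC.
  by rewrite !map_mx_idfun.
by rewrite -fE; apply: vM => N [_ cN]; rewrite fE; exact: cN.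
Qed.

Lemma trace_rad_group_normal : normal_in trace_rad_group G.
Proof.
split=> [M []//|M N HM [HN cN]]; have HMV := subgroup_inv G_group HM.
split; first by do 2?apply: subgroup_mul.
have := word_closure_conj HMV cN; rewrite invmxK mulmxBr mulmxBl mulmx1 mulVmx //.
exact: (subgroup_unit G_group HM).
Qed.

Lemma trace_rad_group_unipotent : unipotent trace_rad_group.
Proof. by move=> M [_ /word_closure_nilp M0]; exists n. Qed.

Hypothesis G_reductive : reductive G.

(* [trace_rad_group] is a closed normal unipotent subgroup of [G] that contains
   [exp (t x)] for all [x] in the radical of the trace form. *)
Lemma trace_rad_eq0 x : trace_rad x -> x = 0.
Proof.
move=> tx; have xn := trace_rad_nilp tx.
(* With the exponent [n.+1] instead of [n], the truncated exponential has a linear term also when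
   [n = 0]. *)
have xn1 : x ^+ n.+1 = 0 by rewrite exprS xn mulr0.
have e1 t : expm n.+2 t x = 1%:M.
  apply: G_reductive; exists trace_rad_group; split.
    split; [exact: trace_rad_group_subgroup | exact: trace_rad_group_closed | |
      exact: trace_rad_group_normal | exact: trace_rad_group_unipotent].
    apply: unipotent_connected => //; [exact: trace_rad_group_subgroup |
      exact: trace_rad_group_closed | by move=> M [/G_det] | exact: trace_rad_group_unipotent].
  split; first exact: Lie_expm tx.1 xn1.
  rewrite /expm big_ord_recl fact0 invr1 expr0 mul1r scale1r expr0 -[1%:M]/(1 : 'M[F]_n) addrAC subrr add0r.
  apply: (big_ind word_closure) => [|y z hy hz|j _]; first exact: word_closure0.
    by rewrite -[y]scale1r; exact: word_closure_lin.
  rewrite -[_ *: _]addr0; apply: word_closure_lin; last exact: word_closure0.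
  by apply: word_closure_expr => //; exact: word_closure_trad.
apply/matrixP => h l; rewrite [RHS]mxE.
(* All the exponentials being the identity, the polynomial curve is constant; its coefficient of
   degree 1 is [x]. *)
have p0 : (expX n.+2 x) h l - ((1%:M : 'M[F]_n) h l)%:P = 0.
  apply: poly_natroots => // t; rewrite hornerD hornerN hornerC.
  rewrite -[in X in _ - X](e1 t%:R) -[X in X - _]/(horner_eval t%:R _).
  rewrite /expX /expm !summxE rmorph_sum /= -sumrB big1 // => j _.
  by rewrite !mxE /= /horner_eval !hornerE subrr.
have /(congr1 (fun p : {poly F} => p`_1)) := p0.
rewrite coefB coefC subr0 coef0 /expX summxE coef_sum big_ord_recl big_ord_recl /= big1 ?addr0.
  by rewrite !mxE /= expr0 expr1 fact0 invr1 !scale1r mul1r coefC add0r coefMC coefX mul1r.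
move=> j _; rewrite !mxE /= coefMC coefZ coefXn /=.
by rewrite mulr0 mul0r.
Qed.
End Radical.

(** * Semi-invariants of a reductive group *)


Lemma det_taylor (R : comNzRingType) n (B : 'M[R]_n) :
  (\det (1%:M + 'X *: map_mx polyC B))`_1 = \tr B.
Proof.
have entry (s : 'S_n) i : (1%:M + 'X *: map_mx polyC B) i (s i) =
    (i == s i)%:R + 'X * (B i (s i))%:P by rewrite !mxE.
rewrite /determinant coef_sum (bigD1 (1%g : 'S_n)) //= [X in _ + X]big1 ?addr0 => [|s s1].
  rewrite odd_perm1 expr0 mul1r; set p := \prod_i _.
  suff [] : p`_0 = 1 /\ p`_1 = \tr B by [].
  rewrite /p /mxtrace.
  apply: (big_ind2 (fun (p : {poly R}) s => p`_0 = 1 /\ p`_1 = s)) => [|p1 s1 p2 s2|i _].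
  - by rewrite !coef1.
  - move=> [p10 p11] [p20 p21]; rewrite !coefM !big_ord_recl !big_ord0 /= p10 p20 p11 p21.
    by rewrite !addr0 mulr1 mul1r mulr1 addrC.
  by rewrite entry perm1 eqxx !coefD !coef1 !coefXM coefC addr0 add0r.
(* A nontrivial permutation moves two indices, [i] and [s i], so its term is divisible by the square
   of ['X]. *)
have [i si] : exists i, s i != i.
  apply: contrapT => ns; case/eqP: s1; apply/permP => i; rewrite perm1.
  by apply: contrapT => /eqP si; apply: ns; exists i.
rewrite (bigD1 i) //= (bigD1 (s i)) /=; last by rewrite si.
rewrite !entry eq_sym (negPf si) eq_sym (inj_eq perm_inj) (negPf si) !add0r.
set c := (-1) ^+ s; move: (B _ _)%:P (B _ _)%:P (\prod_(_ | _) _) => b1 b2 b3.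
by rewrite (_ : _ * _ = 'X * ('X * (c * b1 * b2 * b3))) ?coefXM //; ring.
Qed.

Lemma vspace_of_pred (F : fieldType) (V : vectType F) (L : V -> Prop) :
  L 0 -> (forall a x y, L x -> L y -> L (a *: x + y)) ->
  exists U : {vspace V}, forall x, (x \in U) <-> L x.
Proof.
move=> L0 Llin; suff H d (U : {vspace V}) : (\dim {:V} <= \dim U + d)%N ->
    (forall x, x \in U -> L x) -> exists U : {vspace V}, forall x, (x \in U) <-> L x.
  apply: (H (\dim {:V}) 0%VS); rewrite ?dimv0 //.
  by move=> x; rewrite memv0 => /eqP ->.
elim: d U => [|d IHd] U dU UL.
  exists U => x; split=> [/UL//|_].
  have /eqP -> : U == fullv by rewrite eqEdim subvf /= -[X in (_ <= X)%N]addn0.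
  exact: memvf.
have [[x Lx xU]|nx] := pselect (exists2 x, L x & x \notin U); last first.
  exists U => x; split=> [/UL//|Lx]; apply: contrapT => xU; apply: nx.
  by exists x => //; apply/negP.
apply: (IHd (U + <[x]>)%VS); last first.
  move=> y /memv_addP[u uU [v /vlineP[a ->] ->]].
  by rewrite addrC; apply: Llin => //; exact: UL.
apply: leq_trans dU _; rewrite addnS -addSn leq_add2r ltnNge; apply: contra xU => dd.
have /eqP -> : U == (U + <[x]>)%VS by rewrite eqEdim addvSl.
by rewrite memvE addvSr.
Qed.

Lemma trace_dual (F : fieldType) n (L : 'M[F]_n -> Prop) (phi : 'M[F]_n -> F) :
  L 0 -> (forall a x y, L x -> L y -> L (a *: x + y)) ->
  (forall x, L x -> (forall y, L y -> \tr (x *m y) = 0) -> x = 0) ->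
  scalar phi -> exists2 z, L z & forall y, L y -> \tr (z *m y) = phi y.
Proof.
move=> L0 Llin nondeg phil; have [U UL] := vspace_of_pred L0 Llin.
pose phiM := GRing.isLinear.Build F 'M[F]_n F^o *:%R phi phil.
pose phi' : {linear 'M[F]_n -> F^o} := HB.pack phi phiM.
pose X := vbasis U; pose Gram := \matrix_(i, j) \tr (X`_i *m X`_j) : 'M_(\dim U).
have XU (i : 'I_(\dim U)) : X`_i \in U by rewrite vbasis_mem ?mem_nth ?size_tuple.
have basisE (v : 'rV[F]_(\dim U)) y : y \in U ->
    \tr ((\sum_i v 0 i *: X`_i) *m y) = \sum_j coord X j y * (v *m Gram) 0 j.
  move=> yU; rewrite [in LHS](coord_vbasis yU) mulmx_sumr raddf_sum; apply: eq_bigr => j _.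
  rewrite -scalemxAr /= mxtraceZ [in RHS]mxE mulmx_suml raddf_sum; congr (_ * _).
  by apply: eq_bigr => i _; rewrite -scalemxAl /= mxtraceZ [in RHS]mxE.
have Gu : Gram \in unitmx.
  rewrite -row_free_unit -kermx_eq0; apply/rowV0P => v /sub_kermxP vG.
  have x0 : \sum_i v 0 i *: X`_i = 0.
    apply: nondeg; first by apply/UL; apply: memv_suml => i _; apply: memvZ.
    by move=> y /UL yU; rewrite basisE // vG big1 // => j _; rewrite mxE mulr0.
  have Xfree : free X by apply: basis_free (vbasisP U).
  apply/rowP => j; have := coord_sum_free (v 0) j Xfree.
  by rewrite x0 linear0 mxE.
pose v : 'rV_(\dim U) := (\row_j phi X`_j) *m invmx Gram.
exists (\sum_i v 0 i *: X`_i).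
  by apply/UL; apply: memv_suml => i _; apply: memvZ.
move=> y /UL yU; rewrite basisE // /v mulmxKV //.
rewrite -[RHS]/(phi' y) [in RHS](coord_vbasis yU) linear_sum; apply: eq_bigr => j _.
by rewrite linearZ [in LHS]mxE.
Qed.

(** The [e i] serve as multiplicities of projections that must cancel [m] times the eigenvalues
    [r i]; the shift by [A] makes them natural numbers. *)
Lemma common_denominator n (r : 'I_n -> rat) :
  exists (m A : nat) (e : 'I_n -> nat), (0 < m)%N /\ forall i, (e i)%:R = A%:R - m%:R * r i :> rat.
Proof.
pose m := (\prod_i `|denq (r i)|)%N.
have m_gt0 : (0 < m)%N by rewrite prodn_gt0 // => i; rewrite absz_gt0 denq_neq0.
have zr i : exists z : int, m%:R * r i = z%:~R.
  exists (numq (r i) * (\prod_(j | j != i) `|denq (r j)|)%N%:Z).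
  have rd : r i * (denq (r i))%:~R = (numq (r i))%:~R.
    by rewrite -{1}[r i]divq_num_den divfK // intr_eq0 denq_neq0.
  rewrite /m (bigD1 i) //= natrM [X in X * _ * _]pmulrn absz_denq intrM -rd -pmulrn.
  ring.
pose z i := projT1 (cid (zr i)); have zP i : m%:R * r i = (z i)%:~R by rewrite /z; case: cid.
pose A := (\sum_i `|z i|)%N; have Az i : (z i <= A)%R.
  by apply: Order.POrderTheory.le_trans (lez_abs _) _; rewrite lez_nat /A (bigD1 i) //= leq_addr.
exists m, A, (fun i => `|A%:Z - z i|%N); split=> // i; rewrite zP.
by rewrite pmulrn gez0_abs ?Num.Theory.subr_ge0 // rmorphB /= -pmulrn.
Qed.

Section Observable.
Variables (F : fieldType) (n : nat) (qF : {rmorphism rat -> F}).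
Hypothesis F_closed : GRing.closed_field_axiom F.
Variables (G : 'M[F]_n -> Prop) (G_group : is_subgroup G).
Hypothesis G_det : forall M, G M -> \det M = 1.
Hypothesis G_closed : forall M, M \in unitmx -> (forall f, van G f -> evalm M f = 0) -> G M.
Hypothesis G_reductive : reductive G.
Let F0 := pchar_ratr_morph qF.
Local Notation Pol := {mpoly F[n * n]}.

Lemma nondeg x : Lie G x -> (forall y, Lie G y -> \tr (x *m y) = 0) -> x = 0.
Proof. by move=> Lx x0; apply: (trace_rad_eq0 qF F_closed G_group G_det G_closed G_reductive). Qed.

Lemma Dm_Rm M y (f : Pol) : M \in unitmx -> Dm y (Rm M f) = Rm M (Dm (invmx M *m y *m M) f).
Proof.
move=> Mu; apply: evalm_eq => // N; rewrite evalm_Dm devalm_Rm evalm_Rm evalm_Dm.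
by rewrite !mulmxA mulmxK.
Qed.

Lemma tr_Lie y : Lie G y -> \tr y = 0.
Proof.
move=> Ly; have := (LieE G y).1 Ly _ (van_detp G_det); rewrite devalmB [devalm _ _ 1]dmevC subr0 => <-.
rewrite /devalm -mev_taylor1 (mev_detp (polyC \o idfun)).
by rewrite map_mx1 det_taylor.
Qed.

Lemma rep_geneigen P (th : 'I_n -> F) : P \in unitmx -> geneigen_basis (rep P th) P th.
Proof.
move=> Pu; split=> // i; have n_gt0 : (0 < n)%N by exact: leq_ltn_trans (leq0n i) (ltn_ord i).
have -> : ('X - (th i)%:P) ^+ n = ('X - (th i)%:P) ^+ n.-1 * ('X - (th i)%:P).
  by rewrite -exprSr prednK.
by rewrite papplyM papplyXsub /= rep_col // subrr linear0.
Qed.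

Section Weight.
Variables (w : Pol) (chi dchi : 'M[F]_n -> F).
Hypothesis w0 : w != 0.
Hypothesis w_semi : semiinv G w chi.
Hypothesis dchi_lin : scalar dchi.
Hypothesis w_dchi : forall y, Lie G y -> Dm y w = dchi y *: w.

Lemma Rm_neq0 M (f : Pol) : M \in unitmx -> f != 0 -> Rm M f != 0.
Proof.
move=> Mu; apply: contraNneq => e; rewrite -[f]Rm1 -(mulVmx Mu) -Rm_mulmx.
by rewrite e linear0.
Qed.

Lemma chi_neq0 M : G M -> chi M != 0.
Proof.
move=> HM; have := Rm_neq0 (subgroup_unit G_group HM) w0; rewrite w_semi //.
by apply: contraNneq => ->; rewrite scale0r.
Qed.

Lemma scalew_inj a b : a *: w = b *: w -> a = b.
Proof.
by move/eqP; rewrite -subr_eq0 -scalerBl scaler_eq0 (negPf w0) orbF subr_eq0 => /eqP.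
Qed.

Lemma dchi_conj M y : G M -> Lie G y -> dchi (M *m y *m invmx M) = dchi y.
Proof.
move=> HM Ly; have Mu := subgroup_unit G_group HM.
have := Dm_Rm (M *m y *m invmx M) w Mu; rewrite !mulmxA mulVmx // mul1mx mulmxKV //.
rewrite w_semi // (w_dchi Ly) !linearZ /= w_semi // w_dchi; last exact: Lie_conj.
by rewrite !scalerA => /scalew_inj; rewrite [RHS]mulrC; apply: mulfI; exact: chi_neq0.
Qed.

Lemma dchi_rat P (a : 'I_n -> rat) : P \in unitmx ->
  Lie G (rep P (fun i => qF (a i))) -> exists r, dchi (rep P (fun i => qF (a i))) = qF r.
Proof.
move=> Pu La; pose th i := qF (a i).
have [m [e _]] := Dm_replica_eigen (rep_geneigen th Pu) (th := th) (fun m m' e => e) w0 (w_dchi La).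
by exists (wtz a m); rewrite -wt_rat -e.
Qed.

(* The differential of [chi] is dual, for the trace form, to a central element, which is
   semisimple with rational eigenvalues because its replicas are again in [Lie G]. *)
Lemma central_dual : exists P (r : 'I_n -> rat), [/\ P \in unitmx,
  Lie G (rep P (fun i => qF (r i))),
  forall M, G M -> M *m rep P (fun i => qF (r i)) = rep P (fun i => qF (r i)) *m M &
  forall y, Lie G y -> \tr (rep P (fun i => qF (r i)) *m y) = dchi y].
Proof.
have [z Lz zP] := trace_dual (@Lie0 F n G) (@Lie_lin F n G) nondeg dchi_lin.
have Gz M : G M -> M *m z = z *m M.
  move=> HM; have Mu := subgroup_unit G_group HM.
  suff e : M *m z *m invmx M = z by rewrite -{2}e mulmxKV.
  apply/eqP; rewrite -subr_eq0; apply/eqP; apply: nondeg.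
    by apply: Lie_sub => //; exact: Lie_conj.
  move=> y Ly; have LV := Lie_conj G_group (subgroup_inv G_group HM) Ly; rewrite invmxK in LV.
  have -> : \tr ((M *m z *m invmx M - z) *m y) = \tr (z *m (invmx M *m y *m M)) - \tr (z *m y).
    by rewrite mulmxBl raddfB /= -!mulmxA mxtrace_mulC -!mulmxA.
  by rewrite !zP // -(dchi_conj HM LV) !mulmxA mulmxV // mul1mx mulmxK // subrr.
(* The trace of [[y, z] y'] is that of [z [y', y]], that is, the value of [dchi] at a bracket, which
   is zero. *)
have Lz_comm y : Lie G y -> y *m z = z *m y.
  move=> Ly; apply/eqP; rewrite -subr_eq0; apply/eqP; apply: nondeg; first exact: Lie_bracket.
  move=> y' Ly'; have Lb := Lie_bracket G_group Ly' Ly.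
  have -> : \tr ((y *m z - z *m y) *m y') = \tr (z *m (y' *m y - y *m y')).
    by rewrite mulmxBl mulmxBr !raddfB /= -!mulmxA [\tr (y *m _)]mxtrace_mulC !mulmxA.
  rewrite zP //; apply: scalew_inj; rewrite scale0r -w_dchi // Dm_bracket.
  by rewrite (w_dchi Ly) (w_dchi Ly') !linearZ /= (w_dchi Ly) (w_dchi Ly') scalerN !scalerA mulrC subrr.
have [P [al zPa]] := geneigen_basis_exists F_closed z; have [Pu zal] := zPa.
(* The nilpotent part of [z] commutes with [Lie G], so it is orthogonal to it and vanishes. *)
have zs : z = rep P al.
  have Ls : Lie G (rep P al) by apply: Lie_replica zPa _ Lz.
  apply/eqP; rewrite -subr_eq0; apply/eqP; apply: nondeg; first exact: Lie_sub.
  move=> y Ly; apply: (comm_nilpotent_trace F_closed _ (nilpart Pu zal)).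
  by rewrite mulmxBl mulmxBr Lz_comm // (comm_rep_gen Pu zal _ (Lz_comm _ Ly)).
have f1 : hfree qF [:: 1].
  by move=> a; rewrite /comb big_ord1 mulr1 => /eqP; rewrite fmorph_eq0 => /eqP a0 [].
have [c' [a [cf alE]]] := comb_family al f1; set c := [:: 1] ++ c' in cf alE.
have Lrep j : (j < size c)%N -> Lie G (rep P (fun i => qF (a i j))).
  by move=> jc; apply: Lie_replica zPa (wt_comb_replica cf alE jc) Lz.
(* The trace of [z] against the replica of index [j] is rational, so it has no coordinate along a
   basis element of positive index; that coordinate is a sum of squares. *)
have a0 i j : (0 < j < size c)%N -> a i j = 0.
  move=> /andP[j0 jc]; apply: (rat_sum_sqr_eq0 (a := fun i => a i j)) => {i}.
  have [r rP] := dchi_rat Pu (Lrep j jc).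
  have := zP _ (Lrep j jc); rewrite rP zs repM // trace_rep //.
  rewrite (eq_bigr (fun i => \sum_(l < size c) (qF (a i l * a i j) * c`_l))) => [|i _]; last first.
    rewrite alE mulr_suml; apply: eq_bigr => l _; rewrite rmorphM; ring.
  rewrite exchange_big /= => e0.
  have e1 : comb qF c (fun l => \sum_i a i l * a i j) = comb qF c (fun l => if l == 0%N then r else 0).
    rewrite [RHS]/comb big_ord_recl /= mulr1 big1 ?addr0 => [|l _]; last by rewrite rmorph0 mul0r.
    by rewrite -e0; apply: eq_bigr => l _; rewrite rmorph_sum mulr_suml.
  by have := hfree_inj cf e1 jc; rewrite gtn_eqF.
have zE : z = rep P (fun i => qF (a i 0%N)).
  rewrite zs; apply: eq_rep => // i; rewrite alE /comb big_ord_recl /= mulr1 big1 ?addr0 // => j _.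
  by rewrite a0 ?rmorph0 ?mul0r //= /bump /= add1n ltnS.
by exists P, (a^~ 0%N); rewrite -zE; split.
Qed.
End Weight.
End Observable.

Section MonomialRelations.
Variables (F : fieldType) (n : nat).
Implicit Types (m : 'X_{1..n * n}).

Definition colexp m (i : 'I_n) : nat := (\sum_b m (mxvec_index b i))%N.

Lemma mwt_colexp (al : 'I_n -> F) m : mwt al m = \prod_i al i ^+ colexp m i.
Proof.
transitivity (\prod_p colval al (mxvec_index p.1 p.2) ^+ m (mxvec_index p.1 p.2)).
  by rewrite /mwt (reindex _ (curry_mxvec_bij _ _)); apply: eq_bigr => -[].
rewrite -(pair_bigA _ (fun b i => colval al (mxvec_index b i) ^+ m (mxvec_index b i))) /=.
rewrite exchange_big /=; apply: eq_bigr => i _.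
by rewrite /colexp -prodrXr; apply: eq_bigr => b _; rewrite colvalE.
Qed.

Lemma wtz_colexp (a : 'I_n -> rat) m : wtz a m = \sum_i (colexp m i)%:R * a i.
Proof.
transitivity (\sum_p colval a (mxvec_index p.1 p.2) *+ m (mxvec_index p.1 p.2)).
  by rewrite /wtz (reindex _ (curry_mxvec_bij _ _)); apply: eq_bigr => -[].
rewrite -(pair_bigA _ (fun b i => colval a (mxvec_index b i) *+ m (mxvec_index b i))) /=.
rewrite exchange_big /=; apply: eq_bigr => i _.
by rewrite /colexp natr_sum mulr_suml; apply: eq_bigr => b _; rewrite colvalE mulr_natl.
Qed.

(** Linear algebra over the rationals: the condition on all [a] says that the exponent vector of
    [m0] is a combination of the differences given by [T], and clearing denominators gives [K]. The
    condition stands under the quantifier so that [K] is defined for every [T] and [m0], before any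
    [al] is known. *)
Lemma relation_order (J : finType) (mu : J -> 'X_{1..n * n}) (T : {set J * J}) (m0 : 'X_{1..n * n}) :
  exists2 K, (0 < K)%N &
    (forall a, (forall p, p \in T -> wtz a (mu p.1) = wtz a (mu p.2)) -> wtz a m0 = 0) ->
    forall al : 'I_n -> F, (forall i, al i != 0) ->
      (forall p, p \in T -> mwt al (mu p.1) = mwt al (mu p.2)) -> mwt al m0 ^+ K = 1.
Proof.
have [T0|nT] := pselect (forall a, (forall p, p \in T -> wtz a (mu p.1) = wtz a (mu p.2)) -> wtz a m0 = 0); last by exists 1%N.
pose D (p : J * J) i : int := (colexp (mu p.1) i)%:Z - (colexp (mu p.2) i)%:Z.
pose A := \matrix_(t < #|T|, i < n) ((D (enum_val t) i)%:~R : rat).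
pose e0 := \row_(i < n) ((colexp m0 i)%:R : rat).
have /submxP[u e0u] : (e0 <= A)%MS.
  rewrite submxE; apply/eqP/rowP => j; rewrite [RHS]mxE.
  move: (cokermx A) (mulmx_coker A) => Ck ACk; pose a i := Ck i j.
  have Aa : A *m col j Ck = 0 by rewrite -col_mulmx ACk; apply/colP => i; rewrite !mxE.
  rewrite -[RHS](T0 a) => [|p pT].
    by rewrite wtz_colexp mxE; apply: eq_bigr => i _; rewrite mxE.
  apply/eqP; rewrite -subr_eq0 !wtz_colexp -sumrB; apply/eqP.
  have /colP/(_ (enum_rank_in pT p)) := Aa; rewrite !mxE => {2}<-.
  apply: eq_bigr => i _; rewrite !mxE enum_rankK_in // -mulrBl /D rmorphB /=.
  by rewrite -!pmulrn.
have [K K0 [k kP]] : exists2 K : nat, (0 < K)%N & exists k : 'I_#|T| -> int,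
    forall i, (K * colexp m0 i)%N%:Z = \sum_t k t * D (enum_val t) i.
  have [K [N [e [K0 eE]]]] := common_denominator (u 0).
  exists K => //; exists (fun t => N%:Z - (e t)%:Z) => i; apply: (@intr_inj rat).
  have /rowP/(_ i) := e0u; rewrite !mxE => e0i.
  rewrite -pmulrn natrM e0i mulr_sumr rmorph_sum; apply: eq_bigr => t _.
  by rewrite rmorphM rmorphB /= -!pmulrn eE opprB addrC subrK mxE mulrA.
exists K => // _ al al0 alT.
have -> : mwt al m0 ^+ K = \prod_i al i ^ (\sum_t k t * D (enum_val t) i).
  rewrite mwt_colexp -prodrXl; apply: eq_bigr => i _.
  by rewrite -kP -exprnP -exprM mulnC.
transitivity (\prod_t \prod_i (al i ^ (k t * D (enum_val t) i))).
  rewrite exchange_big; apply: eq_bigr => i _.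
  apply: (big_morph (fun z => al i ^ z)) => [z z'|]; last by rewrite expr0z.
  by rewrite expfzDr.
rewrite big1 // => t _; have := alT _ (enum_valP t); rewrite !mwt_colexp => e.
transitivity ((\prod_i al i ^ D (enum_val t) i) ^ k t).
  rewrite (big_morph (fun x => x ^ k t) (id1 := 1) (op1 := *%R)) ?exp1rz //.
    by apply: eq_bigr => i _; rewrite exprz_exp mulrC.
  by move=> x y; rewrite expfzMl.
rewrite (_ : \prod_i _ = 1) ?exp1rz // /D.
under eq_bigr => i _ do rewrite expfzDr // -exprnP -exprnN.
by rewrite big_split prodfV /= e divff //; apply/prodf_neq0 => i _; rewrite expf_neq0.
Qed.
End MonomialRelations.

Section Observable2.
Variables (F : fieldType) (n : nat) (qF : {rmorphism rat -> F}).
Hypothesis F_closed : GRing.closed_field_axiom F.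
Variables (G : 'M[F]_n -> Prop) (G_group : is_subgroup G).
Let F0 := pchar_ratr_morph qF.
Local Notation Pol := {mpoly F[n * n]}.
Local Notation mC := (@mpolyC (n * n) F).

(** As long as the common kernel of the tests exceeds [Lie G], a new test lowers its dimension.
    Finitely many tests leave a bound on the degrees to be considered. *)
Lemma Lie_finite_tests : exists s : seq Pol, (forall f, f \in s -> van G f) /\
  forall x, (forall f, f \in s -> devalm 1%:M x f = 0) -> Lie G x.
Proof.
have HU (s : seq Pol) : exists U : {vspace 'M[F]_n},
    forall x, (x \in U) <-> (forall f, f \in s -> devalm 1%:M x f = 0).
  apply: vspace_of_pred => [f _|a x y hx hy f fs].
    by rewrite /devalm -[0](subrr 1%:M) addrC -scaleN1r dmev_linear mulN1r addNr.
  by rewrite devalm_scalar hx // hy // mulr0 addr0.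
suff H d (s : seq Pol) (U : {vspace 'M[F]_n}) : (\dim U <= d)%N -> (forall f, f \in s -> van G f) ->
    (forall x, (x \in U) <-> (forall f, f \in s -> devalm 1%:M x f = 0)) ->
    exists s : seq Pol, (forall f, f \in s -> van G f) /\
      forall x, (forall f, f \in s -> devalm 1%:M x f = 0) -> Lie G x.
  by have [U UP] := HU [::]; apply: (H (\dim U) [::] U).
elim: d s U => [|d IHd] s U dU sv UP.
  exists s; split=> // x /UP; move: dU; rewrite leqn0 dimv_eq0 => /eqP ->.
  by rewrite memv0 => /eqP ->; exact: Lie0.
have [done|ndone] := pselect (forall x, x \in U -> Lie G x).
  by exists s; split=> // x /UP; exact: done.
have [x xU [f vf fx]] : exists2 x, x \in U & exists2 f, van G f & devalm 1%:M x f <> 0.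
  apply: contrapT => nx; apply: ndone => x xU; apply/LieE => f vf.
  by apply: contrapT => fx; apply: nx; exists x => //; exists f.
have [U' UP'] := HU (f :: s).
apply: (IHd (f :: s) U') => //; last by move=> g; rewrite inE => /predU1P[->//|/sv].
have U'U : (U' <= U)%VS.
  by apply/subvP => y /UP' yP; apply/UP => g gs; apply: yP; rewrite inE gs orbT.
rewrite -ltnS (leq_trans _ dU) // ltn_neqAle dimvS // andbT; apply/eqP => e.
have eU : U' = U by apply/eqP; rewrite eqEdim U'U e /=.
by apply: fx; move: xU; rewrite -eU => /UP'; apply; rewrite mem_head.
Qed.

(** Let [al] be the eigenvalues of [M], and [T] their multiplicative relations in degree at most
    [d]. A rational solution of the additive form of these relations gives a replica that acts on
    the tests as a polynomial in [Rm M], so it lies in [Lie G] and kills [q]: the weight of [m0],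
    where [chi M = mwt al m0], vanishes on all such solutions. The resulting exponent depends only
    on [T] and [m0], which range over a finite set, so the product serves every [M]. *)
Lemma finite_order (q : Pol) (chi : 'M[F]_n -> F) : q != 0 -> semiinv G q chi ->
  (forall y, Lie G y -> Dm y q = 0) ->
  exists2 K, (0 < K)%N & forall M, G M -> chi M ^+ K = 1.
Proof.
move=> q0 qchi Dq; have [s [sv sLie]] := Lie_finite_tests.
pose d := (msize q + \sum_(f <- s) msize f)%N.
have degq m : m \in msupp q -> (mdeg m <= d)%N.
  by move/msize_mdeg_lt/ltnW/leq_trans; apply; rewrite leq_addr.
have degs f : f \in s -> forall m, m \in msupp f -> (mdeg m <= d)%N.
  move=> fs m /msize_mdeg_lt/ltnW/leq_trans; apply.
  by rewrite /d (big_rem f) //= addnCA leq_addr.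
pose J := bmultinom (n * n) d.+1; pose mu (j : J) : 'X_{1..n * n} := bmnm j.
pose K (p : {set J * J} * J) : nat := s2val (cid2 (@relation_order F n J mu p.1 (mu p.2))).
exists (\prod_p K p)%N => [|M HM].
  by apply: prodn_gt0 => p; rewrite /K; case: cid2.
have [P [al MP]] := geneigen_basis_exists F_closed M; have [Pu Mal] := MP.
have Mu := subgroup_unit G_group HM.
have al0 i : al i != 0.
  apply/eqP => ali; have := Mal i; rewrite ali subr0.
  have Xn k : papply (mulmx M) ('X ^+ k) (col i P) = M ^+ k *m col i P.
    elim: k => [|k IHk]; first by rewrite !expr0 -[1]/(1%:P) papplyC scale1r mul1mx.
    by rewrite exprS papplyM IHk -['X]mul1r papplyMX -[1]/(1%:P) papplyC scale1r /= exprS -mulmxE mulmxA.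
  rewrite Xn; have Mnu : M ^+ n \in unitmx.
    by elim: (n in M ^+ n) => [|k IHk]; rewrite ?expr0 ?unitmx1 // exprS -mulmxE unitmx_mul Mu.
  move/(congr1 (mulmx (invmx (M ^+ n)))); rewrite mulKmx // mulmx0 => ci.
  have /colP/(_ i) := col_mulmx (invmx P) P i; rewrite ci mulmx0 mulVmx // !mxE eqxx.
  by move/eqP; rewrite oner_eq0.
pose T := [set p : J * J | mwt al (mu p.1) == mwt al (mu p.2)].
have relT a : (forall p, p \in T -> wtz a (mu p.1) = wtz a (mu p.2)) ->
    forall m m', (mdeg m <= d)%N -> (mdeg m' <= d)%N -> mwt al m = mwt al m' ->
    wt (fun i => qF (a i)) m = wt (fun i => qF (a i)) m'.
  move=> aT m m'; rewrite -ltnS => md; rewrite -ltnS => md' e; rewrite !wt_rat; congr (qF _).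
  by apply: (aT (BMultinom md, BMultinom md')); rewrite inE /mu /= e.
(* The zero family satisfies all relations; it is used only to extract a monomial with the
   eigenvalue [chi M]. *)
have [m0 m0d [chim0 _]] : exists2 m, (mdeg m <= d)%N & chi M = mwt al m /\ True.
  have z (m : 'X_{1..n * n}) : wtz (fun=> 0) m = 0 by rewrite wtz_colexp big1 // => i _; rewrite mulr0.
  have rel0 := relT (fun=> 0) (fun p _ => etrans (z _) (esym (z _))).
  have [m md [e _]] := Rm_replica_eigen MP degq rel0 q0 (qchi M HM).
  by exists m.
have e1 : mwt al m0 ^+ K (T, BMultinom (m0d : (mdeg m0 < d.+1)%N)) = 1.
  rewrite /K; case: cid2 => /= K0 _; apply=> // [a aT|p]; last by rewrite inE => /eqP.
  pose th i := qF (a i).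
  have LT : Lie G (rep P th).
    apply: sLie => f fs; have [r e] := Rm_replica MP (th := th) (degs f fs) (relT a aT).
    rewrite -[rep P th]mul1mx -evalm_Dm e.
    by apply: van_papply (sv f fs) _ _; [move=> g; exact: van_Rm | exact: subgroup_one].
  have [m' m'd [em' Dm']] := Rm_replica_eigen MP (th := th) degq (relT a aT) q0 (qchi M HM).
  apply/eqP; rewrite -(fmorph_eq0 qF) -wt_rat (relT a aT m0 m') // -?chim0 -?em' //.
  have /eqP := Dq _ LT; rewrite Dm' scaler_eq0 => /orP[//|/eqP qz].
  by move: q0; rewrite qz eqxx.
rewrite (bigD1 (T, BMultinom (m0d : (mdeg m0 < d.+1)%N))) //= exprM chim0.
by rewrite [X in X ^+ _]e1 expr1n.
Qed.

Definition weighted (f : Pol) (chi c : 'M[F]_n -> F) : Prop :=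
  semiinv G f chi /\ forall y, Lie G y -> Dm y f = c y *: f.

Lemma weighted1 : weighted 1 (fun=> 1) (fun=> 0).
Proof. by split=> [M _|y _]; rewrite ?rmorph1 ?scale1r // Dm1 scale0r. Qed.

Lemma weightedM f g chi psi c e : weighted f chi c -> weighted g psi e ->
  weighted (f * g) (fun M => chi M * psi M) (fun y => c y + e y).
Proof.
move=> [fM fc] [gM gc]; split=> [M HM|y Ly].
  by rewrite rmorphM /= fM // gM // -scalerAl -scalerAr scalerA.
by rewrite DmM fc // gc // -scalerAl -scalerAr scalerDl.
Qed.

Lemma weightedX f chi c k : weighted f chi c ->
  weighted (f ^+ k) (fun M => chi M ^+ k) (fun y => c y *+ k).
Proof.
move=> fw; elim: k => [|k IHk].
  have -> : (fun M => chi M ^+ 0) = fun=> 1 by apply: funext => M; rewrite expr0.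
  have -> : (fun y => c y *+ 0) = fun=> 0 by apply: funext => y; rewrite mulr0n.
  by rewrite expr0; exact: weighted1.
have -> : (fun M => chi M ^+ k.+1) = fun M => chi M * chi M ^+ k.
  by apply: funext => M; rewrite exprS.
have -> : (fun y => c y *+ k.+1) = fun y => c y + c y *+ k.
  by apply: funext => y; rewrite mulrS.
by rewrite exprS; exact: weightedM.
Qed.

Lemma weighted_prod T (f : 'I_T -> Pol) chi c : (forall t, weighted (f t) (chi t) (c t)) ->
  weighted (\prod_t f t) (fun M => \prod_t chi t M) (fun y => \sum_t c t y).
Proof.
move=> fw; elim: T f chi c fw => [|T IHT] f chi c fw.
  have -> : (fun M => \prod_(t < 0) chi t M) = fun=> 1 by apply: funext => M; rewrite big_ord0.
  have -> : (fun M => \sum_(t < 0) c t M) = fun=> 0 by apply: funext => M; rewrite big_ord0.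
  by rewrite big_ord0; exact: weighted1.
have -> : (fun M => \prod_t chi t M) = fun M => chi ord0 M * \prod_t chi (lift ord0 t) M.
  by apply: funext => M; rewrite big_ord_recl.
have -> : (fun M => \sum_t c t M) = fun M => c ord0 M + \sum_t c (lift ord0 t) M.
  by apply: funext => M; rewrite big_ord_recl.
by rewrite big_ord_recl; apply: weightedM => //; exact: IHT.
Qed.

(* The determinant of [X] compressed to the image of the projection [Pi]. *)
Definition corner_det (Pi : 'M[F]_n) : Pol :=
  \det (map_mx mC Pi *m gmx *m map_mx mC Pi + map_mx mC (1%:M - Pi)).

Lemma mev_corner_det (S : comNzRingType) (h : {rmorphism F -> S}) Pi N :
  mev h N (corner_det Pi) = \det (map_mx h Pi *m N *m map_mx h Pi + map_mx h (1%:M - Pi)).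
Proof. by rewrite /corner_det -det_map_mx map_mxD !map_mxM map_gmx !map_mevC. Qed.

Lemma evalm_corner_det Pi N : evalm N (corner_det Pi) = \det (Pi *m N *m Pi + (1%:M - Pi)).
Proof. by rewrite /evalm mev_corner_det !map_mx_idfun. Qed.

Lemma evalm1_corner_det Pi : Pi *m Pi = Pi -> evalm 1%:M (corner_det Pi) = 1.
Proof. by move=> PP; rewrite evalm_corner_det mulmx1 PP addrC subrK det1. Qed.

Lemma corner_det_semiinv Pi : Pi *m Pi = Pi -> (forall M, G M -> M *m Pi = Pi *m M) ->
  semiinv G (corner_det Pi) (fun M => evalm M (corner_det Pi)).
Proof.
move=> PP GP M HM; apply: evalm_eq => // N; rewrite evalmZ evalm_Rm !evalm_corner_det mulrC -det_mulmx.
have PQ : Pi *m (1%:M - Pi) = 0 by rewrite mulmxBr mulmx1 PP subrr.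
have QP : (1%:M - Pi) *m Pi = 0 by rewrite mulmxBl mul1mx PP subrr.
have QQ : (1%:M - Pi) *m (1%:M - Pi) = 1%:M - Pi by rewrite mulmxBl mul1mx PQ subr0.
move: (1%:M - Pi) PQ QP QQ => Q PQ QP QQ; congr (\det _).
have PMP : Pi *m M *m Pi = Pi *m M by rewrite -mulmxA (GP M HM) mulmxA PP.
have e1 : Pi *m N *m Pi *m Q = 0 by rewrite -mulmxA PQ mulmx0.
have e2 : Q *m (Pi *m M *m Pi) = 0 by rewrite !mulmxA QP !mul0mx.
rewrite mulmxDl !mulmxDr e1 e2 QQ addr0 add0r; congr (_ + _).
by rewrite PMP -!mulmxA; congr (Pi *m (N *m _)); rewrite (GP M HM) mulmxA PP.
Qed.

Lemma devalm_corner_det Pi y : Pi *m Pi = Pi -> devalm 1%:M y (corner_det Pi) = \tr (Pi *m y).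
Proof.
move=> PP; rewrite /devalm -mev_taylor1 (mev_corner_det (polyC \o idfun)).
have cE (Z : 'M[F]_n) : map_mx (polyC \o idfun) Z = map_mx polyC Z by [].
rewrite !cE mulmxDr mulmxDl -scalemxAr -scalemxAl -!map_mxM mulmx1 PP addrAC -map_mxD.
by rewrite [Pi + _]addrC subrK map_mx1 det_taylor mxtrace_mulC mulmxA PP.
Qed.

Lemma corner_det_weighted Pi : Pi *m Pi = Pi -> (forall M, G M -> M *m Pi = Pi *m M) ->
  weighted (corner_det Pi) (fun M => evalm M (corner_det Pi)) (fun y => \tr (Pi *m y)).
Proof.
move=> PP GP; have sP := corner_det_semiinv PP GP; split=> // y Ly.
have p0 : corner_det Pi != 0.
  by apply/eqP => p0; have := evalm1_corner_det PP; rewrite p0 rmorph0 => /esym/eqP; rewrite oner_eq0.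
have [dchi [_ /(_ y Ly) Dy]] := semiinv_Lie F0 p0 sP.
rewrite Dy -(devalm_corner_det y PP); congr (_ *: _).
have := congr1 (evalm 1%:M) Dy; rewrite evalm_Dm mul1mx evalmZ evalm1_corner_det // mulr1.
by move=> ->.
Qed.

Hypothesis G_det : forall M, G M -> \det M = 1.
Hypothesis G_closed : forall M, M \in unitmx -> (forall f, van G f -> evalm M f = 0) -> G M.
Hypothesis G_reductive : reductive G.

(* A power of [w] times corner determinants of spectral projections of the central
   element dual to [chi] has trivial differential weight, hence weight of finite order. *)
Lemma observable w chi : w != 0 -> semiinv G w chi ->
  exists2 b : Pol, b != 0 & forall M, G M -> chi M *: Rm M b = b.
Proof.
move=> w0 wchi; have [dchi [dchi_lin w_dchi]] := semiinv_Lie F0 w0 wchi.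
have [P [r [Pu Lz Gz zP]]] := central_dual qF F_closed G_group G_det G_closed G_reductive w0 wchi dchi_lin w_dchi.
have [m [A [e [m0 eE]]]] := common_denominator r.
pose T := (\sum_i e i)%N.
(* The projection onto the columns [i] of [P] with [e i > t]; over all [t], column [i] is counted
   [e i] times. *)
pose Pi (t : 'I_T) := rep P (fun i => (t < e i)%N%:R).
have PP t : Pi t *m Pi t = Pi t.
  rewrite repM //; apply: eq_rep => // i; by case: (_ < _)%N; rewrite ?mulr0 ?mulr1.
have GP t M : G M -> M *m Pi t = Pi t *m M.
  move=> HM; apply: comm_rep (Gz M HM) => // i j /fmorph_inj rij; congr (_%:R).
  suff -> : e i = e j by [].
  by apply: (natr_inj (R := rat)); [exact: Num.Theory.pchar_num | rewrite /= !eE rij].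
have sumPi : \sum_t Pi t = rep P (fun i => (e i)%:R).
  apply: (eq_col_basis Pu) => i; rewrite mulmx_suml rep_col //.
  under eq_bigr do rewrite rep_col //.
  rewrite -scaler_suml; congr (_ *: _); rewrite -natr_sum; congr (_%:R).
  have eT : (e i <= T)%N by rewrite /T (bigD1 i) //= leq_addr.
  rewrite -[RHS]card_ord -sum1_card (big_ord_widen T (fun=> 1%N) eT) [RHS]big_mkcond.
  by apply: eq_bigr => t _; case: ltnP.
pose delta := \prod_t corner_det (Pi t); pose dw M := \prod_t evalm M (corner_det (Pi t)).
have dwt : weighted delta dw (fun y => \sum_t \tr (Pi t *m y)).
  by apply: weighted_prod => t; exact: (corner_det_weighted (PP t) (fun M HM => GP t M HM)).
have wwt : weighted w chi dchi by [].
have [qM qD] := weightedM (weightedX m wwt) dwt.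
have delta0 : delta != 0.
  apply/prodf_neq0 => t _; apply/eqP => p0; have := evalm1_corner_det (PP t).
  by rewrite p0 rmorph0 => /esym/eqP; rewrite oner_eq0.
have q0 : w ^+ m * delta != 0 by rewrite mulf_neq0 // expf_neq0.
(* The differential weight of the product is [m] times [dchi] plus the trace against [A - m z],
   where [z] is dual to [dchi]; the scalar [A] is orthogonal to [Lie G], so the sum vanishes. *)
have [|K K0 KP] := finite_order q0 qM.
  move=> y Ly; rewrite qD // (_ : _ + _ = 0) ?scale0r //.
  rewrite -raddf_sum -mulmx_suml sumPi.
  have -> : rep P (fun i => (e i)%:R) = A%:R%:M - m%:R *: rep P (fun i => qF (r i)).
    rewrite -(rep_const Pu) -scaleN1r scalerA addrC rep_linear //; apply: eq_rep => // i.
    by rewrite -(rmorph_nat qF) eE rmorphB rmorphM !rmorph_nat mulN1r mulNr addrC.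
  rewrite mulmxBl mul_scalar_mx -scalemxAl raddfB /= !mxtraceZ zP // (tr_Lie G_det Ly).
  by rewrite mulr0 sub0r mulr_natl subrr.
(* One factor [w] is left out of the invariant [(w ^+ m * delta) ^+ K]. *)
exists (w ^+ (m * K).-1 * delta ^+ K) => [|M HM].
  by rewrite mulf_neq0 ?expf_neq0.
rewrite rmorphM !rmorphXn /= wchi // dwt.1 // !exprZn -scalerAl -scalerAr !scalerA.
by rewrite -exprS prednK ?muln_gt0 ?m0 // exprM -exprMn KP // scale1r.
Qed.
End Observable2.

(** * The Nullstellensatz *)


Definition is_ideal (R : comNzRingType) (J : R -> Prop) : Prop :=
  [/\ J 0, forall f g, J f -> J g -> J (f + g) & forall f g, J g -> J (f * g)].

Definition is_prime_ideal (R : comNzRingType) (J : R -> Prop) : Prop :=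
  [/\ is_ideal J, ~ J 1 & forall f g, J (f * g) -> J f \/ J g].

Lemma ideal_sub (R : comNzRingType) (J : R -> Prop) f g : is_ideal J -> J f -> J g -> J (f - g).
Proof. by move=> [_ JD JM] Jf Jg; rewrite -mulN1r; apply: JD => //; exact: JM. Qed.

Lemma ideal_sum (R : comNzRingType) (J : R -> Prop) I (r : seq I) (P : pred I) (f : I -> R) :
  is_ideal J -> (forall i, P i -> J (f i)) -> J (\sum_(i <- r | P i) f i).
Proof. by move=> [J0 JD _] Jf; apply: big_ind. Qed.

Lemma prime_exp (R : comNzRingType) (J : R -> Prop) f m : is_prime_ideal J -> J (f ^+ m) -> J f.
Proof.
move=> [Ji J1 Jp]; elim: m => [|m IHm]; first by rewrite expr0.
by rewrite exprS => /Jp[//|/IHm].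
Qed.

Lemma minimal_size (R : nzRingType) (S : {poly R} -> Prop) : (exists p, S p) ->
  exists2 p, S p & forall q, S q -> (size p <= size q)%N.
Proof.
move=> [p Sp]; move: {2}(size p) (leqnn (size p)) => m; elim: m p Sp => [|m IHm] p Sp pm.
  by exists p => // q _; move: pm; rewrite leqn0 => /eqP ->.
have [[q Sq qp]|nq] := pselect (exists2 q, S q & (size q < size p)%N).
  by apply: (IHm q) => //; rewrite -ltnS (leq_trans qp).
by exists p => // q Sq; rewrite leqNgt; apply/negP => qp; apply: nq; exists q.
Qed.

Section PolyPrime.
Variables (R : idomainType) (Q : {poly R} -> Prop).
Hypothesis Q_prime : is_prime_ideal Q.
Implicit Types (p q r s u : {poly R}).

Let Q0 (c : R) := Q c%:P.
(** Zero modulo the contraction of [Q] to [R]. The quotient and its fraction field are never formed: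
    division there becomes pseudo-division, and equalities hold up to [qnull]. *)
Definition qnull p := forall i, Q0 p`_i.

Lemma Q0_prime : is_prime_ideal Q0.
Proof.
have [[Qz QD QM] Q1 Qp] := Q_prime; split.
- split=> [|f g|f g]; rewrite /Q0; [by rewrite polyC0 | by rewrite polyCD; apply: QD|].
  by rewrite polyCM; apply: QM.
- by rewrite /Q0 polyC1.
- by move=> f g; rewrite /Q0 polyCM => /Qp.
Qed.

Lemma qnull_Q p : qnull p -> Q p.
Proof.
move=> pn; have [Qi _ _] := Q_prime; have [_ _ QM] := Qi.
rewrite -[p]coefK poly_def; apply: (@ideal_sum _ Q) => // i _.
by rewrite -mul_polyC mulrC; apply: QM; exact: pn.
Qed.

Lemma qnull_sub p q : qnull p -> qnull q -> qnull (p - q).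
Proof. by move=> pn qn i; rewrite coefB; apply: ideal_sub => //; case: Q0_prime. Qed.

Lemma qnullM p q : qnull q -> qnull (p * q).
Proof.
have [[Q00 QD QM] _ _] := Q0_prime => qn i; rewrite coefM.
by apply: big_ind => // j _; exact: QM.
Qed.

Lemma qnullXn c m : Q0 c -> qnull (c%:P * 'X^m).
Proof.
have [[Q00 QD QM] _ _] := Q0_prime => Qc i; rewrite coefCM coefXn mulrC; exact: QM.
Qed.

Definition drop_lead p := p - (lead_coef p)%:P * 'X^((size p).-1).

Lemma size_drop_lead p : p != 0 -> (size (drop_lead p) < size p)%N.
Proof.
move=> p0; have sp : (size p).-1.+1 = size p by rewrite prednK ?size_poly_gt0.
rewrite -[X in (_ < X)%N]sp ltnS; apply/leq_sizeP => j; rewrite leq_eqVlt coefB coefCM coefXn.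
case/predU1P => [<-|jp]; first by rewrite eqxx mulr1 lead_coefE subrr.
by rewrite gtn_eqF // mulr0 subr0 nth_default // -sp.
Qed.

Lemma lead_minimal (S : {poly R} -> Prop) p : p != 0 -> S p ->
  (forall q, S q -> (size p <= size q)%N) -> (Q0 (lead_coef p) -> S (drop_lead p)) ->
  ~ Q0 (lead_coef p).
Proof. by move=> p0 Sp pmin dS /dS/pmin; rewrite leqNgt size_drop_lead. Qed.

Let pdiv p q : exists k, exists r, exists c,
  [/\ (lead_coef q ^+ k)%:P * p = c * q + r, q != 0 -> (size r < size q)%N
    & q != 0 -> size c = (size p - (size q).-1)%N].
Proof.
exists (scalp p q), (p %% q), (p %/ q); split.
- by rewrite mul_polyC Pdiv.Idomain.divp_eq.
- by move=> q0; rewrite ltn_modp.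
- by move=> q0; rewrite size_divp.
Qed.

Section Algebraic.
Variable p : {poly R}.
Hypothesis Qp : Q p.
Hypothesis p_lead : ~ Q0 (lead_coef p).
Hypothesis p_min : forall q, Q q -> ~ qnull q -> (size p <= size q)%N.

Lemma alg_neq0 : p != 0.
Proof. by apply/eqP => p0; apply: p_lead; rewrite p0 lead_coef0; case: Q0_prime => -[]. Qed.

Lemma small_null q : Q q -> (size q < size p)%N -> qnull q.
Proof. by move=> Qq; rewrite ltnNge => /negP qp; apply: contrapT => /(p_min Qq). Qed.

Lemma alg_divides f : Q f -> exists k c r, (lead_coef p ^+ k)%:P * f = c * p + r /\ qnull r.
Proof.
move=> Qf; have [k [r [c [e sr _]]]] := pdiv f p; exists k, c, r; split=> //.
apply: small_null (sr alg_neq0); have [Qi _ _] := Q_prime; have [_ _ QM] := Qi.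
have -> : r = (lead_coef p ^+ k)%:P * f - c * p by rewrite e [_ + r]addrC addrK.
by apply: ideal_sub Qi _ _; apply: QM.
Qed.

(** Over the fraction field of the quotient of [R] by the contraction, [b] is prime to [p].
    Concretely, a combination [s] of [b] and [p] outside [Q], of least size, is constant: otherwise
    dividing [s] by [p], or [p] by [s], contradicts the minimality of [s] or the choice of [p]. *)
Lemma alg_resultant b : ~ Q b -> exists c u v z,
  [/\ ~ Q0 c, c%:P = u * b + v * p + z & qnull z].
Proof.
move=> nQb; have [Qi Q1 Qpr] := Q_prime; have [Qz QD QM] := Qi.
pose S s := ~ Q s /\ exists u v z, s = u * b + v * p + z /\ qnull z.
have n0 : qnull 0 by move=> i; rewrite coef0; case: Q0_prime => -[].
have [|s [nQs [u [v [z [sE zn]]]]] smin] := @minimal_size _ S.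
  by exists b; split=> //; exists 1, 0, 0; rewrite mul1r mul0r !addr0.
have s0 : s != 0 by apply/eqP => s0; apply: nQs; rewrite s0.
have sl : ~ Q0 (lead_coef s).
  apply: (lead_minimal (S := S)) => // [|Ql]; first by split=> //; exists u, v, z.
  have ln := qnullXn (size s).-1 Ql.
  split=> [Qd|]; first by apply: nQs; rewrite -(subrK ((lead_coef s)%:P * 'X^((size s).-1)) s); apply: QD => //; exact: qnull_Q.
  exists u, v, (z - (lead_coef s)%:P * 'X^((size s).-1)); split; last exact: qnull_sub.
  by rewrite /drop_lead {1}sE addrA.
have [ss|ss] := leqP (size s) 1.
  exists s`_0, u, v, z; rewrite -(size1_polyC ss); split=> // Qs; apply: nQs.
  by rewrite (size1_polyC ss).
exfalso; have [ps|sp] := leqP (size p) (size s).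
  have [k [r [c [e sr _]]]] := pdiv s p.
  have : S r.
    split=> [Qr|].
      have : Q ((lead_coef p ^+ k)%:P * s) by rewrite e; apply: QD => //; exact: QM.
      by case/Qpr => // /(prime_exp Q0_prime).
    exists ((lead_coef p ^+ k)%:P * u), ((lead_coef p ^+ k)%:P * v - c), ((lead_coef p ^+ k)%:P * z).
    split; last exact: qnullM.
    by apply: (addrI (c * p)); rewrite -e sE; ring.
  by move/smin; rewrite leqNgt (leq_trans (sr alg_neq0)).
have [k [r [c [e sr sc]]]] := pdiv p s.
have rE : r = (- c * u) * b + ((lead_coef s ^+ k)%:P - c * v) * p + (- c * z).
  by apply: (addrI (c * s)); rewrite -e sE; ring.
have Qr : Q r.
  apply: contrapT => nQr; have : S r.
    by split=> //; exists (- c * u), ((lead_coef s ^+ k)%:P - c * v), (- c * z); split=> //; exact: qnullM.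
  by move/smin; rewrite leqNgt sr.
have rn : qnull r by apply: small_null => //; exact: ltn_trans (sr s0) sp.
have cn : qnull c.
  apply: small_null; last first.
    rewrite sc // ltn_subrL -subn1 subn_gt0 ss /=.
    by rewrite size_poly_gt0 alg_neq0.
  have : Q (c * s).
    have -> : c * s = (lead_coef s ^+ k)%:P * p - r by rewrite e addrK.
    by apply: ideal_sub Qi _ Qr; apply: QM.
  by case/Qpr.
have : qnull ((lead_coef s ^+ k)%:P * p).
  rewrite e -[r]opprK; apply: qnull_sub; first by rewrite mulrC; exact: qnullM.
  by rewrite -mulN1r; exact: qnullM.
move/(_ (size p).-1); rewrite coefCM -lead_coefE.
by case: Q0_prime => _ _ H /H[/(prime_exp Q0_prime)|].
Qed.

End Algebraic.

(** The class of the variable is transcendental or algebraic over the quotient of [R] by the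
    contraction; in the second case [p] plays the part of a minimal polynomial. *)
Lemma prime_dichotomy : (forall p, Q p -> qnull p) \/
  exists p, [/\ Q p, ~ Q0 (lead_coef p), (1 < size p)%N &
    forall q, Q q -> ~ qnull q -> (size p <= size q)%N].
Proof.
have [|np] := pselect (forall p, Q p -> qnull p); [by left | right].
have [Qi _ _] := Q_prime.
have [|p [Qp pn] pmin] := @minimal_size _ (fun p => Q p /\ ~ qnull p).
  apply: contrapT => nex; apply: np => p Qp; apply: contrapT => pn.
  by apply: nex; exists p.
have p0 : p != 0.
  by apply/eqP => p0; apply: pn => i; rewrite p0 coef0; case: Q0_prime => -[].
have pl : ~ Q0 (lead_coef p).
  apply: (lead_minimal (S := fun p => Q p /\ ~ qnull p)) => // Ql.
  have ln := qnullXn (size p).-1 Ql; split.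
    by apply: ideal_sub => //; exact: qnull_Q.
  move=> dn; apply: pn; rewrite -(subrK ((lead_coef p)%:P * 'X^((size p).-1)) p) -[X in _ + X]opprK.
  by apply: qnull_sub => //; rewrite -mulN1r; exact: qnullM.
exists p; split=> // [|q Qq qn]; last by apply: pmin.
rewrite ltnNge; apply/negP => sp; apply: pl.
by rewrite (size1_polyC sp) lead_coefC /Q0 -(size1_polyC sp).
Qed.

End PolyPrime.

Lemma comap_prime (R S : comNzRingType) (g : {rmorphism R -> S}) (Q : S -> Prop) :
  is_prime_ideal Q -> is_prime_ideal (fun x => Q (g x)).
Proof.
move=> [[Q0 QD QM] Q1 Qp]; split.
- split=> [|x y|x y]; first by rewrite rmorph0.
    by rewrite rmorphD; exact: QD.
  by rewrite rmorphM; exact: QM.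
- by rewrite rmorph1.
- by move=> x y; rewrite rmorphM; exact: Qp.
Qed.

Section Nullstellensatz.
Variable F : fieldType.
Hypothesis F_closed : GRing.closed_field_axiom F.
Hypothesis F0 : [pchar F] =i pred0.

Lemma poly_nonroot (p : {poly F}) : p != 0 -> exists t, p.[t] != 0.
Proof.
move=> p0; apply: contrapT => np; case/eqP: p0; apply: poly_natroots => // j.
by apply: contrapT => /eqP pj; apply: np; exists j%:R.
Qed.

(** Induction on the number of variables. All but the last are specialized so that an element
    outside the contraction stays nonzero: a coefficient of [b] in the transcendental case; in the
    algebraic case, the leading coefficient of [p] times a combination [c] of [b] and [p]. The last
    variable then becomes a nonroot of [b], or a root of [p]. *)
Lemma prime_nullstellensatz N (Q : {mpoly F[N]} -> Prop) b : is_prime_ideal Q -> ~ Q b ->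
  exists v : 'I_N -> F, (forall f, Q f -> f.@[v] = 0) /\ b.@[v] != 0.
Proof.
elim: N Q b => [|N IHN] Q b Qprime Qb; have [[Q0 QD QM] Q1 Qp] := Qprime.
  have mc (f : {mpoly F[0]}) : f = (f@_0)%:MP.
    apply/mpolyP => m; rewrite mcoeffC (_ : m = 0%MM) ?eqxx ?mulr1 //.
    by apply/mnmP => -[].
  exists (fun=> 0); split=> [f Qf|].
    rewrite (mc f) mevalC; apply: contrapT => /eqP fn; apply: Q1.
    have -> : 1 = ((f@_0)^-1)%:MP_[0] * f by rewrite {2}(mc f) -mpolyCM mulVf.
    exact: QM.
  by rewrite (mc b) mevalC; apply/eqP => b0; apply: Qb; rewrite (mc b) b0 mpolyC0.
pose Q' (p : {poly {mpoly F[N]}}) := Q (mjoin p).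
have Q'prime : is_prime_ideal Q' by exact: comap_prime Qprime.
have Q'0 := Q0_prime Q'prime.
pose w (v : 'I_N -> F) t (i : 'I_N.+1) := if unlift ord_max i is Some j then v j else t.
have evw v t f : f.@[w v t] = (map_poly (meval v) (msplit f)).[t].
  rewrite -{1}[f]msplitK /meval mmap_mjoin /w unlift_none.
  congr (_.[_]); apply: eq_map_poly => g; apply: eq_mmap => // i.
  have -> : widen_ord (leqnSn N) i = lift ord_max i.
    by apply/val_inj; rewrite /= /bump leqNgt ltn_ord.
  by rewrite liftK.
have Q'split f : Q f -> Q' (msplit f) by rewrite /Q' msplitK.
have nullv v (vP : forall g, Q' g%:P -> g.@[v] = 0) p : qnull Q' p -> map_poly (meval v) p = 0.
  by move=> pn; apply/polyP => i; rewrite coef_map coef0; apply: vP; exact: pn.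
case: (prime_dichotomy Q'prime) => [alln|[p [Qp' pl sp pmin]]].
  have [i bi] : exists i, ~ Q' ((msplit b)`_i)%:P.
    apply: contrapT => nb; apply: Qb; rewrite -[b]msplitK; apply: (qnull_Q Q'prime) => i.
    by apply: contrapT => bi; apply: nb; exists i.
  have [v [vP vb]] := IHN _ _ Q'0 bi.
  have [|t tP] := @poly_nonroot (map_poly (meval v) (msplit b)).
    by apply: contraNneq vb => /(congr1 (fun q : {poly F} => q`_i)); rewrite coef_map coef0 => ->.
  exists (w v t); split=> [f Qf|]; last by rewrite evw.
  by rewrite evw (nullv v vP) ?horner0 //; exact/alln/Q'split.
have nQb' : ~ Q' (msplit b) by rewrite /Q' msplitK.
have [c [u [z' [z [Qc cE zn]]]]] := alg_resultant Q'prime Qp' pl pmin nQb'.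
have [|v [vP vc]] := IHN _ (c * lead_coef p) Q'0.
  by case: Q'0 => _ _ H /H[].
have lv : (lead_coef p).@[v] != 0 by apply: contraNneq vc => e; rewrite mevalM e mulr0.
have [|t tP] := closed_root F_closed (p := map_poly (meval v) p).
  by rewrite size_map_poly_id0.
exists (w v t); split=> [f Qf|].
  have [k [c' [r [e rn]]]] := alg_divides Q'prime Qp' pl pmin (Q'split _ Qf).
  have /(congr1 (fun q => (map_poly (meval v) q).[t])) := e.
  rewrite rmorphD !rmorphM /= map_polyC !hornerE /= -evw (nullv v vP r rn) horner0 (eqP tP).
  by rewrite mulr0 addr0 => /eqP; rewrite mulf_eq0 rmorphXn expf_eq0 (negPf lv) andbF => /eqP.
have /(congr1 (fun q => (map_poly (meval v) q).[t])) := cE.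
rewrite !rmorphD !rmorphM /= map_polyC !hornerE /= -evw (nullv v vP z zn) horner0 (eqP tP).
rewrite mulr0 !addr0 => e; apply: contraNneq vc => b0.
by rewrite mevalM e b0 mulr0 mul0r.
Qed.

Lemma prime_avoiding (R : comNzRingType) (J : R -> Prop) f : is_ideal J ->
  (forall m, ~ J (f ^+ m)) ->
  exists Q, [/\ is_prime_ideal Q, forall g, J g -> Q g & ~ Q f].
Proof.
move=> Ji Jf.
pose good (A : R -> Prop) := [/\ is_ideal A, forall g, J g -> A g & forall m, ~ A (f ^+ m)].
pose T := {A | good A}.
pose le (A B : T) : bool := `[< forall g, sval A g -> sval B g >].
have leP A B : reflect (forall g, sval A g -> sval B g) (le A B) by exact: asboolP.
have J0 : good J by split.
have [||A tot|[A [Ai JA Af]] Amax] := @classical_sets.ZL_preorder T (exist _ J J0) le.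
- by move=> A; apply/leP.
- by move=> A B C /leP BA /leP AC; apply/leP => g /BA/AC.
- have [[B0 AB0]|nA] := pselect (exists B, A B); last first.
    by exists (exist _ J J0) => B AB; case: nA; exists B.
  pose U g := exists2 B, A B & sval B g.
  have Ug : good U.
    split; last by move=> m [B AB]; case: (svalP B) => _ _; exact.
      split; first by exists B0 => //; case: (svalP B0) => -[].
        move=> g h [B AB Bg] [C AC Ch].
        case: (tot B C AB AC) => /leP BC.
          by exists C => //; case: (svalP C) => -[_ CD _] _ _; apply: CD => //; exact: BC.
        by exists B => //; case: (svalP B) => -[_ BD _] _ _; apply: BD => //; exact: BC.
      by move=> g h [B AB Bh]; exists B => //; case: (svalP B) => -[_ _ BM] _ _; exact: BM.
    by move=> g Jg; exists B0 => //; case: (svalP B0) => _ JB _; exact: JB.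
  by exists (exist _ U Ug) => B AB; apply/leP => g Bg; exists B.
have [A0 AD AM] := Ai; exists A; split=> //; last by have := Af 1%N; rewrite expr1.
split=> //; first by have := Af 0%N; rewrite expr0.
have ext g : ~ A g -> exists m a h, A a /\ f ^+ m = a + h * g.
  move=> nAg; pose B x := exists a h, A a /\ x = a + h * g.
  apply: contrapT => nB; have Bg : good B.
    split; last by move=> m [a [h [Aa e]]]; apply: nB; exists m, a, h.
      split; first by exists 0, 0; rewrite mul0r addr0.
        move=> x y [a [h [Aa ->]]] [a' [h' [Aa' ->]]]; exists (a + a'), (h + h').
        by split; [exact: AD | ring].
      by move=> x y [a [h [Aa ->]]]; exists (x * a), (x * h); split; [exact: AM | ring].
    by move=> x Jx; exists x, 0; split; [exact: (JA x Jx) | ring].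
  have AB x : A x -> B x by move=> Ax; exists x, 0; rewrite mul0r addr0.
  have /leP H := Amax (exist _ B Bg) (introT (leP (exist _ A _) (exist _ B Bg)) AB).
  by apply: nAg; apply: H; exists 0, 1; split=> //; rewrite mul1r add0r.
move=> g h Agh; apply: contrapT => /not_orP[/ext[m [a [x [Aa e]]]] /ext[m' [a' [x' [Aa' e']]]]].
apply: (Af (m + m')%N); rewrite exprD e e'.
rewrite (_ : _ * _ = (a' + x' * h) * a + x * g * a' + x * x' * (g * h)); last by ring.
by apply: (AD); [apply: (AD); exact: AM | exact: AM].
Qed.

Lemma strong_nullstellensatz N (J : {mpoly F[N]} -> Prop) f : is_ideal J ->
  (forall v : 'I_N -> F, (forall g, J g -> g.@[v] = 0) -> f.@[v] = 0) ->
  exists m, J (f ^+ m).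
Proof.
move=> Ji fJ; apply: contrapT => nf.
have [|Q [Qp JQ Qf]] := prime_avoiding Ji (f := f).
  by move=> m Jm; apply: nf; exists m.
have [v [vP /eqP fv]] := prime_nullstellensatz Qp Qf.
by apply: fv; apply: fJ => g /JQ/vP.
Qed.

End Nullstellensatz.

(** * The differential Galois group *)


Section Derivation.
Variable k : diffFieldType.

Lemma der0 : der (0 : k) = 0.
Proof. by apply: (addrI (der (0 : k))); rewrite -derD !addr0. Qed.

Lemma der_is_zmod_morphism : zmod_morphism (@der k).
Proof.
move=> x y; apply: (addIr (der y)); rewrite -derD subrK -addrA [- _ + _]addrC subrr addr0.
by [].
Qed.
HB.instance Definition _ := GRing.isZmodMorphism.Build k k (@der k) der_is_zmod_morphism.

Lemma der1 : der (1 : k) = 0.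
Proof. by apply: (addrI (der (1 : k))); rewrite addr0 -{3}[1](mulr1 1) derM mulr1 mul1r. Qed.

Lemma constantP (x : k) : reflect (der x = 0) (x \in @is_constant k).
Proof. by rewrite inE; exact: eqP. Qed.

Lemma der_val (c : constants k) : der (val c) = 0.
Proof. by apply/constantP; case: c. Qed.
End Derivation.

Section InjectiveOperator.
Variables (F : fieldType) (V : lmodType F) (T : {linear V -> V}).
Hypothesis T_inj : injective T.

(* Replaces a dimension count: an injective operator acts surjectively on the
   finite-dimensional span of an orbit. *)
Lemma inj_papply q x : q != 0 -> papply T q x = 0 -> exists r, x = papply T r (T x).
Proof.
move: {2}(size q) (leqnn (size q)) => m; elim: m q => [|m IHm] q.
  by rewrite leqn0 size_poly_eq0 => ->.
elim/poly_ind: q => [|q c _] sq q0; first by rewrite eqxx in q0.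
rewrite papplyD papplyMX papplyC.
have [c0|c0] := eqVneq c 0.
  rewrite c0 scale0r addr0 papply_comm => e.
  have q'0 : q != 0 by apply/eqP => q'0; case/eqP: q0; rewrite q'0 c0 polyC0 mul0r addr0.
  apply: (IHm q) => //; last by apply: T_inj; rewrite e linear0.
  by move: sq; rewrite c0 polyC0 addr0 size_mulX.
move=> e; exists (- c^-1 *: q).
rewrite -mul_polyC papplyCM; apply: (scalerI c0).
by rewrite scalerA mulrN divff // scaleN1r; apply/eqP; rewrite -addr_eq0 addrC e.
Qed.
End InjectiveOperator.

Lemma row_dependence (F : fieldType) D (u : nat -> 'rV[F]_D) :
  exists2 q : {poly F}, q != 0 & \sum_(j < size q) q`_j *: u j = 0.
Proof.
pose W := \matrix_(j < D.+1) u j.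
have /rowV0Pn[c cW c0] : kermx W != 0.
  by rewrite kermx_eq0 /row_free; apply/eqP => e; have := rank_leq_col W; rewrite e ltnn.
exists (rVpoly c); first by rewrite -(inj_eq (can_inj rVpolyK)) linear0 in c0 *.
have -> : \sum_(j < size (rVpoly c)) (rVpoly c)`_j *: u j = \sum_(j < D.+1) (rVpoly c)`_j *: u j.
  rewrite (big_ord_widen D.+1 (fun j => (rVpoly c)`_j *: u j) (size_poly _ _)) big_mkcond.
  by apply: eq_bigr => j _; case: ltnP => // /(nth_default 0) ->; rewrite scale0r.
move/sub_kermxP: cW => cW; rewrite -[RHS]cW mulmx_sum_row; apply: eq_bigr => j _.
by rewrite coef_rVpoly_ord rowK.
Qed.

Lemma mpoly_dependence (F : fieldType) N d (T : {linear {mpoly F[N]} -> {mpoly F[N]}}) f :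
  (forall j m, m \in msupp (iter j T f) -> (mdeg m <= d)%N) ->
  exists2 q : {poly F}, q != 0 & papply T q f = 0.
Proof.
move=> deg; pose J := bmultinom N d.+1.
pose u j : 'rV[F]_#|{: J}| := \row_i (iter j T f)@_(bmnm (enum_val i)).
have [q q0 qu] := row_dependence u; exists q => //.
apply/mpolyP => m; rewrite mcoeff0 /papply (raddf_sum (mcoeff m)) /=.
have [md|md] := leqP (mdeg m) d; last first.
  rewrite big1 // => j _; rewrite mcoeffZ memN_msupp_eq0 ?mulr0 //.
  by apply/negP => /deg; rewrite leqNgt md.
have /rowP/(_ (enum_rank (BMultinom (md : (mdeg m < d.+1)%N)))) := qu.
rewrite summxE [RHS]mxE => e; rewrite -[RHS]e; apply: eq_bigr => j _.
by rewrite mcoeffZ !mxE enum_rankK.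
Qed.

Lemma map_mpoly_derM (k : diffFieldType) N (f g : {mpoly k[N]}) :
  map_mpoly der (f * g) = map_mpoly der f * g + f * map_mpoly der g.
Proof.
apply/mpolyP => m; rewrite mcoeffD mcoeff_map_mpoly /= !mcoeffM raddf_sum -big_split /=.
by apply: eq_bigr => i _; rewrite derM !mcoeff_map_mpoly.
Qed.

Section SystemDerivation.
Variables (k : diffFieldType) (n : nat) (A : 'M[k]_n).
Local Notation mC := (@mpolyC (n * n) k).

(* The derivation of [k[X]] extending that of [k] with [X' = A X]. *)
Definition sysder (P : {mpoly k[n * n]}) : {mpoly k[n * n]} :=
  map_mpoly der P + dmev mC gmx (map_mx mC A *m gmx) P.

Arguments sysder : simpl never.

Lemma mev_sysder (S : comNzRingType) (h : {rmorphism k -> S}) (d : {additive S -> S})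
    (V : 'M[S]_n) P :
  (forall x y, d (x * y) = d x * y + x * d y) -> (forall c, d (h c) = h (der c)) ->
  map_mx d V = map_mx h A *m V -> d (mev h V P) = mev h V (sysder P).
Proof.
move=> dM dh dV; rewrite (mev_chain (d := @der k) V P dM dh) dV rmorphD; congr (_ + _).
rewrite /dmev rmorph_sum; apply: eq_bigr => i _; rewrite rmorphM /= mev_id_mC; congr (_ * _).
have <- : map_mx (mev h V) (map_mx mC A *m gmx) = map_mx h A *m V.
  by rewrite map_mxM map_gmx map_mevC.
by rewrite -map_mxvec mxE.
Qed.
End SystemDerivation.

Section Decomposition.
Variables (F L : fieldType) (h : {rmorphism F -> L}).

Lemma mpoly_decomp N c0 (p : {mpoly L[N]}) : hfree h c0 ->
  exists c', hfree h (c0 ++ c') /\ exists f : nat -> {mpoly F[N]},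
    p = \sum_(j < size (c0 ++ c')) (c0 ++ c')`_j *: map_mpoly h (f j).
Proof.
move=> /(hfree_extend [seq p@_m | m <- msupp p])[c' [cf cP]]; exists c'; split=> //.
have /choice[a aP] m : exists a, m \in msupp p -> p@_m = comb h (c0 ++ c') a.
  case: (boolP (m \in msupp p)) => [/(map_f (fun m => p@_m))/cP[a] e|_]; last by exists (fun=> 0).
  by exists a.
exists (fun j => \sum_(m <- msupp p) a m j *: 'X_[m]).
rewrite {1}[p]mpolyE big_seq (eq_bigr (fun m =>
  \sum_(j < size (c0 ++ c')) (h (a m j) * (c0 ++ c')`_j) *: 'X_[L, m])); last first.
  by move=> m mp; rewrite aP // scaler_suml.
rewrite -big_seq exchange_big; apply: eq_bigr => j _.
rewrite (raddf_sum (map_mpoly h)) /= scaler_sumr.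
apply: eq_bigr => m _; rewrite map_mpolyZ map_mpolyX scalerA mulrC.
by [].
Qed.

Lemma hfree_mpoly_inj N c (f g : nat -> {mpoly F[N]}) : hfree h c ->
  \sum_(j < size c) c`_j *: map_mpoly h (f j) = \sum_(j < size c) c`_j *: map_mpoly h (g j) ->
  forall j, (j < size c)%N -> f j = g j.
Proof.
move=> cf e j jc; apply/mpolyP => m; apply: (hfree_inj (a := fun j => (f j)@_m) (b := fun j => (g j)@_m) cf) => //.
have := congr1 (mcoeff m) e; rewrite !raddf_sum /=; rewrite /comb.
under eq_bigr do rewrite mcoeffZ mcoeff_map_mpoly mulrC.
by under [X in _ = X -> _]eq_bigr do rewrite mcoeffZ mcoeff_map_mpoly mulrC.
Qed.

Lemma poly_decomp c0 (p : {poly L}) : hfree h c0 ->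
  exists c', hfree h (c0 ++ c') /\ exists f : nat -> {poly F},
    p = \sum_(j < size (c0 ++ c')) (c0 ++ c')`_j *: map_poly h (f j).
Proof.
move=> /(hfree_extend p)[c' [cf cP]]; exists c'; split=> //.
have /choice[a aP] i : exists a, p`_i = comb h (c0 ++ c') a.
  have [ip|ip] := ltnP i (size p); first exact/cP/mem_nth.
  exists (fun=> 0); rewrite nth_default // /comb big1 // => j _.
  by rewrite rmorph0 mul0r.
exists (fun j => \poly_(i < size p) a i j); apply/polyP => i; rewrite coef_sum.
have [ip|ip] := ltnP i (size p); last first.
  rewrite nth_default // big1 // => j _.
  by rewrite coefZ coef_map coef_poly ltnNge ip /= rmorph0 mulr0.
rewrite aP; apply: eq_bigr => j _.
by rewrite coefZ coef_map coef_poly ip mulrC.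
Qed.

(* A divisor of a power of ['X - y] with coefficients in [F] has [y] as a multiple of a
   subleading coefficient. *)
Lemma root_in_base (y : L) e (g : {poly F}) : [pchar F] =i pred0 ->
  map_poly h g %= ('X - y%:P) ^+ e.+1 -> exists x, y = h x.
Proof.
move=> F0; elim: e g => [|e IHe] g.
  rewrite expr1 => /eqpf_eq[c c0 gy].
  have := congr1 (fun p : {poly L} => p`_1) gy; have := congr1 (fun p : {poly L} => p`_0) gy.
  rewrite /= !coef_map !coefZ !coefB !coefX !coefC /= sub0r subr0 mulr1 mulrN => e0 e1.
  exists (- (g`_0 / g`_1)); by rewrite rmorphN fmorph_div e0 e1 mulNr opprK mulrAC divff // mul1r.
move=> /eqpf_eq[c c0 gy]; apply: (IHe g^`()).
rewrite -deriv_map gy derivZ deriv_exp derivXsubC mul1r -[_ *+ _]scaler_nat scalerA.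
apply: eqp_scale; rewrite mulf_neq0 // -(rmorph_nat h) fmorph_eq0.
by rewrite (pcharf0P _).1.
Qed.
End Decomposition.

Lemma prime_avoiding_radical (R : comNzRingType) (J : R -> Prop) f : is_ideal J ->
  (forall Q, is_prime_ideal Q -> (forall g, J g -> Q g) -> Q f) -> exists m, J (f ^+ m).
Proof.
move=> Ji fQ; apply: contrapT => nf.
have [|Q [Qp JQ Qf]] := prime_avoiding Ji (f := f).
  by move=> m Jm; apply: nf; exists m.
by apply: Qf; exact: fQ.
Qed.

Lemma map_mpoly_coefs (R S : nzRingType) (h : {rmorphism R -> S}) N (p : {mpoly S[N]}) :
  (forall m, exists x, p@_m = h x) -> exists f, p = map_mpoly h f.
Proof.
move=> /choice[c cP]; exists (\sum_(m <- msupp p) c m *: 'X_[m]).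
rewrite {1}[p]mpolyE (raddf_sum (map_mpoly h)); apply: eq_bigr => m _.
by rewrite cP /= map_mpolyZ map_mpolyX.
Qed.

Lemma der_mpolyX (k : diffFieldType) N i : map_mpoly der ('X_i : {mpoly k[N]}) = 0.
Proof.
apply/mpolyP => m; rewrite mcoeff_map_mpoly mcoeffX mcoeff0.
by case: eqP; rewrite /= ?der0 ?der1.
Qed.

(** * Fundamental matrices of a Picard-Vessiot extension *)

Section PicardVessiot.
Variables (k K : diffFieldType) (iK : {rmorphism k -> K}) (n : nat) (A : 'M[k]_n).
Hypothesis K_PV : is_Picard_Vessiot iK A.
Variable U : 'M[K]_n.
Hypothesis U_sol : solution_basis iK A U.
Local Notation C := (constants k).
Local Notation cK := (const_to_K iK).
Local Notation mCK := (@mpolyC (n * n) K).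
HB.instance Definition _ := GRing.RMorphism.copy cK (iK \o val).

Lemma iK_der x : iK (der x) = der (iK x). Proof. by case: K_PV. Qed.

Lemma der_cK (c : C) : der (cK c) = 0.
Proof. by rewrite -iK_der der_val raddf0. Qed.

Lemma constant_cK y : der y = 0 -> exists c, y = cK c.
Proof. by case: K_PV => _ h _; exact: h. Qed.

Lemma U_system : map_mx der U = map_mx iK A *m U. Proof. by case: U_sol. Qed.

Lemma der_mul_const m p q (X : 'M[K]_(m, p)) (M : 'M[C]_(p, q)) :
  map_mx der (X *m map_mx cK M) = map_mx der X *m map_mx cK M.
Proof.
apply/matrixP => i j; rewrite !mxE raddf_sum; apply: eq_bigr => l _.
by rewrite /= !mxE derM der_cK mulr0 addr0.
Qed.

Lemma UM_system (M : 'M[C]_n) :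
  map_mx der (U *m map_mx cK M) = map_mx iK A *m (U *m map_mx cK M).
Proof. by rewrite der_mul_const U_system mulmxA. Qed.

Lemma mpoly_constant N (p : {mpoly K[N]}) : map_mpoly der p = 0 -> exists w, p = map_mpoly cK w.
Proof.
move=> p0; apply: map_mpoly_coefs => m; apply: constant_cK.
by have := congr1 (mcoeff m) p0; rewrite mcoeff_map_mpoly mcoeff0.
Qed.

Lemma basis_change (V : 'M[K]_n) : solution (map_mx iK A) V -> exists N, V = U *m map_mx cK N.
Proof.
move=> Vs; have /choice[c cP] j : exists c : 'cV[C]_n, col j V = U *m map_mx cK c.
  have [_ h] := U_sol; have [|c [cj _]] := h (col j V); last by exists c.
  have e : map_mx der (col j V) = col j (map_mx der V) by apply/matrixP => a b; rewrite !mxE.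
  by rewrite /solution e Vs !colE mulmxA.
exists (\matrix_(i, j) c j i 0); apply/matrixP => i j.
by have /colP/(_ i) := cP j; rewrite !mxE => ->; apply: eq_bigr => l _; rewrite !mxE.
Qed.

Lemma PV_basis : exists U1, [/\ U1 \in unitmx, exists2 N, U1 = U *m map_mx cK N & N \in unitmx
      & forall P : K -> Prop, subfield P -> (forall x, P (iK x)) ->
          (forall i j, P (U1 i j)) -> forall y, P y].
Proof.
have [_ _ [U1 [U1u U1s U1g]]] := K_PV; exists U1; split=> //.
have [N UN] := basis_change U1s.
exists N => //; move: U1u; rewrite UN !unitmxE !unitfE det_mulmx mulf_eq0 negb_or => /andP[_].
by rewrite det_map_mx fmorph_eq0.
Qed.

Lemma U_unit : U \in unitmx.
Proof.
have [U1 [U1u [N UN _] _]] := PV_basis; move: U1u.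
by rewrite UN !unitmxE !unitfE det_mulmx mulf_eq0 negb_or => /andP[].
Qed.

Local Notation ev := (mev iK U).

(** The fractions in the entries of [U] form a subfield containing [k] and the entries of a
    generating fundamental matrix, which differs from [U] by a constant factor. *)
Lemma PV_fraction y : exists P Q, ev Q != 0 /\ y * ev Q = ev P.
Proof.
have [U1 [_ [N UN _] U1g]] := PV_basis.
apply: (U1g (fun y => exists P Q, ev Q != 0 /\ y * ev Q = ev P)); first split.
- by exists 1, 1; rewrite rmorph1 mul1r oner_eq0.
- move=> x z [P [Q [Q0 e]]] [P' [Q' [Q'0 e']]]; exists (P * Q' - P' * Q), (Q * Q').
  by rewrite rmorphB !rmorphM /= -e -e' mulf_neq0 //; split=> //; ring.
- move=> x z [P [Q [Q0 e]]] [P' [Q' [Q'0 e']]]; exists (P * P'), (Q * Q').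
  by rewrite !rmorphM /= -e -e' mulf_neq0 //; split=> //; ring.
- move=> x [P [Q [Q0 e]]]; have [->|x0] := eqVneq x 0.
    by exists 0, 1; rewrite rmorph1 rmorph0 oner_eq0 invr0 mul0r.
  have eP : ev P != 0 by rewrite -e mulf_neq0.
  by exists Q, P; split=> //; rewrite -e mulKf.
- by move=> x; exists x%:MP, 1; rewrite rmorph1 mevC mulr1 oner_eq0.
move=> i j; exists (Rm (map_mx val N) 'X_(mxvec_index i j)), 1.
rewrite rmorph1 mulr1 oner_eq0 mev_Rm mevX mxvecE UN; split=> //.
by congr ((_ *m _) _ _); apply/matrixP => ? ?; rewrite !mxE.
Qed.

End PicardVessiot.

(** * The Galois group as the stabilizer of the ideal of relations *)

Section GaloisGroup.
Variables (k K : diffFieldType) (iK : {rmorphism k -> K}) (n : nat) (A : 'M[k]_n).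
Hypothesis K_PV : is_Picard_Vessiot iK A.
Variable U : 'M[K]_n.
Hypothesis U_sol : solution_basis iK A U.
Local Notation C := (constants k).
Local Notation cK := (const_to_K iK).
Local Notation ev := (mev iK U).

Lemma der_mev V P : map_mx der V = map_mx iK A *m V ->
  der (mev iK V P) = mev iK V (sysder A P).
Proof. by move=> dV; apply: (mev_sysder (d := @der K)) => // [|c]; [exact: derM|rewrite /= (iK_der K_PV)]. Qed.

Lemma map_iK_val m p (M : 'M[C]_(m, p)) : map_mx iK (map_mx val M) = map_mx cK M.
Proof. by apply/matrixP => i j; rewrite !mxE. Qed.

Lemma mev_UM M P : mev iK (U *m map_mx cK M) P = ev (Rm (map_mx val M) P).
Proof. by rewrite mev_Rm map_iK_val. Qed.

Section Automorphism.
Variable M : 'M[C]_n.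
Hypothesis Mu : M \in unitmx.
Hypothesis M_rel : forall P, ev P = 0 -> mev iK (U *m map_mx cK M) P = 0.
Let V := U *m map_mx cK M.
Let kM : 'M[k]_n := map_mx val M.
Local Notation evV := (mev iK V).

Let kM_unit : kM \in unitmx. Proof. by rewrite map_unitmx. Qed.

Lemma Rm_unit_inj : injective (Rm kM).
Proof. by apply: (can_inj (g := Rm (invmx kM))) => f; rewrite Rm_mulmx mulVmx // Rm1. Qed.

(* [Rm kM] maps the ideal of relations of [U] into itself; being locally finite and
   injective, it maps no other polynomial into it. *)
Lemma rel_reflect P : evV P = 0 -> ev P = 0.
Proof.
rewrite mev_UM => rP; pose d := \max_(m <- msupp P) mdeg m.
have [|q q0 qP] := mpoly_dependence (d := d) (T := Rm kM) (f := P).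
  elim=> [|j IHj] m; first by move=> mP; rewrite /d (big_rem m) //= leq_maxl.
  by rewrite iterS; exact: (Rm_deg IHj).
have [r ->] := inj_papply Rm_unit_inj q0 qP.
rewrite /papply rmorph_sum big1 // => j _; rewrite /= mevZ.
suff -> : ev (iter j (Rm kM) (Rm kM P)) = 0 by rewrite mulr0.
by elim: (nat_of_ord j) => //= i IHi; rewrite -mev_UM; apply: M_rel.
Qed.

Lemma PV_fraction_pair y : exists PQ, ev PQ.2 != 0 /\ y * ev PQ.2 = ev PQ.1.
Proof. by have [P [Q PQ]] := PV_fraction K_PV U_sol y; exists (P, Q). Qed.

(** Substitutes [U M] for [U] in a fraction chosen for [y]. The choice is immaterial, because
    relations of [U] are relations of [U M] and nonzero denominators stay nonzero. *)
Definition sigma (y : K) : K :=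
  let PQ := projT1 (cid (PV_fraction_pair y)) in evV PQ.1 / evV PQ.2.

Arguments sigma : simpl never.

Lemma sigmaE y P Q : ev Q != 0 -> y * ev Q = ev P -> sigma y * evV Q = evV P.
Proof.
rewrite /sigma; case: (cid _) => -[P' Q'] /= [Q'0 e'] Q0 e.
have evV0 R : ev R != 0 -> evV R != 0 by apply: contra_neq => /rel_reflect.
have : evV (P' * Q - P * Q') = 0.
  by apply: M_rel; rewrite rmorphB !rmorphM /= -e -e'; ring.
rewrite rmorphB !rmorphM /= => /eqP; rewrite subr_eq0 => /eqP e1.
by apply: (mulIf (evV0 _ Q'0)); rewrite -e1 [LHS]mulrAC divfK ?evV0.
Qed.

Lemma sigma_ev P : sigma (ev P) = evV P.
Proof.
by rewrite -[LHS]mulr1 -(rmorph1 evV); apply: sigmaE; rewrite rmorph1 ?mulr1 // oner_eq0.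
Qed.

Lemma sigma_cases y : exists P Q, [/\ ev Q != 0, evV Q != 0, y * ev Q = ev P & sigma y * evV Q = evV P].
Proof.
have [P [Q [Q0 e]]] := PV_fraction K_PV U_sol y; exists P, Q; split=> //; last exact: sigmaE.
by apply: contra_neq Q0 => /rel_reflect.
Qed.

Lemma sigma_is_zmod_morphism : zmod_morphism sigma.
Proof.
move=> x z; have [P [Q [Q0 Q0' e e']]] := sigma_cases x.
have [R [S [S0 S0' f f']]] := sigma_cases z.
apply: (mulIf (mulf_neq0 Q0' S0')); rewrite -rmorphM (@sigmaE _ (P * S - R * Q)).
- by rewrite rmorphB !rmorphM /= -e' -f'; ring.
- by rewrite rmorphM mulf_neq0.
by rewrite rmorphB !rmorphM /= -e -f; ring.
Qed.

Lemma sigma_is_monoid_morphism : monoid_morphism sigma.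
Proof.
split=> [|x z]; first by rewrite -(rmorph1 ev) sigma_ev !rmorph1.
have [P [Q [Q0 Q0' e e']]] := sigma_cases x.
have [R [S [S0 S0' f f']]] := sigma_cases z.
apply: (mulIf (mulf_neq0 Q0' S0')); rewrite -rmorphM (@sigmaE _ (P * R)).
- by rewrite !rmorphM /= -e' -f'; ring.
- by rewrite rmorphM mulf_neq0.
by rewrite !rmorphM /= -e -f; ring.
Qed.

HB.instance Definition _ := GRing.isZmodMorphism.Build K K sigma sigma_is_zmod_morphism.
HB.instance Definition _ := GRing.isMonoidMorphism.Build K K sigma sigma_is_monoid_morphism.

Lemma rel_Galois : Galois_group iK U M.
Proof.
exists sigma; split.
- have surj y : exists x, sigma x = y.
    have [P [Q [Q0 e]]] := PV_fraction K_PV U_sol y.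
    have back R : evV (Rm (invmx kM) R) = ev R by rewrite mev_UM Rm_mulmx mulmxV // Rm1.
    exists (ev (Rm (invmx kM) P) / ev (Rm (invmx kM) Q)).
    by rewrite fmorph_div /= !sigma_ev !back -e mulfK.
  have /choice[g gP] := surj; exists g => // x; apply: (fmorph_inj sigma).
  exact: gP.
(* Differentiating [x Q(U) = P(U)] and its image gives two parallel equations, as [U] and [U M]
   solve the same system. *)
- move=> x; have [P [Q [Q0 Q0' e e']]] := sigma_cases x.
  have key q dq dp q' dq' dp' : sigma q = q' -> sigma dq = dq' -> sigma dp = dp' ->
      der x * q + x * dq = dp -> sigma (der x) * q' + sigma x * dq' = dp'.
    by move=> <- <- <- <-; rewrite (rmorphD sigma) !(rmorphM sigma).
  have := congr1 der e; rewrite derM !der_mev; [|exact: U_system..].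
  move=> /(key _ _ _ _ _ _ (sigma_ev Q) (sigma_ev _) (sigma_ev _)) e1.
  have := congr1 der e'; rewrite derM !der_mev; [|exact: UM_system..] => e2.
  by apply: (mulIf Q0'); exact: (addIr _ (etrans e1 (esym e2))).
- by move=> x; rewrite -(mevC iK U x) /= sigma_ev !mevC.
rewrite -[in LHS](map_gmx iK U) -map_mx_comp -/V -[RHS](map_gmx iK V).
by apply: eq_map_mx => P /=; exact: sigma_ev.
Qed.
End Automorphism.

Lemma Galois_rel M : Galois_group iK U M <->
  M \in unitmx /\ forall P, ev P = 0 -> mev iK (U *m map_mx cK M) P = 0.
Proof.
split=> [[s [_ _ sk sU]]|[Mu Mr]]; last exact: rel_Galois.
split=> [|P P0].
  have : map_mx s U \in unitmx by rewrite map_unitmx (U_unit K_PV U_sol).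
  rewrite sU !unitmxE !unitfE det_mulmx mulf_eq0 negb_or.
  by move=> /andP[_]; rewrite det_map_mx fmorph_eq0.
rewrite -sU -(rmorph0 s) -P0 (rmorph_mev iK s).
by apply: eq_mev => x; rewrite /= sk.
Qed.

Lemma Galois_subgroup : is_subgroup (Galois_group iK U).
Proof.
split.
- by move=> M /Galois_rel[].
- by apply/Galois_rel; rewrite unitmx1 map_mx1 mulmx1.
- move=> M N /Galois_rel[Mu Mr] /Galois_rel[Nu Nr]; apply/Galois_rel.
  rewrite unitmx_mul Mu Nu; split=> // P P0.
  rewrite map_mxM mulmxA -(map_iK_val N) -mev_Rm; apply: Mr; rewrite mev_Rm map_iK_val.
  exact: Nr.
move=> M /Galois_rel[Mu Mr]; apply/Galois_rel; rewrite unitmx_inv; split=> // P P0.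
rewrite -map_iK_val -mev_Rm; apply: (rel_reflect Mu Mr).
by rewrite mev_Rm map_iK_val -mulmxA -map_mxM mulmxV // map_mx1 mulmx1.
Qed.

(* [P (U Y)], a polynomial in [Y]. *)
Definition subU (P : {mpoly k[n * n]}) : {mpoly K[n * n]} := Lm U (map_mpoly iK P).

Lemma mev_subU M P : mev idfun (map_mx cK M) (subU P) = mev iK (U *m map_mx cK M) P.
Proof. by rewrite mev_Lm map_mx_idfun mev_map_mpoly. Qed.

Lemma mev_map_cK M (f : {mpoly C[n * n]}) : mev idfun (map_mx cK M) (map_mpoly cK f) = cK (evalm M f).
Proof. by rewrite mev_map_mpoly [RHS]rmorph_mev; apply: eq_mev. Qed.

Lemma mev_decomp M c (f : nat -> {mpoly C[n * n]}) :
  mev idfun (map_mx cK M) (\sum_(j < size c) c`_j *: map_mpoly cK (f j)) =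
  comb cK c (fun j => evalm M (f j)).
Proof. by rewrite rmorph_sum; apply: eq_bigr => j _; rewrite /= mevZ mev_map_cK mulrC. Qed.

Lemma hfree_nil : hfree cK [::]. Proof. by []. Qed.

Lemma decomp_van p : (forall M, Galois_group iK U M -> mev idfun (map_mx cK M) p = 0) ->
  exists (c : seq K) (f : nat -> {mpoly C[n * n]}),
    p = \sum_(j < size c) c`_j *: map_mpoly cK (f j) /\
    forall j, (j < size c)%N -> van (Galois_group iK U) (f j).
Proof.
move=> pG; have [c [cf [f pE]]] := mpoly_decomp p hfree_nil; rewrite /= in cf pE.
exists c, f; split=> // j jc M GM.
by apply: (cf (fun j => evalm M (f j))) => //; rewrite -mev_decomp -pE pG.
Qed.

Lemma Galois_closed M : M \in unitmx ->
  (forall f, van (Galois_group iK U) f -> evalm M f = 0) -> Galois_group iK U M.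
Proof.
move=> Mu Mv; apply/Galois_rel; split=> // P P0; rewrite -mev_subU.
have [|c [f [-> fv]]] := decomp_van (p := subU P).
  by move=> N /Galois_rel[_ /(_ P P0)]; rewrite mev_subU.
by rewrite mev_decomp /comb big1 // => j _; rewrite Mv ?rmorph0 ?mul0r // ; apply: fv.
Qed.
End GaloisGroup.

Section LmRules.
Variables (F : fieldType) (n : nat).
Lemma LmE (x : 'M[F]_n) f : Lm x f = mev (@mpolyC _ F) (map_mx (@mpolyC _ F) x *m gmx) f.
Proof. by rewrite unlock. Qed.

Lemma Lm_mulmx (x y : 'M[F]_n) f : Lm x (Lm y f) = Lm (y *m x) f.
Proof. by rewrite (LmE x) mev_Lm mulmxA -map_mxM -LmE. Qed.

Lemma Lm1 (f : {mpoly F[n * n]}) : Lm 1%:M f = f.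
Proof. by rewrite unlock map_mx1 mul1mx mev_id_mC. Qed.

Lemma Lm_detp (x : 'M[F]_n) : Lm x (detp F n) = \det x *: detp F n.
Proof. by rewrite unlock mev_detp det_mulmx det_map_mx mul_mpolyC. Qed.

Lemma evalm_vec_mx (v : 'I_(n * n) -> F) f : evalm (vec_mx (\row_i v i)) f = f.@[v].
Proof. by apply: eq_mmap => // i; rewrite vec_mxK mxE. Qed.
End LmRules.

Lemma map_detp (R S : fieldType) n (h : {rmorphism R -> S}) : map_mpoly h (detp R n) = detp S n.
Proof.
rewrite /detp -(det_map_mx (map_mpoly h)); congr (\det _); apply/matrixP => i j.
by rewrite !mxE /= map_mpolyX.
Qed.

Lemma dvd_biggcdp (F : fieldType) (I : eqType) (r : seq I) (f : I -> {poly F}) i :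
  i \in r -> \big[gcdp (R:=F)/0]_(j <- r) f j %| f i.
Proof.
elim: r => // j r IHr; rewrite inE big_cons => /predU1P[->|/IHr]; first exact: dvdp_gcdl.
by apply: dvdp_trans; exact: dvdp_gcdr.
Qed.

(** * The field fixed by the Galois group *)

Section InvariantField.
Variables (k K : diffFieldType) (iK : {rmorphism k -> K}) (n : nat) (A : 'M[k]_n).
Hypothesis K_PV : is_Picard_Vessiot iK A.
Variable U : 'M[K]_n.
Hypothesis U_sol : solution_basis iK A U.
Local Notation C := (constants k).
Local Notation cK := (const_to_K iK).
Local Notation ev := (mev iK U).
Local Notation G := (Galois_group iK U).
Local Notation polK := {mpoly K[n * n]}.
Local Notation polk := {mpoly k[n * n]}.
Local Notation subU := (subU iK U).
Local Notation dK := (map_mpoly (@der K)).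

Lemma subUE P : subU P = mev (@mpolyC (n * n) K \o iK) (map_mx (@mpolyC _ _) U *m gmx) P.
Proof. by rewrite /subU unlock mev_map_mpoly. Qed.

Lemma der_subU P : dK (subU P) = subU (sysder A P).
Proof.
rewrite !subUE; apply: (mev_sysder (d := dK)) => [f g|c|].
- exact: map_mpoly_derM.
- by rewrite /= map_mpolyC (iK_der K_PV).
have -> : map_mx (@mpolyC (n * n) K \o iK) A *m (map_mx (@mpolyC _ _) U *m gmx) =
    map_mx (@mpolyC _ _) (map_mx der U) *m gmx.
  by rewrite (U_system U_sol) map_mxM -map_mx_comp mulmxA.
apply/matrixP => i j; rewrite !mxE (raddf_sum dK); apply: eq_bigr => l _.
by rewrite /= map_mpoly_derM !mxE map_mpolyC der_mpolyX mulr0 addr0.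
Qed.

(* The ideal of [K[Y]] generated by the [P (U Y)], for [P] a relation of [U] over [k];
   its zeros in [GL_n(C)] form the Galois group. *)
Definition relK (p : polK) : Prop := exists s : seq (polK * polk),
  (forall x, x \in s -> ev x.2 = 0) /\ p = \sum_(x <- s) x.1 * subU x.2.

Lemma relK_ideal : is_ideal relK.
Proof.
split=> [|p q [s [sP ->]] [t [tP ->]]|f q [s [sP ->]]].
- by exists [::]; rewrite big_nil.
- exists (s ++ t); rewrite big_cat; split=> // x.
  by rewrite mem_cat => /orP[/sP|/tP].
exists [seq (f * x.1, x.2) | x <- s]; split=> [_ /mapP[x /sP e ->]//|].
by rewrite big_map mulr_sumr; apply: eq_bigr => x _; rewrite mulrA.
Qed.

Lemma relK_subU P : ev P = 0 -> relK (subU P).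
Proof.
move=> P0; exists [:: (1, P)]; rewrite big_seq1 mul1r; split=> // x.
by rewrite inE => /eqP ->.
Qed.

Lemma relK_Z c p : relK p -> relK (c *: p).
Proof. by rewrite -mul_mpolyC; case: relK_ideal => _ _ KM /KM. Qed.

Lemma relK_der p : relK p -> relK (dK p).
Proof.
have [K0 KD KM] := relK_ideal; move=> [s [sP ->]]; rewrite raddf_sum big_seq.
apply: ideal_sum => [|x /sP x0]; first exact: relK_ideal.
rewrite /= map_mpoly_derM der_subU; apply: KD; apply: KM; apply: relK_subU => //.
by rewrite -(der_mev K_PV _ (U_system U_sol)) x0 der0.
Qed.

Lemma size_msupp_lt (p q : polK) m : m \in msupp p -> m \notin msupp q ->
  (forall m', m' \in msupp q -> m' \in msupp p) -> (size (msupp q) < size (msupp p))%N.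
Proof.
move=> mp mq qp; apply: (@uniq_leq_size _ (m :: msupp q)); first by rewrite /= mq msupp_uniq.
by move=> m'; rewrite inE => /predU1P[->|/qp].
Qed.

(* [relK] is stable under the derivation of coefficients, so a member of minimal support
   not vanishing at [M] has constant coefficients. *)
Lemma relK_zero (M : 'M[C]_n) : (forall f, relK (map_mpoly cK f) -> evalm M f = 0) ->
  forall p, relK p -> mev idfun (map_mx cK M) p = 0.
Proof.
move=> MJ p; move: {2}(size (msupp p)) (leqnn (size (msupp p))) => s.
elim: s p => [|s IHs] p ps Kp.
  by move: ps; rewrite leqn0 size_eq0 msupp_eq0 => /eqP ->; rewrite rmorph0.
have [->|p0] := eqVneq p 0; first by rewrite rmorph0.
have [m0 m0p] : exists m, m \in msupp p.
  by move: p0; rewrite -msupp_eq0; case: (msupp p) => // m r _; exists m; rewrite inE eqxx.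
(* Once a coefficient is 1, the derivative loses that monomial, so it has smaller support and
   vanishes at [M]. *)
pose p1 := (p@_m0)^-1 *: p; have pm0 : p@_m0 != 0 by rewrite -mcoeff_msupp.
have Kp1 : relK p1 by exact: relK_Z.
have p1_supp m : (m \in msupp p1) = (m \in msupp p).
  by rewrite !mcoeff_msupp mcoeffZ mulf_eq0 invr_eq0 (negPf pm0).
have p1m0 : p1@_m0 = 1 by rewrite mcoeffZ mulVf.
have pE : p = p@_m0 *: p1 by rewrite scalerA mulfV // scale1r.
clearbody p1; suff p1M : mev idfun (map_mx cK M) p1 = 0 by rewrite pE mevZ p1M mulr0.
have q_supp m : m \in msupp (dK p1) -> m \in msupp p.
  rewrite -p1_supp !mcoeff_msupp mcoeff_map_mpoly; apply: contra_neq => /= ->.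
  exact: der0.
have Kq := relK_der Kp1.
have qM : mev idfun (map_mx cK M) (dK p1) = 0.
  apply: IHs Kq; rewrite -ltnS (leq_trans _ ps) //; apply: (size_msupp_lt m0p) => //.
  by rewrite mcoeff_msupp negbK mcoeff_map_mpoly /= p1m0 der1.
have [q0|q0] := eqVneq (dK p1) 0.
  have [w e] := mpoly_constant K_PV q0.
  by rewrite e mev_map_cK MJ ?rmorph0 // -e.
have [m1 m1q] : exists m, m \in msupp (dK p1).
  by move: q0; rewrite -msupp_eq0; case: (msupp _) => // m r _; exists m; rewrite inE eqxx.
have qm1 : (dK p1)@_m1 != 0 by rewrite -mcoeff_msupp.
(* The multiple of [dK p1] cancels the monomial [m1] and does not change the value at [M]. *)
pose r := p1 - (p1@_m1 / (dK p1)@_m1) *: dK p1.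
have Kr : relK r by apply: ideal_sub relK_ideal _ _ => //; exact: relK_Z.
have <- : mev idfun (map_mx cK M) r = mev idfun (map_mx cK M) p1.
  rewrite rmorphB /= [mev _ _ (_ *: dK p1)]mevZ /= qM.
  by rewrite mulr0 subr0.
apply: IHs Kr; rewrite -ltnS (leq_trans _ ps) //; apply: (size_msupp_lt (q_supp _ m1q)).
  by rewrite mcoeff_msupp negbK mcoeffB mcoeffZ divfK // subrr.
move=> m; apply: contraLR => mp.
have e1 : p1@_m = 0 by apply/memN_msupp_eq0; rewrite p1_supp.
have e2 : (dK p1)@_m = 0 by apply/memN_msupp_eq0; apply: contra mp; exact: q_supp.
by rewrite mcoeff_msupp negbK mcoeffB mcoeffZ e1 e2 mulr0 subrr.
Qed.

Lemma relK_Galois (M : 'M[C]_n) : M \in unitmx -> (forall f, relK (map_mpoly cK f) -> evalm M f = 0) ->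
  G M.
Proof.
move=> Mu MJ; apply/(Galois_rel K_PV U_sol); split=> // P P0.
by rewrite -mev_subU; apply: relK_zero => //; exact: relK_subU.
Qed.

(** Substituting [U^-1 Y] for [Y] turns each generator [P (U Y)] back into [P (Y)]; expanding the
    cofactors along a family free over [k] collects relations over [k]. *)
Lemma relK_free p : relK p -> exists (c : seq K) (R : nat -> polk), [/\ hfree iK c,
  forall j, ev (R j) = 0 & Lm (invmx U) p = \sum_(j < size c) c`_j *: map_mpoly iK (R j)].
Proof.
move=> [s [sP ->]]; rewrite (linear_sum (Lm (invmx U))) /=.
elim: s sP => [|[g P] s IHs] sP.
  by exists [::], (fun=> 0); split=> // [j|]; rewrite ?rmorph0 // big_nil big_ord0.
have [|c [R [cf R0 e]]] := IHs; first by move=> x xs; apply: sP; rewrite inE xs orbT.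
have P0 : ev P = 0 by apply: (sP (g, P)); rewrite inE eqxx.
have [c' [c'f [f gE]]] := mpoly_decomp (Lm (invmx U) g) cf.
exists (c ++ c'), (fun j => f j * P + (if (j < size c)%N then R j else 0)); split=> // [j|].
  by rewrite rmorphD rmorphM /= P0 mulr0 add0r; case: ifP; rewrite ?R0 ?rmorph0.
rewrite big_cons e rmorphM /= Lm_mulmx mulmxV ?(U_unit K_PV U_sol) // Lm1 gE mulr_suml.
rewrite (big_ord_widen (size (c ++ c')) (fun j => c`_j *: map_mpoly iK (R j))); last first.
  by rewrite size_cat leq_addr.
rewrite [X in _ + X]big_mkcond -big_split; apply: eq_bigr => j _ /=.
rewrite rmorphD rmorphM /= scalerDr scalerAl; congr (_ + _).
by rewrite nth_cat; case: ifP => // _; rewrite rmorph0 scaler0.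
Qed.

Hypothesis C_closed : GRing.closed_field_axiom C.
Hypothesis k0 : [pchar k] =i pred0.

(* By the Nullstellensatz a power of [a (U Y) - y] lies in [relK]; comparing coefficients
   of a basis over [k], a power of ['X - y] is a combination of polynomials over [k]
   that vanish at [y]. *)
Lemma Galois_fixed y a : y = ev a ->
  (forall M, G M -> mev iK (U *m map_mx cK M) a = y) -> exists x, y = iK x.
Proof.
move=> ya yG.
have C0 : [pchar C] =i pred0 by move=> l; rewrite -(fmorph_pchar (val : C -> k)); exact: k0.
pose Q := subU a - y%:MP.
have [|c [f [QE fv]]] := decomp_van (p := Q) (iK := iK) (U := U).
  by move=> M GM; rewrite rmorphB /= mev_subU mevC yG // subrr.
(* The zeros of [relK] are known to lie in [G] only when they are invertible; the factor [detp]
   takes care of the others. *)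
have fJ j : (j < size c)%N -> exists m, relK (map_mpoly cK ((detp C n * f j) ^+ m)).
  move=> jc; apply: (strong_nullstellensatz C_closed C0 (J := fun g => relK (map_mpoly cK g))).
    have [K0 KD KM] := relK_ideal; split=> [|g h Jg Jh|g h Jh]; rewrite ?rmorph0 ?rmorphD ?rmorphM //.
      exact: KD.
    exact: KM.
  move=> v vJ; rewrite -evalm_vec_mx evalmM; set M := vec_mx _.
  have [Mu|] := boolP (M \in unitmx); last first.
    by rewrite unitmxE unitfE negbK => /eqP M0; rewrite /evalm mev_detp M0 mul0r.
  have /(fv j jc) -> : G M by apply: relK_Galois => // g /vJ; rewrite -evalm_vec_mx.
  exact: mulr0.
have [m Km] : exists m, relK ((detp K n * Q) ^+ m).
  apply: prime_avoiding_radical relK_ideal _ => I I_prime relK_I.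
  have [I_ideal _ _] := I_prime; have [_ _ IM] := I_ideal.
  rewrite QE mulr_sumr; apply: ideal_sum => // j _.
  rewrite -scalerAr -mul_mpolyC; apply: IM.
  have [m' Jm] := fJ j (ltn_ord j); apply: (prime_exp (m := m') I_prime).
  by apply: relK_I; rewrite -(map_detp _ cK) -rmorphM -rmorphXn.
(* The factor [\det U ^+ m] compensates the determinant that appears when [Y] is replaced by
   [U^-1 Y]. *)
have [d [R [df R0 RE]]] := relK_free (relK_Z (\det U ^+ m) Km).
have [d' [d'f [p pE]]] := poly_decomp (('X - y%:P) ^+ m) df.
pose psi (g : {poly k}) : polk := (map_poly (@mpolyC (n * n) k) g).[a].
have psiE (g : {poly k}) : (map_poly (@mpolyC (n * n) K) (map_poly iK g)).[map_mpoly iK a] = map_mpoly iK (psi g).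
  rewrite -horner_map -!map_poly_comp; congr (_.[_]); apply: eq_map_poly => x /=.
  by rewrite map_mpolyC.
have LE : Lm (invmx U) (\det U ^+ m *: (detp K n * Q) ^+ m) =
    map_mpoly iK (detp k n ^+ m) * (map_mpoly iK a - y%:MP) ^+ m.
  rewrite linearZ /= rmorphXn rmorphM rmorphB /= Lm_detp Lm_mulmx mulmxV ?(U_unit K_PV U_sol) // Lm1.
  rewrite (LmE _ y%:MP) mevC exprMn exprZn -scalerAl scalerA -exprMn det_inv mulfV ?expr1n ?scale1r.
    by rewrite rmorphXn /= map_detp.
  by have := U_unit K_PV U_sol; rewrite unitmxE unitfE.
have e j : (j < size (d ++ d'))%N -> detp k n ^+ m * psi (p j) = if (j < size d)%N then R j else 0.
  move: j; apply: (hfree_mpoly_inj (f := fun j => detp k n ^+ m * psi (p j))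
    (g := fun j => if (j < size d)%N then R j else 0) d'f).
  transitivity (map_mpoly iK (detp k n ^+ m) * (map_mpoly iK a - y%:MP) ^+ m).
    have -> : (map_mpoly iK a - y%:MP) ^+ m =
        (map_poly (@mpolyC (n * n) K) (('X - y%:P) ^+ m)).[map_mpoly iK a].
      by rewrite rmorphXn rmorphB /= map_polyX map_polyC horner_exp hornerXsubC.
    rewrite pE rmorph_sum horner_sum mulr_sumr; apply: eq_bigr => j _.
    by rewrite rmorphM /= -psiE map_polyZ hornerZ mul_mpolyC scalerAr.
  rewrite -LE RE (big_ord_widen (size (d ++ d')) (fun j => d`_j *: map_mpoly iK (R j))); last first.
    by rewrite size_cat leq_addr.
  rewrite [LHS]big_mkcond; apply: eq_bigr => j _ /=.
  by rewrite nth_cat; case: ifP => // _; rewrite rmorph0 scaler0.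
have root_p j : (j < size (d ++ d'))%N -> root (map_poly iK (p j)) y.
  move=> /e/(congr1 ev); rewrite (fun_if ev) R0 rmorph0 if_same rmorphM rmorphXn /= mev_detp.
  move/eqP; rewrite mulf_eq0 expf_eq0.
  have := U_unit K_PV U_sol; rewrite unitmxE unitfE => /negPf ->; rewrite andbF /=.
  rewrite /psi -horner_map -map_poly_comp /= -ya /root.
  by rewrite (eq_map_poly (g := iK)) // => x /=; rewrite mevC.
(* A gcd of polynomials over [k] stays over [k]; this one divides a power of ['X - y] and has the
   root [y], so up to a unit it is a positive power of ['X - y]. *)
pose g := \big[gcdp (R:=k)/0]_(j <- iota 0 (size (d ++ d'))) p j.
have gE : map_poly iK g = \big[gcdp (R:=K)/0]_(j <- iota 0 (size (d ++ d'))) map_poly iK (p j).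
  by apply: big_morph => [u v|]; [exact: gcdp_map|rewrite rmorph0].
have g_dvd : map_poly iK g %| ('X - y%:P) ^+ m.
  rewrite pE; apply: (big_ind (fun q => map_poly iK g %| q)) => [|u v|j _]; [exact: dvdp0|exact: dvdp_add|].
  rewrite -mul_polyC; apply: dvdp_mull; rewrite dvdp_map; apply: dvd_biggcdp; rewrite mem_iota.
  exact: ltn_ord.
have g_root : root (map_poly iK g) y.
  rewrite gE -(big_map (fun j => map_poly iK (p j)) xpredT id) root_biggcd.
  by apply/allP => q /mapP[j]; rewrite mem_iota => /root_p jr ->.
have /dvdp_exp_XsubCP[[|e'] em ge] := g_dvd.
  by have := g_root; rewrite (eqp_root ge) expr0 rootC oner_eq0.
exact: root_in_base k0 ge.
Qed.
End InvariantField.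

(** * Symmetric powers as spaces of forms *)


Section CopyIndex.
Variable n : nat.
Local Notation N := (\sum_(i < n) n)%N.

(** An index of the [n] copies is a pair: the copy becomes the row of the matrix variable, and the
    coordinate within the copy its column. *)
Definition copy_of (s : 'I_N) : 'I_n := tagnat.sig1 s.
Definition row_of (s : 'I_N) : 'I_n := tagnat.sig2 s.
Definition copy_row (i j : 'I_n) : 'I_N := @tagnat.Rank n (fun=> n) i j.

Lemma copy_rowK1 i j : copy_of (copy_row i j) = i.
Proof. exact: tagnat.Rank1K. Qed.

Lemma copy_rowK2 i j : row_of (copy_row i j) = j.
Proof. by apply: val_inj; rewrite /row_of /copy_row tagnat.Rank2K. Qed.

Lemma copy_row_of s : copy_row (copy_of s) (row_of s) = s.
Proof. exact: tagnat.sig2K. Qed.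

Lemma sum_copy_row (V : nmodType) (f : 'I_N -> V) : \sum_s f s = \sum_i \sum_j f (copy_row i j).
Proof.
rewrite pair_bigA /=; apply: reindex => /=.
exists (fun s => (copy_of s, row_of s)) => [[i j] _|s _] /=; last exact: copy_row_of.
by rewrite copy_rowK1 copy_rowK2.
Qed.

Lemma mxdiagE (V : nmodType) (M : 'M[V]_n) s t :
  (\mxdiag_(i < n) M) s t = if copy_of s == copy_of t then M (row_of s) (row_of t) else 0.
Proof. by rewrite !mxE -/(copy_of s) -/(copy_of t); case: eqP => _; rewrite ?conform_mx_id ?mxE. Qed.
End CopyIndex.

Lemma mxvec_index_inj p q (i i' : 'I_p) (j j' : 'I_q) :
  mxvec_index i j = mxvec_index i' j' -> i = i' /\ j = j'.
Proof. by move=> /cast_ord_inj/enum_rank_inj[]. Qed.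

Section SymmetricPower.
Variables (n m : nat).
Local Notation N := (\sum_(i < n) n)%N.
Local Notation D := (Sym_dim N m).

Lemma Sym_monomial_deg (j : 'I_D) : mdeg (Sym_monomial j) = m.
Proof. by rewrite /Sym_monomial; case: (enum_val j) => mu /= /eqP. Qed.

Lemma Sym_monomial_inj : injective (@Sym_monomial N m).
Proof. by move=> i j /val_inj/val_inj/enum_val_inj. Qed.

Lemma Sym_monomial_surj mu : mdeg mu = m -> exists j : 'I_D, Sym_monomial j = mu.
Proof.
move=> md; have mdS : (mdeg mu < m.+1)%N by rewrite md.
have mdE : mdeg (BMultinom mdS) == m by rewrite /= md.
by exists (enum_rank (exist _ (BMultinom mdS) mdE : Sym_index N m)); rewrite /Sym_monomial enum_rankK.
Qed.

Section Ring.
Variable R : comNzRingType.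

(* The values at [P] of the monomials of degree [m] in the entries of a matrix. *)
Definition symval (P : 'M[R]_n) : 'rV[R]_D :=
  \row_j 'X_[R, Sym_monomial j].@[fun s => P (copy_of s) (row_of s)].

(** Sending each variable to its column of the block diagonal matrix is the substitution of [X M]
    for [X], row by row. The image of a monomial is homogeneous of degree [m], so the monomials
    indexing the rows of [Const m M] account for all its terms. *)
Lemma symval_mulmx (P M : 'M[R]_n) : symval (P *m M) = symval P *m Const m M.
Proof.
apply/rowP => j; rewrite !mxE; set v := fun s => P (copy_of s) (row_of s).
set q := [tuple \sum_(h < N) (\mxdiag_(i < n) M) h l *: 'X_h | l < N].
have qh : 'X_[R, Sym_monomial j] \mPo q \is m.-homog.
  rewrite comp_mpolyX; suff : \prod_(l < N) tnth q l ^+ Sym_monomial j l \is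
      (\sum_l Sym_monomial j l)%N.-homog by rewrite -mdegE Sym_monomial_deg.
  apply: (big_ind2 (fun (f : {mpoly R[N]}) d => f \is d.-homog)) => [|p e q' e' pe qe'|l _].
  - exact: dhomog1.
  - exact: dhomogM.
  suff : tnth q l \is 1.-homog by move/(dhomogMn (Sym_monomial j l)); rewrite mul1n.
  rewrite tnth_mktuple; apply: rpred_sum => h _; rewrite rpredZ // dhomogX /=.
  by rewrite mdeg1.
transitivity (('X_[R, Sym_monomial j] \mPo q).@[v]).
  rewrite comp_mpoly_meval; apply: meval_eq => l; rewrite tnth_mktuple raddf_sum /=.
  under eq_bigr do rewrite mevalZ mevalXU mxdiagE.
  rewrite sum_copy_row (bigD1 (copy_of l)) //= [X in _ + X]big1 => [|i il].
    rewrite addr0 !mxE; apply: eq_bigr => h _; rewrite copy_rowK1 copy_rowK2 eqxx /v.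
    by rewrite copy_rowK1 copy_rowK2 mulrC.
  by apply: big1 => h _; rewrite copy_rowK1 (negPf il) mul0r.
rewrite {1}[_ \mPo q]mpolyE raddf_sum /=.
transitivity (\sum_(mu <- msupp ('X_[R, Sym_monomial j] \mPo q)) \sum_(i < D)
    (if mu == Sym_monomial i then 'X_[R, mu].@[v] * ('X_[R, Sym_monomial j] \mPo q)@_mu else 0)).
  rewrite big_seq [RHS]big_seq; apply: eq_bigr => mu mus.
  have [i <-] := Sym_monomial_surj (dhomog_mf qh mus).
  rewrite (bigD1 i) //= eqxx [X in _ = _ + X]big1 ?addr0 ?mevalZ 1?mulrC // => i' ii'.
  by rewrite (inj_eq Sym_monomial_inj) eq_sym (negPf ii').
rewrite exchange_big; apply: eq_bigr => i _ /=; rewrite !mxE -big_mkcond /=.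
have [iq|iq] := boolP (Sym_monomial i \in msupp ('X_[R, Sym_monomial j] \mPo q)).
  rewrite (big_rem _ iq) /= eqxx [X in _ + X = _]big1_seq ?addr0 // => mu /andP[/eqP ->].
  by rewrite mem_rem_uniq ?msupp_uniq // inE eqxx.
rewrite (memN_msupp_eq0 iq) mulr0 big1_seq // => mu /andP[/eqP ->].
by rewrite (negPf iq).
Qed.
End Ring.

Section Morphism.
Variables (R S : comNzRingType) (h : {rmorphism R -> S}).

Lemma map_symval P : map_mx h (symval P) = symval (map_mx h P).
Proof.
apply/rowP => j; rewrite !mxE !mevalX rmorph_prod; apply: eq_bigr => s _.
by rewrite rmorphXn /= mxE.
Qed.
End Morphism.

Section Form.
Variable R : comNzRingType.
Local Notation Pol := {mpoly R[n * n]}.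
Local Notation mC := (@mpolyC (n * n) R).

Definition form (c : 'cV[R]_D) : Pol := (symval gmx *m map_mx mC c) 0 0.

Definition spread (mu : 'X_{1..N}) : 'X_{1..n * n} := (\sum_s U_(mxvec_index (copy_of s) (row_of s)) *+ mu s)%MM.

Lemma symval_gmx j : symval (gmx : 'M[Pol]_n) 0 j = 'X_[spread (Sym_monomial j)].
Proof.
rewrite mxE mevalX -mprodXE; apply: eq_bigr => s _.
by rewrite !mxE mpolyXn.
Qed.

Lemma spreadE mu i j : spread mu (mxvec_index i j) = mu (copy_row i j).
Proof.
rewrite mnm_sumE (bigD1 (copy_row i j)) //= [X in (_ + X)%N]big1 => [|s sij].
  by rewrite mulmnE mnm1E copy_rowK1 copy_rowK2 eqxx mul1n addn0.
rewrite mulmnE mnm1E; case: eqP => // /mxvec_index_inj[si sj].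
by move: sij; rewrite -si -sj copy_row_of eqxx.
Qed.

Lemma spread_inj : injective spread.
Proof.
move=> mu nu e; apply/mnmP => s; rewrite -(copy_row_of s) -!spreadE.
by rewrite e.
Qed.

Lemma mdeg_spread mu : mdeg (spread mu) = mdeg mu.
Proof.
by rewrite mdeg_sum [RHS]mdegE; apply: eq_bigr => s _; rewrite mdegMn mdeg1 mul1n.
Qed.

Lemma spread_surj nu : exists mu, spread mu = nu.
Proof.
exists [multinom nu (mxvec_index (copy_of s) (row_of s)) | s < N].
apply/mnmP => l; case/mxvec_indexP: l => i j.
by rewrite spreadE mnmE copy_rowK1 copy_rowK2.
Qed.

Lemma formE c : form c = \sum_j c j 0 *: 'X_[spread (Sym_monomial j)].
Proof.
by rewrite /form mxE; apply: eq_bigr => j _; rewrite symval_gmx mxE mulrC mul_mpolyC.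
Qed.

Lemma form_coef c j : (form c)@_(spread (Sym_monomial j)) = c j 0.
Proof.
rewrite formE (raddf_sum (mcoeff _)) (bigD1 j) //= mcoeffZ mcoeffX eqxx mulr1.
rewrite [X in _ + X]big1 ?addr0 // => i ij; rewrite mcoeffZ mcoeffX.
by rewrite (inj_eq spread_inj) (inj_eq Sym_monomial_inj) (negPf ij) mulr0.
Qed.

Lemma form_inj : injective form.
Proof. by move=> c d e; apply/colP => j; rewrite -!form_coef e. Qed.

Lemma form_homog f : f \is m.-homog -> exists c, f = form c.
Proof.
move=> fh; exists (\col_j f@_(spread (Sym_monomial j))); apply/mpolyP => nu.
have [mu <-] := spread_surj nu; have [md|md] := eqVneq (mdeg mu) m.
  by have [j <-] := Sym_monomial_surj md; rewrite form_coef mxE.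
have md' : mdeg (spread mu) != m by rewrite mdeg_spread.
rewrite (dhomog_nemf_coeff fh md') formE (raddf_sum (mcoeff _)) [RHS]big1 // => j _ /=.
rewrite mcoeffZ mcoeffX (inj_eq spread_inj); have [e|_] := eqVneq (Sym_monomial j) mu; last by rewrite mulr0.
by case/eqP: md; rewrite -e Sym_monomial_deg.
Qed.
End Form.

Lemma map_Const (R S : comNzRingType) (h : {rmorphism R -> S}) (M : 'M[R]_n) :
  map_mx h (Const m M) = Const m (map_mx h M).
Proof.
apply/matrixP => i j; rewrite !mxE -[LHS]/(h _) -mcoeff_map_mpoly !comp_mpolyX rmorph_prod.
congr (_@_ _); apply: eq_bigr => l _; rewrite rmorphXn /= !tnth_mktuple raddf_sum.
congr (_ ^+ _); apply: eq_bigr => s _; rewrite /= map_mpolyZ map_mpolyX !mxdiagE mxE.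
by case: ifP; rewrite ?rmorph0.
Qed.

Lemma map_form (R S : comNzRingType) (h : {additive R -> S}) (c : 'cV[R]_D) :
  map_mpoly h (form c) = form (map_mx h c).
Proof.
apply/mpolyP => nu; have [mu <-] := spread_surj nu; rewrite mcoeff_map_mpoly.
have [md|md] := eqVneq (mdeg mu) m.
  by have [j <-] := Sym_monomial_surj md; rewrite !form_coef mxE.
have z (T : comNzRingType) (d : 'cV[T]_D) : (form d)@_(spread mu) = 0.
  rewrite formE (raddf_sum (mcoeff _)) [LHS]big1 // => j _ /=; rewrite mcoeffZ mcoeffX (inj_eq spread_inj).
  have [e|_] := eqVneq (Sym_monomial j) mu; last by rewrite mulr0.
  by case/eqP: md; rewrite -e Sym_monomial_deg.
by rewrite !z raddf0.
Qed.

Lemma mev_form (R S : comNzRingType) (h : {rmorphism R -> S}) (P : 'M[S]_n) (c : 'cV[R]_D) :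
  mev h P (form c) = (symval P *m map_mx h c) 0 0.
Proof.
transitivity (map_mx (mev h P) (symval gmx *m map_mx (@mpolyC (n * n) R) c) 0 0).
  by rewrite mxE.
by rewrite map_mxM map_symval map_gmx map_mevC.
Qed.

(** Both sides are the coefficient of the infinitesimal in the value of the form at
    [X (1 + eps B)]. *)
Lemma Dm_form (F : fieldType) (B : 'M[F]_n) (c : 'cV[F]_D) :
  Dm B (form c) = form (const m B *m c).
Proof.
pose mC := @mpolyC (n * n) F; pose Pol := {mpoly F[n * n]}.
pose Z : 'M[{poly Pol}]_n := 1%:M + 'X *: map_mx polyC (map_mx mC B).
rewrite unlock -mev_taylor1; set V := (_ + _ : 'M_n).
have -> : V = map_mx polyC (gmx : 'M[Pol]_n) *m Z.
  by rewrite mulmxDr mulmx1 -scalemxAr -map_mxM.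
rewrite (mev_form (polyC \o mC)) symval_mulmx -map_symval.
have ZE : Const m Z = map_mx (map_poly mC) (Const m (1%:M + 'X *: map_mx polyC B)).
  rewrite map_Const; congr (Const m _); rewrite map_mxD map_mx1 map_mxZ /= map_polyX.
  by congr (_ + _ *: _); apply/matrixP => i j; rewrite !mxE map_polyC.
rewrite {}ZE /form map_mxM mulmxA [in LHS]mxE [in RHS]mxE coef_sum; apply: eq_bigr => j _.
rewrite [map_mx _ c _ _]mxE coefMC [map_mx _ c _ _]mxE; congr (_ * _).
rewrite !mxE coef_sum; apply: eq_bigr => i _.
by rewrite ![map_mx _ _ _ _]mxE coefCM coef_map.
Qed.
End SymmetricPower.

(** * Reduced form and invariants *)


Lemma eq_dmev (R S : comNzRingType) n (h h' : {rmorphism R -> S}) (M B : 'M[S]_n) f :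
  h =1 h' -> dmev h M B f = dmev h' M B f.
Proof. by move=> hh'; apply: eq_bigr => i _; rewrite (eq_mev _ _ hh'). Qed.

Lemma rmorph_dmev (R S T : comNzRingType) (h : {rmorphism R -> S}) (g : {rmorphism S -> T}) n (M B : 'M[S]_n) f :
  g (dmev h M B f) = dmev (g \o h) (map_mx g M) (map_mx g B) f.
Proof.
rewrite rmorph_sum; apply: eq_bigr => i _.
by rewrite rmorphM -map_mxvec mxE (rmorph_mev h g).
Qed.

Lemma dmevN (R S : comNzRingType) n (h : {rmorphism R -> S}) (M B : 'M[S]_n) f :
  dmev h M (- B) f = - dmev h M B f.
Proof. by rewrite -sumrN; apply: eq_bigr => i _; rewrite linearN mxE mulrN. Qed.

Lemma DmE (F : fieldType) n (x : 'M[F]_n) f :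
  Dm x f = dmev (@mpolyC _ F) gmx (gmx *m map_mx (@mpolyC _ F) x) f.
Proof. by rewrite unlock. Qed.

Lemma Dm0 (F : fieldType) n f : Dm (0 : 'M[F]_n) f = 0.
Proof.
have := Dm_linear f 1 0 0; rewrite scaler0 addr0 scale1r => e.
by apply: (addrI (Dm (0 : 'M[F]_n) f)); rewrite addr0 -e.
Qed.

Lemma Dm_suml (F : fieldType) n (I : finType) (a : I -> F) (B : I -> 'M[F]_n) f :
  Dm (\sum_i a i *: B i) f = \sum_i a i *: Dm (B i) f.
Proof.
apply: (big_ind2 (fun x y => Dm x f = y)) => [|x _ y _ <- <-|i _]; first exact: Dm0.
  by rewrite -[x]scale1r Dm_linear !scale1r.
by rewrite -[_ *: B i]addr0 Dm_linear Dm0 addr0.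
Qed.

Section BaseChange.
Variables (F L : fieldType) (h : {rmorphism F -> L}) (n : nat).
Implicit Types (x : 'M[F]_n) (f : {mpoly F[n * n]}).

Lemma map_gmx_mpoly : map_mx (map_mpoly h) (gmx : 'M[{mpoly F[n * n]}]_n) = gmx.
Proof. by apply/matrixP => i j; rewrite !mxE /= map_mpolyX. Qed.

Lemma map_mpolyC_mx m p (x : 'M[F]_(m, p)) :
  map_mx (map_mpoly h) (map_mx (@mpolyC (n * n) F) x) = map_mx (@mpolyC _ L) (map_mx h x).
Proof. by apply/matrixP => i j; rewrite !mxE /= map_mpolyC. Qed.

Lemma map_Rm x f : map_mpoly h (Rm x f) = Rm (map_mx h x) (map_mpoly h f).
Proof.
rewrite !RmE rmorph_mev map_mxM map_gmx_mpoly map_mpolyC_mx mev_map_mpoly.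
by apply: eq_mev => c /=; rewrite map_mpolyC.
Qed.

Lemma map_mderiv i f : map_mpoly h f^`M(i) = (map_mpoly h f)^`M(i).
Proof. by apply/mpolyP => m; rewrite mcoeff_map_mpoly /= !mcoeff_deriv mcoeff_map_mpoly rmorphMn. Qed.

Lemma dmev_map_mpoly (S : comNzRingType) (g : {rmorphism L -> S}) (M B : 'M[S]_n) f :
  dmev g M B (map_mpoly h f) = dmev (g \o h) M B f.
Proof. by apply: eq_bigr => i _; rewrite -map_mderiv mev_map_mpoly. Qed.

Lemma map_Dm x f : map_mpoly h (Dm x f) = Dm (map_mx h x) (map_mpoly h f).
Proof.
rewrite !DmE dmev_map_mpoly (rmorph_dmev _ (map_mpoly h)) map_mxM map_gmx_mpoly map_mpolyC_mx.
by apply: eq_dmev => c /=; rewrite map_mpolyC.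
Qed.

Lemma map_mpoly_inj N : injective (map_mpoly h : {mpoly F[N]} -> {mpoly L[N]}).
Proof.
move=> f g e; apply/mpolyP => m; apply: (fmorph_inj h).
by have := congr1 (mcoeff m) e; rewrite !mcoeff_map_mpoly.
Qed.
End BaseChange.

Lemma Rm_Lm (F : fieldType) n (x y : 'M[F]_n) f : Rm x (Lm y f) = Lm y (Rm x f).
Proof.
by rewrite (RmE x (Lm y f)) mev_Lm (LmE y (Rm x f)) mev_Rm mulmxA.
Qed.

Lemma map_mpolyK (R S T : nzRingType) (h : {additive R -> S}) (g : {additive S -> T}) N (f : {mpoly R[N]}) :
  map_mpoly g (map_mpoly h f) = map_mpoly (g \o h) f.
Proof. by apply/mpolyP => m; rewrite !mcoeff_map_mpoly. Qed.

(** * From the reduced form to constant invariants *)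

Section Solutions.
Variables (k K : diffFieldType) (iK : {rmorphism k -> K}) (n : nat) (A : 'M[k]_n).
Hypothesis K_PV : is_Picard_Vessiot iK A.
Variable U : 'M[K]_n.
Hypothesis U_sol : solution_basis iK A U.
Local Notation C := (constants k).
Local Notation cK := (const_to_K iK).
Local Notation ev := (mev iK U).
Local Notation G := (Galois_group iK U).
Local Notation dK := (map_mpoly (@der K)).
Local Notation mCK := (@mpolyC (n * n) K).
Hypothesis C0 : [pchar C] =i pred0.

Lemma der_map_cK N (w : {mpoly C[N]}) : map_mpoly (@der K) (map_mpoly cK w) = 0.
Proof. by apply/mpolyP => m; rewrite !mcoeff_map_mpoly /= (der_cK K_PV) mcoeff0. Qed.

Lemma map_mpoly_der_iK N (f : {mpoly k[N]}) :
  map_mpoly (@der K) (map_mpoly iK f) = map_mpoly iK (map_mpoly der f).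
Proof. by apply/mpolyP => m; rewrite !mcoeff_map_mpoly /= (iK_der K_PV). Qed.

Lemma map_iK_valp N (w : {mpoly C[N]}) : map_mpoly iK (map_mpoly val w) = map_mpoly cK w.
Proof. by apply/mpolyP => m; rewrite !mcoeff_map_mpoly. Qed.

Lemma der_invU : map_mx der (invmx U) = - (invmx U *m map_mx iK A).
Proof.
have Uu := U_unit K_PV U_sol.
have dM (X Y : 'M[K]_n) : map_mx der (X *m Y) = map_mx der X *m Y + X *m map_mx der Y.
  apply/matrixP => i j; rewrite !mxE raddf_sum -big_split; apply: eq_bigr => l _.
  by rewrite /= derM !mxE.
have := dM (invmx U) U; rewrite mulVmx // (U_system U_sol).
have -> : map_mx der (1%:M : 'M[K]_n) = 0.
  by apply/matrixP => i j; rewrite !mxE; case: eqP => _; rewrite ?der1 ?der0.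
move/eqP; rewrite eq_sym addr_eq0 => /eqP e.
by rewrite -[LHS](mulmxK Uu) e mulNmx mulmxA mulmxK.
Qed.

(* [f (Y U^-1)] is killed by the derivation of [K]. *)
Lemma pullback_constant f : map_mpoly der f = Dm A f ->
  exists2 w, map_mpoly cK w = Rm (invmx U) (map_mpoly iK f) & forall M, G M -> Rm M w = w.
Proof.
move=> fA; set s := Rm (invmx U) (map_mpoly iK f).
pose V := gmx *m map_mx mCK (invmx U).
pose hK : {rmorphism k -> {mpoly K[n * n]}} := mCK \o iK.
have sE : s = mev hK V f by rewrite /s RmE mev_map_mpoly.
have ds : dK s = 0.
  rewrite sE (mev_chain (h := hK) (d := @der k) (delta := dK)) => [|p q|c].
  - rewrite fA mev_Dm.
    suff -> : map_mx dK V = - (V *m map_mx hK A).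
      by rewrite dmevN; apply: subrr.
    have -> : map_mx dK V = gmx *m map_mx mCK (map_mx der (invmx U)).
      apply/matrixP => i j; rewrite !mxE (raddf_sum dK); apply: eq_bigr => l _.
      by rewrite /= map_mpoly_derM !mxE map_mpolyC der_mpolyX mul0r add0r.
    by rewrite der_invU map_mxN mulmxN map_mxM mulmxA (map_mx_comp iK mCK).
  - exact: map_mpoly_derM.
  by rewrite /= map_mpolyC (iK_der K_PV).
have [w we] := mpoly_constant K_PV ds; exists w => // M GM.
(* The automorphism fixes the coefficients of [w] and of [f], and replaces [U] by [U M]. *)
have [g [_ _ gk gU]] := GM; have [Mu _] := (Galois_rel K_PV U_sol M).1 GM.
have gw : map_mpoly g (map_mpoly cK w) = map_mpoly cK w.
  by apply/mpolyP => m; rewrite !mcoeff_map_mpoly /= gk.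
have gf : map_mpoly g (map_mpoly iK f) = map_mpoly iK f.
  by apply/mpolyP => m; rewrite !mcoeff_map_mpoly /= gk.
suff e : Rm (invmx M) w = w by rewrite -{1}e Rm_mulmx mulmxV // Rm1.
apply: (map_mpoly_inj (h := cK)); rewrite map_Rm -[RHS]gw -we /s map_Rm gf Rm_mulmx.
rewrite !map_invmx gU; congr (Rm _ _).
have Uu := U_unit K_PV U_sol; have cMu : map_mx cK M \in unitmx by rewrite map_unitmx.
by apply: (can_inj (mulmxK Uu)); apply: (can_inj (mulmxK cMu));
   rewrite mulmxKV // mulVmx // -mulmxA mulVmx // unitmx_mul Uu.
Qed.

(** For every [N], the polynomial [w (N X) - w (N)] vanishes on [G], so [Lie G] annihilates [w], and
    [A] is a combination of elements of [Lie G]. *)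
Lemma Dm_invariant (L : fieldType) (ib : {rmorphism k -> L}) w :
  Lie_over (fun c : C => ib (val c)) G (map_mx ib A) ->
  (forall M, G M -> Rm M w = w) -> Dm A (map_mpoly val w) = 0.
Proof.
move=> [r [B [a [BL AE]]]] wG; apply: (map_mpoly_inj (h := ib)).
rewrite map_Dm AE rmorph0.
pose hb : {rmorphism C -> L} := ib \o val.
have -> : map_mpoly ib (map_mpoly val w) = map_mpoly hb w by rewrite map_mpolyK.
have wB i : Dm (B i) w = 0.
  apply: evalm_eq => // N; rewrite rmorph0.
  have : van G (Lm N w - (evalm N w)%:MP).
    by move=> M GM; rewrite evalmB evalm_Lm -evalm_Rm wG // evalmC subrr.
  move=> /((LieE G (B i)).1 (BL i)); rewrite devalmB devalm_Lm mulmx1 -evalm_Dm.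
  by rewrite [devalm _ _ _%:MP]dmevC subr0.
rewrite Dm_suml big1 // => i _.
by rewrite -[map_mx _ (B i)]/(map_mx hb (B i)) -(map_Dm hb) wB rmorph0 scaler0.
Qed.

(* [f |-> f (Y U^-1)] maps the invariants of [G] to themselves, injectively, hence onto:
   the pullback of [f] is itself the pullback of a combination of invariants. *)
Lemma reduced_constant_forms (L : fieldType) (ib : {rmorphism k -> L}) f :
  Lie_over (fun c : C => ib (val c)) G (map_mx ib A) ->
  map_mpoly der f = Dm A f -> map_mpoly der f = 0.
Proof.
move=> AL fA; pose T := Rm (invmx U) : {linear {mpoly K[n * n]} -> {mpoly K[n * n]}}.
pose f_K := map_mpoly iK f.
have Uu := U_unit K_PV U_sol.
have T_inj : injective T.
  by apply: (can_inj (g := Rm U)) => p; rewrite /T /= Rm_mulmx mulmxV // Rm1.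
pose d := \max_(m <- msupp (T f_K)) mdeg m.
have [|q q0 qT] := mpoly_dependence (d := d) (T := T) (f := T f_K).
  elim=> [|j IHj] m; first by move=> mP; rewrite /d (big_rem m) //= leq_maxl.
  by rewrite iterS; exact: (Rm_deg IHj).
have [r rE] := inj_papply T_inj q0 qT.
have fE : f_K = papply T r (T f_K) by apply: T_inj; rewrite -papply_comm.
have step j : exists2 w, map_mpoly cK w = iter j T (T f_K) & forall M, G M -> Rm M w = w.
  elim: j => [|j [w we wG]]; first exact: pullback_constant.
  have wA : map_mpoly der (map_mpoly val w) = Dm A (map_mpoly val w).
    rewrite (Dm_invariant AL wG); apply: (map_mpoly_inj (h := iK)).
    by rewrite -map_mpoly_der_iK map_iK_valp der_map_cK rmorph0.
  have [w' w'e w'G] := pullback_constant wA.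
  by exists w' => //; rewrite w'e map_iK_valp we.
rewrite fA; apply: (map_mpoly_inj (h := iK)); rewrite map_Dm rmorph0 -/f_K fE.
rewrite /papply (linear_sum (Dm _)) big1 // => j _ /=.
have [w we wG] := step j; rewrite linearZ /= -we -map_iK_valp -map_Dm.
by rewrite (Dm_invariant AL wG) rmorph0 scaler0.
Qed.
End Solutions.

Lemma dhomog_map (F L : fieldType) (h : {rmorphism F -> L}) N (f : {mpoly F[N]}) d :
  (map_mpoly h f \is d.-homog) = (f \is d.-homog).
Proof.
have e m : (m \in msupp (map_mpoly h f)) = (m \in msupp f).
  by rewrite !mcoeff_msupp mcoeff_map_mpoly /= fmorph_eq0.
by apply/dhomogP/dhomogP => H m; have := H m; rewrite e.
Qed.

Lemma Rm_pihomog (F : fieldType) n (x : 'M[F]_n) f d :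
  Rm x (pihomog mdeg d f) = pihomog mdeg d (Rm x f).
Proof.
pose b := maxn d.+1 (msize f).
have fE := pihomog_partitionE (leq_maxr d.+1 (msize f)); rewrite -/b in fE.
have db : (d < b)%N by exact: leq_maxl.
transitivity (pihomog mdeg d (\sum_(i < b) Rm x (pihomog mdeg i f))); last first.
  by rewrite -(linear_sum (Rm x)) -fE.
rewrite [RHS](linear_sum (pihomog mdeg d)) [RHS](bigD1 (Ordinal db)) //=.
rewrite (pihomog_dE (Rm_homog _ (pihomogP _ _ _))) [X in _ + X]big1 ?addr0 // => i id'.
by apply: pihomog_ne0 (Rm_homog _ (pihomogP _ _ _)).
Qed.

Section GenericTranslate.
Variables (k0 k K : fieldType) (i0 : {rmorphism k0 -> k}) (iK : {rmorphism k -> K}) (n : nat).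

(* [v (Y X)], as a polynomial in [Y] with coefficients polynomials in [X]. *)
Definition gen_translate (v : {mpoly k0[n * n]}) : {mpoly {mpoly k[n * n]}[n * n]} :=
  mev (@mpolyC (n * n) _ \o (@mpolyC (n * n) k \o i0)) (gmx *m map_mx (@mpolyC _ _) gmx) v.

Lemma map_gen_translate (V : 'M[K]_n) v :
  map_mpoly (mev iK V) (gen_translate v) = Rm V (map_mpoly (iK \o i0) v).
Proof.
rewrite /gen_translate RmE mev_map_mpoly (rmorph_mev _ (map_mpoly (mev iK V))) map_mxM.
have -> : map_mx (map_mpoly (mev iK V)) (gmx : 'M[{mpoly {mpoly k[n * n]}[n * n]}]_n) = gmx.
  by apply/matrixP => i j; rewrite !mxE /= map_mpolyX.
have -> : map_mx (map_mpoly (mev iK V)) (map_mx (@mpolyC (n * n) {mpoly k[n * n]}) gmx) =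
    map_mx (@mpolyC _ _) V.
  by rewrite -{2}(map_gmx iK V); apply/matrixP => i j; rewrite !mxE /= map_mpolyC.
by apply: eq_mev => c /=; rewrite map_mpolyC /= mevC.
Qed.
End GenericTranslate.

Section Bases.
Variables (k K : diffFieldType) (iK : {rmorphism k -> K}) (n : nat) (A : 'M[k]_n).
Hypothesis K_PV : is_Picard_Vessiot iK A.
Variable U : 'M[K]_n.
Hypothesis U_sol : solution_basis iK A U.
Local Notation C := (constants k).
Local Notation cK := (const_to_K iK).
Local Notation G := (Galois_group iK U).

Variable N : 'M[C]_n.
Hypothesis Nu : N \in unitmx.

Lemma Galois_conj M : G M -> Galois_group iK (U *m map_mx cK N) (invmx N *m M *m N).
Proof.
move=> [g [gb gd gk gU]]; exists g; split=> //.
have gN : map_mx g (map_mx cK N) = map_mx cK N by apply/matrixP => i j; rewrite !mxE gk.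
have e : N *m (invmx N *m M *m N) = M *m N by rewrite !mulmxA mulmxV // mul1mx.
by rewrite map_mxM gU gN -!(mulmxA U) -!map_mxM e.
Qed.

Lemma solution_basis_conj : solution_basis iK A (U *m map_mx cK N).
Proof.
split; first exact: UM_system.
move=> v /(U_sol.2 v)[c [ve cu]]; exists (invmx N *m c); split.
  by rewrite ve -mulmxA -map_mxM mulmxA mulmxV // mul1mx.
move=> c'; rewrite -mulmxA -map_mxM => /cu ->.
by rewrite mulmxA mulVmx // mul1mx.
Qed.
End Bases.

(** * Invariants of the group as invariants of the module *)

Section Invariants.
Variables (k K : diffFieldType) (iK : {rmorphism k -> K}) (n : nat) (A : 'M[k]_n).
Hypothesis K_PV : is_Picard_Vessiot iK A.
Variable U : 'M[K]_n.
Hypothesis U_sol : solution_basis iK A U.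
Local Notation C := (constants k).
Local Notation cK := (const_to_K iK).
Local Notation G := (Galois_group iK U).
Local Notation dK := (map_mpoly (@der K)).
Local Notation mCK := (@mpolyC (n * n) K).
Hypothesis C_closed : GRing.closed_field_axiom C.
Hypothesis k0 : [pchar k] =i pred0.

(** The coefficients of [v (Y U)] in [Y] are values at [U] of polynomials over [k], and replacing
    [U] by [U M] does not change them, so they lie in the fixed field [k]. *)
Lemma invariant_rational v : (forall M, G M -> Rm M v = v) ->
  exists f, Rm U (map_mpoly cK v) = map_mpoly iK f.
Proof.
move=> vG; apply: map_mpoly_coefs => m.
have yE M : (Rm (U *m map_mx cK M) (map_mpoly cK v))@_m =
    mev iK (U *m map_mx cK M) (gen_translate val v)@_m.
  by rewrite -[RHS]mcoeff_map_mpoly map_gen_translate.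
apply: (Galois_fixed K_PV U_sol C_closed k0 (a := (gen_translate val v)@_m)).
  by have := yE 1%:M; rewrite map_mx1 mulmx1.
by move=> M GM; rewrite -yE -Rm_mulmx -map_Rm vG.
Qed.

Lemma der_translate v : dK (Rm U (map_mpoly cK v)) = Dm (map_mx iK A) (Rm U (map_mpoly cK v)).
Proof.
pose hC : {rmorphism C -> {mpoly K[n * n]}} := mCK \o cK.
have -> : Rm U (map_mpoly cK v) = mev hC (gmx *m map_mx mCK U) v by rewrite RmE mev_map_mpoly.
rewrite (mev_chain (h := hC) (d := GRing.null_fun C) (delta := dK)) => [|p q|c]; last first.
- by rewrite /= map_mpolyC /= (der_cK K_PV) !raddf0.
- exact: map_mpoly_derM.
have -> : map_mpoly (GRing.null_fun C) v = 0.
  by apply/mpolyP => m; rewrite mcoeff_map_mpoly mcoeff0.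
rewrite rmorph0 add0r.
have -> : mev hC (gmx *m map_mx mCK U) v = Rm U (map_mpoly cK v) by rewrite RmE mev_map_mpoly.
rewrite DmE dmev_Rm dmev_map_mpoly -mulmxA -map_mxM -(U_system U_sol).
congr (dmev _ _ _ _); apply/matrixP => i j; rewrite !mxE (raddf_sum dK); apply: eq_bigr => l _.
by rewrite /= map_mpoly_derM !mxE map_mpolyC der_mpolyX mul0r add0r.
Qed.

Hypothesis forms_constant : forall m (f : {mpoly k[n * n]}), f \is m.-homog ->
  map_mpoly der f = Dm A f -> map_mpoly der f = 0.

(** [v (Y U)] has its coefficients in [k] and satisfies the equation of the invariants of the
    module, which are constant by hypothesis. *)
Lemma homog_invariant_constant m v : v \is m.-homog -> (forall M, G M -> Rm M v = v) ->
  exists w, Rm U (map_mpoly cK v) = map_mpoly cK w.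
Proof.
move=> vm vG; have [f fE] := invariant_rational vG.
apply: (mpoly_constant K_PV); rewrite fE (map_mpoly_der_iK K_PV) (@forms_constant m) ?rmorph0 //.
  by rewrite -(dhomog_map iK) -fE; apply: Rm_homog; rewrite dhomog_map.
apply: (map_mpoly_inj (h := iK)); rewrite -(map_mpoly_der_iK K_PV) map_Dm -fE.
exact: der_translate.
Qed.

Lemma invariant_constant v : (forall M, G M -> Rm M v = v) ->
  exists w, Rm U (map_mpoly cK v) = map_mpoly cK w.
Proof.
move=> vG; have /choice[w wP] d : exists w, Rm U (map_mpoly cK (pihomog mdeg d v)) = map_mpoly cK w.
  apply: (@homog_invariant_constant d); first exact: pihomogP.
  by move=> M GM; rewrite Rm_pihomog vG.
exists (\sum_(d < msize v) w d); rewrite {1}(pihomog_partitionE (leqnn (msize v))).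
rewrite !(raddf_sum (map_mpoly cK)) (linear_sum (Rm U)); apply: eq_bigr => d _.
exact: wP.
Qed.
End Invariants.

Definition set_row (R : Type) n (A : 'M[R]_n) (u : 'rV[R]_n) j : 'M[R]_n :=
  \matrix_(a, b) if a == j then u 0 b else A a b.

Lemma mul_row_adj (R : comNzRingType) n (A : 'M[R]_n) (u : 'rV[R]_n) j :
  (u *m \adj A) 0 j = \det (set_row A u j).
Proof.
rewrite (expand_det_row _ j) mxE; apply: eq_bigr => i _.
rewrite [in RHS]mxE eqxx mxE; congr (_ * _); rewrite /cofactor; congr (_ * \det _).
by apply/matrixP => a b; rewrite !mxE eq_sym (negPf (neq_lift _ _)).
Qed.

(** * Transport of the equations of the group *)

Section VanishingBasis.
Variables (F : fieldType) (n : nat) (G : 'M[F]_n -> Prop).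
Local Notation Pol := {mpoly F[n * n]}.
Implicit Types (f : Pol).

Lemma van_basis d : exists e (f : 'I_e -> Pol), [/\ forall i, van G (f i),
    forall i m, m \in msupp (f i) -> (mdeg m <= d)%N,
    forall a : 'I_e -> F, \sum_i a i *: f i = 0 -> forall i, a i = 0
  & forall g, van G g -> (forall m, m \in msupp g -> (mdeg m <= d)%N) ->
      exists a : 'I_e -> F, g = \sum_i a i *: f i].
Proof.
pose J := bmultinom (n * n) d.+1.
pose pol (c : 'rV[F]_#|{: J}|) : Pol := \sum_i c 0 i *: 'X_[bmnm (enum_val i)].
have pol_lin a x y : pol (a *: x + y) = a *: pol x + pol y.
  rewrite scaler_sumr -big_split; apply: eq_bigr => i _.
  by rewrite !mxE scalerDl scalerA.
pose polM := GRing.isLinear.Build F 'rV[F]_#|{: J}| Pol *:%R pol pol_lin.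
pose polL : {linear 'rV[F]_#|{: J}| -> Pol} := HB.pack pol polM.
have pol_deg c m : m \in msupp (pol c) -> (mdeg m <= d)%N.
  rewrite mcoeff_msupp leqNgt; apply: contra_neqN => md.
  rewrite (raddf_sum (mcoeff m)) big1 // => i _; rewrite /= mcoeffZ mcoeffX.
  case: eqP => [e|_]; last by rewrite mulr0.
  by move: md; rewrite -e ltnNge -ltnS bmdeg.
have pol_coef c i : (pol c)@_(bmnm (enum_val i)) = c 0 i.
  rewrite (raddf_sum (mcoeff _)) (bigD1 i) //= [X in _ + X]big1 => [|j ji]; rewrite mcoeffZ mcoeffX.
    by rewrite eqxx mulr1 addr0.
  by rewrite (inj_eq val_inj) (inj_eq enum_val_inj) (negPf ji) mulr0.
have pol_surj g : (forall m, m \in msupp g -> (mdeg m <= d)%N) -> exists c, g = pol c.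
  move=> gd; exists (\row_i g@_(bmnm (enum_val i))); apply/mpolyP => m.
  have [md|md] := leqP (mdeg m) d.
    have := pol_coef (\row_i g@_(bmnm (enum_val i))) (enum_rank (BMultinom (md : (mdeg m < d.+1)%N))).
    by rewrite mxE enum_rankK.
  rewrite !memN_msupp_eq0 //; apply/negP; [move/pol_deg|move/gd]; by rewrite leqNgt md.
have pol0 : pol 0 = 0 := linear0 polL.
have pol_sum I (r : seq I) (P : pred I) (g : I -> 'rV_#|{: J}|) :
    pol (\sum_(i <- r | P i) g i) = \sum_(i <- r | P i) pol (g i) := linear_sum polL _ _ _.
have polZ a x : pol (a *: x) = a *: pol x := linearZ_LR polL a x.
have [|a x y vx vy|V VE] := vspace_of_pred (L := fun c => van G (pol c)).
- by move=> M _; rewrite pol0 rmorph0.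
- by move=> M GM; rewrite pol_lin rmorphD /= evalmZ vx // vy // mulr0 addr0.
exists (\dim V), (fun i => pol (vbasis V)`_i); split=> [i|i m|a a0|g vg gd].
- by apply/VE/vbasis_mem/mem_nth; rewrite size_tuple.
- exact: pol_deg.
- have /freeP := basis_free (vbasisP V); apply; apply/rowP => i.
  rewrite -pol_coef mxE -[RHS](mcoeff0 _ (bmnm (enum_val i))) -a0; congr (_@_ _).
  by rewrite pol_sum; apply: eq_bigr => l _; rewrite polZ.
have [c gc] := pol_surj g gd; move: vg; rewrite gc => /VE cV.
exists (fun i => coord (vbasis V) i c); rewrite {1}(coord_vbasis cV) pol_sum.
by apply: eq_bigr => i _; rewrite polZ.
Qed.

Hypothesis F0 : [pchar F] =i pred0.

(** Points are added one by one: a nonzero combination killed by the points found so far has a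
    nonzero value at some matrix, which gives an independent row. *)
Lemma separating_points e (f : 'I_e -> Pol) :
  (forall a : 'I_e -> F, \sum_i a i *: f i = 0 -> forall i, a i = 0) ->
  exists N : 'I_e -> 'M[F]_n, (\matrix_(j, i) evalm (N j) (f i)) \in unitmx.
Proof.
move=> f_free.
suff H r : (r <= e)%N -> exists N : 'I_r -> 'M[F]_n, row_free (\matrix_(j, i) evalm (N j) (f i)).
  by have [N] := H e (leqnn e); rewrite row_free_unit; exists N.
elim: r => [|r IHr] re; first by exists (fun=> 0); rewrite flatmx0 /row_free mxrank0.
have [N NE] := IHr (ltnW re); set E := \matrix_(j, i) _ in NE.
have [c cE c0] : exists2 c : 'cV[F]_e, E *m c = 0 & c != 0.
  have /rowV0Pn[u uE u0] : kermx E^T != 0.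
    rewrite kermx_eq0 /row_free mxrank_tr; apply/eqP => e1.
    by have := rank_leq_row E; rewrite e1 leqNgt re.
  exists u^T; last by rewrite -(inj_eq trmx_inj) trmxK trmx0.
  by apply: trmx_inj; rewrite trmx_mul trmxK trmx0; apply/sub_kermxP.
have [N0 N0c] : exists N0, evalm N0 (\sum_i c i 0 *: f i) != 0.
  apply: contrapT => nN; case/eqP: c0; apply/colP => i; rewrite [RHS]mxE.
  apply: (f_free (fun i => c i 0)); apply: evalm_eq => // M; rewrite rmorph0.
  by apply: contrapT => /eqP MM; apply: nN; exists M.
exists (fun j : 'I_(1 + r) => match split j with inl _ => N0 | inr j' => N j' end).
suff RF : row_free (col_mx (\row_i evalm N0 (f i)) E).
  set E' := \matrix_(j, i) _; have -> // : E' = col_mx (\row_i evalm N0 (f i)) E.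
  by apply/matrixP => j i; rewrite !mxE; case: splitP => l _; rewrite !mxE.
apply: inj_row_free => v; rewrite -(@hsubmxK _ _ 1 r v) mul_row_col => v0.
have Nc : (\row_i evalm N0 (f i)) *m c = (evalm N0 (\sum_i c i 0 *: f i))%:M.
  apply/matrixP => a b; rewrite !ord1 !mxE eqxx mulr1n rmorph_sum; apply: eq_bigr => i _.
  by rewrite mxE /= evalmZ mulrC.
have l0 : lsubmx v = 0.
  have := congr1 (mulmx^~ c) v0; rewrite /= mulmxDl -!mulmxA cE mulmx0 addr0 mul0mx Nc mul_mx_scalar.
  by move/eqP; rewrite scaler_eq0 (negPf N0c) => /eqP.
move: v0; rewrite l0 mul0mx add0r => /eqP; rewrite -(mul0mx _ E).
by move/eqP/(row_free_inj NE) => ->; rewrite row_mx0.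
Qed.
End VanishingBasis.

Section Specialization.
Variables (F L : fieldType) (h : {rmorphism F -> L}) (n : nat).
Variables (G : 'M[F]_n -> Prop) (G_group : is_subgroup G).
Hypothesis F0 : [pchar F] =i pred0.
Local Notation Pol := {mpoly F[n * n]}.
Variables (U : 'M[L]_n) (P0 : 'M[F]_n).
Hypothesis P0u : P0 \in unitmx.
Hypothesis invariant_spec : forall v, (forall M, G M -> Rm M v = v) ->
  forall N, mev h (map_mx h N *m U) v = h (evalm (N *m P0) v).
Hypothesis G_observable : forall w chi, w != 0 -> semiinv G w chi ->
  exists2 b : Pol, b != 0 & forall M, G M -> chi M *: Rm M b = b.

Lemma nonzero_value (f : Pol) : f != 0 -> exists2 Z, Z \in unitmx & evalm Z f != 0.
Proof.
move=> f0; apply: contrapT => nz.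
have /eqP : detp F n * f = 0.
  apply: evalm_eq => // Z; rewrite rmorph0 evalmM [evalm Z (detp F n)]mev_detp.
  have [Zu|] := boolP (Z \in unitmx).
    apply/eqP; rewrite mulf_eq0; apply/orP; right; apply: contrapT => fZ.
    by apply: nz; exists Z => //; apply/negP.
  by rewrite unitmxE unitfE negbK => /eqP ->; rewrite mul0r.
rewrite mulf_eq0 (negPf f0) orbF => /eqP/(congr1 (evalm 1%:M)).
by rewrite [LHS]mev_detp det1 rmorph0 => /eqP; rewrite oner_eq0.
Qed.

(* If [b] has weight the inverse of [chi], then [a (N X) b (X)] is invariant. *)
Lemma semiinv_spec (w : Pol) chi : w != 0 -> semiinv G w chi -> exists2 c, c != 0 &
  forall a N, semiinv G a chi -> mev h (map_mx h N *m U) a = c * h (evalm (N *m P0) a).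
Proof.
move=> w0 wchi; have [b b0 bchi] := G_observable w0 wchi.
have inv N a : semiinv G a chi -> forall M, G M -> Rm M (Lm N a * b) = Lm N a * b.
  move=> achi M GM; rewrite rmorphM /= Rm_Lm achi // linearZ /= -scalerAl -{2}(bchi M GM).
  by rewrite scalerAr.
have spec N N' a : semiinv G a chi ->
    mev h (map_mx h (N *m N') *m U) a * mev h (map_mx h N' *m U) b =
    h (evalm (N *m N' *m P0) a) * h (evalm (N' *m P0) b).
  move=> /(inv N)/invariant_spec/(_ N'); rewrite rmorphM /= mev_Lm evalmM evalm_Lm rmorphM.
  by rewrite !mulmxA -map_mxM.
have [Z Zu bZ] := nonzero_value b0; have [Z' Zu' wZ'] := nonzero_value w0.
pose N' := Z *m invmx P0; have N'P0 : N' *m P0 = Z by rewrite mulmxKV.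
have N'u : N' \in unitmx by rewrite unitmx_mul Zu unitmx_inv.
(* At [N' P0 = Z] the value of [b] is nonzero; were [b (N' U)] zero, the product formula for [w]
   would give [w (Z') b (Z) = 0]. *)
have bU : mev h (map_mx h N' *m U) b != 0.
  apply/eqP => b0'; have /eqP := spec (Z' *m invmx Z) N' w wchi.
  rewrite b0' mulr0 -mulmxA N'P0 mulmxKV // eq_sym mulf_eq0 !fmorph_eq0.
  by rewrite (negPf wZ') (negPf bZ).
exists (h (evalm (N' *m P0) b) / mev h (map_mx h N' *m U) b).
  by rewrite mulf_neq0 ?invr_eq0 // fmorph_eq0 N'P0.
move=> a N /(spec (N *m invmx N') N'); rewrite mulmxKV // => e.
by apply: (mulIf bU); rewrite e mulrAC divfK // mulrC.
Qed.

(* The determinants [det (f_i (N_j X))] are semi-invariants of [G] of the same weight, for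
   [f] a basis of the vanishing polynomials of bounded degree; conclude by Cramer's rule. *)
Lemma van_transport g : van G g -> exists e (f : 'I_e -> Pol) (a : 'I_e -> F) (H : 'M[L]_e),
  [/\ forall i, van G (f i), g = \sum_i a i *: f i, H \in unitmx
    & forall i, Rm U (map_mpoly h (f i)) = \sum_l H l i *: Rm (map_mx h P0) (map_mpoly h (f l))].
Proof.
move=> vg; pose d := \max_(m <- msupp g) mdeg m.
have [e [f [vf fd f_free f_span]]] := van_basis G d.
have [|a gE] := f_span g vg; first by move=> m mg; rewrite /d (big_rem m) //= leq_maxl.
have [N0 N0u] := separating_points F0 f_free.
have /choice[c cP] M : exists c : 'M[F]_e, G M -> forall i, Rm M (f i) = \sum_l c l i *: f l.
  have [GM|nG] := pselect (G M); last by exists 0.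
  have /choice[c cP] i : exists c, Rm M (f i) = \sum_l c l *: f l.
    by apply: f_span; [exact: van_Rm|exact: (Rm_deg (fd i))].
  by exists (\matrix_(l, i) c i l) => _ i; rewrite cP; apply: eq_bigr => l _; rewrite mxE.
pose wm (N : 'I_e -> 'M[F]_n) : 'M[Pol]_e := \matrix_(j, i) Lm (N j) (f i).
pose w N := \det (wm N); pose chi M := \det (c M).
have w_semi N : semiinv G (w N) chi.
  move=> M GM; rewrite /w -(det_map_mx (Rm M)).
  have -> : map_mx (Rm M) (wm N) = wm N *m map_mx (@mpolyC _ F) (c M).
    apply/matrixP => j i; rewrite !mxE /= Rm_Lm cP // (linear_sum (Lm (N j))); apply: eq_bigr => l _.
    by rewrite /= !mxE linearZ /= -mul_mpolyC mulrC.
  by rewrite det_mulmx det_map_mx mulrC mul_mpolyC.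
have w_ev N Z : evalm Z (w N) = \det (\matrix_(j, i) evalm (N j *m Z) (f i)).
  rewrite /w -(det_map_mx (evalm Z)); congr (\det _).
  by apply/matrixP => j i; rewrite !mxE /= evalm_Lm.
have w_evU N : mev h U (w N) = \det (\matrix_(j, i) mev h (map_mx h (N j) *m U) (f i)).
  rewrite /w -(det_map_mx (mev h U)); congr (\det _).
  by apply/matrixP => j i; rewrite !mxE /= mev_Lm.
have w0 : w N0 != 0.
  apply/eqP => /(congr1 (evalm 1%:M)); rewrite w_ev rmorph0 => /eqP.
  move: N0u; rewrite unitmxE unitfE => /negPf e0; rewrite (_ : \matrix_(j, i) _ = \matrix_(j, i) evalm (N0 j) (f i)) ?e0 //.
  by apply/matrixP => j i; rewrite !mxE mulmx1.
have [z z0 zP] := semiinv_spec w0 (w_semi N0).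
(* The factor [z] depends only on the weight [chi], which is the same for every choice of the
   matrices [N j]. *)
have key N : \det (\matrix_(j, i) mev h (map_mx h (N j) *m U) (f i)) =
    z * \det (\matrix_(j, i) h (evalm (N j *m P0) (f i))).
  have := zP (w N) 1%:M (w_semi N); rewrite map_mx1 !mul1mx w_evU w_ev => ->.
  by rewrite -det_map_mx; congr (_ * \det _); apply/matrixP => j i; rewrite !mxE.
pose N1 j := N0 j *m invmx P0.
pose FU := \matrix_(j, i) mev h (map_mx h (N1 j) *m U) (f i).
pose FP := \matrix_(j, i) h (evalm (N1 j *m P0) (f i)).
have FPu : FP \in unitmx.
  have -> : FP = map_mx h (\matrix_(j, i) evalm (N0 j) (f i)).
    by apply/matrixP => j i; rewrite !mxE /N1 mulmxKV.
  by rewrite map_unitmx.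
have dFU : \det FU = z * \det FP by exact: key.
have FUu : FU \in unitmx by rewrite unitmxE unitfE dFU mulf_neq0 // -unitfE -unitmxE.
exists e, f, a, (invmx FP *m FU); split=> // [|i].
  by rewrite unitmx_mul unitmx_inv FPu.
pose uN N := \row_i mev h (map_mx h N *m U) (f i).
pose pN N := \row_i h (evalm (N *m P0) (f i)).
(* Replacing row [j] of both matrices by the values at [N] keeps the ratio [z] of the
   determinants. *)
have adjE N : uN N *m \adj FU = z *: (pN N *m \adj FP).
  apply/rowP => j; rewrite [RHS]mxE !mul_row_adj.
  pose N2 i := if i == j then N else N1 i.
  have -> : set_row FU (uN N) j = \matrix_(l, i) mev h (map_mx h (N2 l) *m U) (f i).
    by apply/matrixP => l b; rewrite !mxE /N2; case: ifP.
  have -> : set_row FP (pN N) j = \matrix_(l, i) h (evalm (N2 l *m P0) (f i)).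
    by apply/matrixP => l b; rewrite !mxE /N2; case: ifP.
  exact: key.
have uE N : uN N = pN N *m (invmx FP *m FU).
  have dFP : \det FP != 0 by rewrite -unitfE -unitmxE.
  apply: (scalerI (mulf_neq0 z0 dFP)); rewrite -{1}dFU.
  rewrite -mul_mx_scalar -mul_adj_mx mulmxA adjE -scalemxAl -scalerA -mulmxA; congr (_ *: _).
  by rewrite /invmx FPu -scalemxAl -scalemxAr scalerA divff // scale1r.
apply: (mev_eq (h := h)) => [j|N].
  by rewrite (fmorph_pchar h); exact: F0.
rewrite mev_Rm map_mx_idfun mev_map_mpoly (rmorph_sum (mev idfun _)).
have /rowP/(_ i) := uE N; rewrite !mxE => e0.
transitivity (mev h (map_mx h N *m U) (f i)); first exact: eq_mev.
rewrite e0; apply: eq_bigr => l _; rewrite /= mevZ mev_Rm map_mx_idfun mev_map_mpoly mulrC !mxE.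
congr (_ * _); rewrite [LHS]rmorph_mev map_mxM; exact: eq_mev.
Qed.
End Specialization.

Section RationalConstants.
Variables (k : diffFieldType) (j : {rmorphism algC -> k}).
Hypothesis j_der : forall a, der (j a) = 0.

Definition rat_constant (x : rat) : constants k :=
  Constant (introT (constantP _) (j_der (ratr x))).

Lemma rat_constant_is_zmod_morphism : zmod_morphism rat_constant.
Proof. by move=> x y; apply: val_inj; rewrite /= [ratr _]rmorphB rmorphB. Qed.

Lemma rat_constant_is_monoid_morphism : monoid_morphism rat_constant.
Proof.
split=> [|x y]; apply: val_inj; first by rewrite /= [ratr _]rmorph1 rmorph1.
by rewrite /= [ratr _]rmorphM rmorphM.
Qed.

HB.instance Definition _ := GRing.isZmodMorphism.Build rat (constants k) rat_constant
  rat_constant_is_zmod_morphism.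
HB.instance Definition _ := GRing.isMonoidMorphism.Build rat (constants k) rat_constant
  rat_constant_is_monoid_morphism.
End RationalConstants.

Section DmevSums.
Variables (R S : comNzRingType) (h : {rmorphism R -> S}) (n : nat) (M : 'M[S]_n) (I : finType).

Lemma dmev_sum (B : 'M[S]_n) (a : I -> R) (f : I -> {mpoly R[n * n]}) :
  dmev h M B (\sum_i a i *: f i) = \sum_i h (a i) * dmev h M B (f i).
Proof.
apply: (big_ind2 (fun p y => dmev h M B p = y)) => [|p _ q _ <- <-|i _].
- by rewrite -(mpolyC0 _ R) dmevC.
- exact: dmevD.
exact: dmevZ.
Qed.

Lemma dmev_suml (a : I -> S) (B : I -> 'M[S]_n) f :
  dmev h M (\sum_i a i *: B i) f = \sum_i a i * dmev h M (B i) f.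
Proof.
have d0 : dmev h M 0 f = 0.
  by rewrite /dmev big1 // => i _; rewrite linear0 mxE mulr0.
apply: (big_ind2 (fun X y => dmev h M X f = y)) => [//|X _ Y _ <- <-|i _].
  by rewrite -[X]scale1r dmev_linear scale1r mul1r.
by rewrite -[_ *: B i]addr0 dmev_linear d0 addr0.
Qed.
End DmevSums.

(** * From constant invariants to a reduced form *)

Section ReducedForm.
Variables (k K : diffFieldType) (iK : {rmorphism k -> K}) (n : nat) (A : 'M[k]_n).
Hypothesis K_PV : is_Picard_Vessiot iK A.
Variable U : 'M[K]_n.
Hypothesis U_sol : solution_basis iK A U.
Local Notation C := (constants k).
Local Notation cK := (const_to_K iK).
Local Notation G := (Galois_group iK U).
Hypothesis C_closed : GRing.closed_field_axiom C.
Variable qF : {rmorphism rat -> C}.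
Hypothesis G_reductive : reductive G.
Hypothesis G_unimodular : Galois_unimodular iK A.
Hypothesis forms_constant : forall m (f : {mpoly k[n * n]}), f \is m.-homog ->
  map_mpoly der f = Dm A f -> map_mpoly der f = 0.
Let valC : {rmorphism C -> k} := val.
Let C0 : [pchar C] =i pred0 := pchar_ratr_morph qF.
Let k0 : [pchar k] =i pred0.
Proof. by move=> l; rewrite (fmorph_pchar (val : C -> k)); exact: C0. Qed.
Let Uu := U_unit K_PV U_sol.
Let G_group := Galois_subgroup K_PV U_sol.

Lemma Galois_det M : G M -> \det M = 1.
Proof.
move=> GM; have [U' [U'_sol det1]] := G_unimodular.
have [N U'E] := basis_change U_sol U'_sol.1.
have Nu : N \in unitmx.
  have := U_unit K_PV U'_sol; rewrite U'E unitmx_mul => /andP[_].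
  by rewrite map_unitmx.
have := det1 (invmx N *m M *m N); rewrite U'E => /(_ (Galois_conj Nu GM)).
by rewrite !det_mulmx mulrAC det_inv mulVf ?mul1r // -unitfE -unitmxE.
Qed.

(** The polynomials over the constants that vanish at [U] form a prime ideal not containing the
    determinant; [P0] is an invertible zero of it. Since [v (N X)] takes a constant value at [U],
    its difference with that constant lies in the ideal, hence vanishes at [P0]. *)
Lemma specialization : exists2 P0, P0 \in unitmx & forall v, (forall M, G M -> Rm M v = v) ->
  forall N, mev cK (map_mx cK N *m U) v = cK (evalm (N *m P0) v).
Proof.
have zero_prime : is_prime_ideal (fun y : K => y = 0).
  split=> [||x y /eqP]; last by rewrite mulf_eq0 => /orP[] /eqP ->; [left|right].
    by split=> // [x y -> ->|x y ->]; rewrite ?addr0 ?mulr0.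
  by apply/eqP; exact: oner_neq0.
have [|v [vQ vdet]] := prime_nullstellensatz C_closed C0 (b := detp C n)
    (comap_prime (mev cK U) zero_prime).
  by rewrite /= mev_detp; apply/eqP; rewrite -unitfE -unitmxE.
pose P0 := vec_mx (\row_i v i); exists P0.
  by move: vdet; rewrite -evalm_vec_mx [evalm _ _]mev_detp unitmxE unitfE.
move=> a aG N; have [w we] := invariant_constant K_PV U_sol C_closed k0 forms_constant aG.
have aw : mev cK (map_mx cK N *m U) a = cK (evalm N w).
  rewrite -mev_map_cK -we mev_Rm map_mx_idfun mev_map_mpoly.
  exact: eq_mev.
have := vQ (Lm N a - (evalm N w)%:MP).
rewrite rmorphB /= mev_Lm mevC aw subrr => /(_ erefl)/eqP.
by rewrite -evalm_vec_mx -/P0 evalmB evalm_Lm evalmC subr_eq0 => /eqP ->.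
Qed.

(* Both derivatives of [f_i (Y U) = \sum_l H l i * f_l (Y P0)] at [Y = P0^-1] vanish, the
   one of [K] and the one along [P0^-1 A]. *)
Lemma tangent_conj : exists2 P0, P0 \in unitmx & forall g, van G g ->
  dmev valC 1%:M (map_mx valC (invmx P0) *m A *m map_mx valC P0) g = 0.
Proof.
have [P0 P0u spec] := specialization; exists P0 => // g vg.
have obs := observable qF C_closed G_group Galois_det (Galois_closed K_PV U_sol) G_reductive.
have [e [f [a [H [vf -> Hu HE]]]]] := van_transport G_group C0 P0u spec (fun w chi => @obs w chi) vg.
set B := _ *m _ *m _.
suff f0 l : dmev cK 1%:M (map_mx iK B) (f l) = 0.
  apply: (fmorph_inj iK); rewrite rmorph0 (rmorph_dmev _ iK) map_mx1.
  have -> : dmev (iK \o valC) 1%:M (map_mx iK B) =1 dmev cK 1%:M (map_mx iK B).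
    by move=> p; apply: eq_dmev.
  by rewrite dmev_sum big1 // => l _; rewrite f0 mulr0.
pose Q := map_mx cK (invmx P0).
pose x := \col_l dmev cK 1%:M (map_mx iK B) (f l).
suff Hx : H^T *m x = 0.
  have := congr1 (mulmx (invmx H^T)) Hx; rewrite mulmx0 mulKmx ?unitmx_tr //.
  by move=> /colP/(_ l); rewrite !mxE.
apply/colP => i; rewrite !mxE.
have QP0 : Q *m map_mx cK P0 = 1%:M by rewrite -map_mxM mulVmx // map_mx1.
have QB : Q *m map_mx iK A *m map_mx cK P0 = map_mx iK B.
  by rewrite /B !map_mxM !map_iK_val.
have fQ : mev cK (Q *m U) (f i) = 0.
  transitivity (mev idfun Q (Rm U (map_mpoly cK (f i)))).
    by rewrite mev_Rm map_mx_idfun mev_map_mpoly; exact: eq_mev.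
  rewrite HE rmorph_sum big1 // => l' _; rewrite /= mevZ mev_Rm map_mx_idfun QP0.
  rewrite -(map_mx1 cK) mev_map_cK vf ?rmorph0 ?mulr0 //.
  exact: (subgroup_one G_group).
have dQ : map_mx der (Q *m U) = Q *m map_mx iK A *m U.
  rewrite -mulmxA -(U_system U_sol); apply/matrixP => a' b; rewrite !mxE raddf_sum.
  by apply: eq_bigr => l' _; rewrite /= !mxE derM (der_cK K_PV) mul0r add0r.
have dQ0 : dmev cK (Q *m U) (Q *m map_mx iK A *m U) (f i) = 0.
  have := mev_chain (h := cK) (d := GRing.null_fun C) (delta := @der K) (Q *m U) (f i) (@derM K).
  have f_0 : map_mpoly (GRing.null_fun C) (f i) = 0.
    by apply/mpolyP => m; rewrite mcoeff_map_mpoly mcoeff0.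
  rewrite fQ dQ raddf0 f_0 (rmorph0 (mev cK (Q *m U))) add0r => -> // c'.
  by rewrite [LHS](der_cK K_PV) [RHS](rmorph0 cK).
have := congr1 (dmev idfun Q (Q *m map_mx iK A)) (HE i).
rewrite dmev_Rm dmev_map_mpoly map_mx_idfun.
rewrite (@eq_dmev _ _ _ _ cK) // dQ0 dmev_sum => /esym e0.
rewrite -[RHS]e0; apply: eq_bigr => l' _; rewrite !mxE; congr (_ * _).
by rewrite dmev_Rm dmev_map_mpoly !map_mx_idfun QP0 QB; exact: eq_dmev.
Qed.

(** The coordinates of [P0^-1 A P0] along a family of [k] free over the constants are constant
    matrices; by freeness the tangency condition splits, so each lies in [Lie G]. Conjugation by
    [P0] gives the Lie algebra of the group in the basis [U P0^-1]. *)
Lemma reduced_form_of_constant_forms (kbar : closedFieldType) (ib : {rmorphism k -> kbar}) :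
  reduced_form iK A ib.
Proof.
have [P0 P0u tangent] := tangent_conj; set B := _ *m _ *m _ in tangent.
have P0Vu : invmx P0 \in unitmx by rewrite unitmx_inv.
exists (U *m map_mx cK (invmx P0)); split; first exact: solution_basis_conj.
have [c [cf cP]] := hfree_extend (h := valC) [seq B ij.1 ij.2 | ij : 'I_n * 'I_n]
  (c := [::]) (fun _ _ _ => fun lt => ltac:(done)).
rewrite /= in cf cP.
have /choice[a aP] ij : exists a, B ij.1 ij.2 = comb valC c a.
  by apply: cP; apply: (map_f (fun ij : 'I_n * 'I_n => B ij.1 ij.2)); rewrite mem_enum.
pose Bl l : 'M[C]_n := \matrix_(i, j) a (i, j) l.
have BE : B = \sum_(l < size c) c`_l *: map_mx valC (Bl l).
  apply/matrixP => i j; rewrite (aP (i, j)) summxE; apply: eq_bigr => l _.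
  by rewrite !mxE mulrC.
have BL l : (l < size c)%N -> Lie G (Bl l).
  move=> lc; apply/LieE => g vg.
  apply: (cf (fun l => devalm 1%:M (Bl l) g)) => //; rewrite -(tangent g vg) BE.
  rewrite dmev_suml; apply: eq_bigr => l' _; rewrite mulrC; congr (_ * _).
  rewrite [LHS](rmorph_dmev _ valC) map_mx1; exact: eq_dmev.
exists (size c), (fun l => P0 *m Bl l *m invmx P0), (fun l => ib c`_l); split=> [l|].
  apply/LieE => f vf.
  have : van G (Lm P0 (Rm (invmx P0) f)).
    move=> M /(Galois_conj P0Vu) GM; rewrite evalm_Lm evalm_Rm.
    by apply: vf; rewrite invmxK in GM.
  move=> /((LieE _ _).1 (BL l (ltn_ord l))); rewrite devalm_Lm devalm_Rm mulmx1 mulmxV //.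
have -> : A = map_mx valC P0 *m B *m map_mx valC (invmx P0).
  by rewrite /B !mulmxA -map_mxM mulmxV // map_mx1 mul1mx -mulmxA -map_mxM mulmxV // map_mx1 mulmx1.
rewrite BE mulmx_sumr mulmx_suml (raddf_sum (map_mx ib)); apply: eq_bigr => l _.
rewrite /= -scalemxAr -scalemxAl map_mxZ; congr (_ *: _).
by rewrite [RHS](map_mx_comp valC ib) !map_mxM.
Qed.
End ReducedForm.

Lemma Sym_invariant_form (k : diffFieldType) n m (A : 'M[k]_n) (phi : 'cV_(Sym_dim (\sum_(i < n) n) m)) :
  Sym_invariant A phi <-> map_mpoly der (form phi) = Dm A (form phi).
Proof.
rewrite Dm_form (map_form (@der k)); split=> [e|/form_inj //].
by congr form.
Qed.

Lemma constant_coefficients_form (k : diffFieldType) n m (phi : 'cV[k]_(Sym_dim (\sum_(i < n) n) m)) :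
  constant_coefficients phi <-> map_mpoly der (form phi) = 0.
Proof.
rewrite (map_form (@der k)); have f0 : form (0 : 'cV[k]_(Sym_dim (\sum_(i < n) n) m)) = 0.
  by rewrite formE big1 // => j _; rewrite mxE scale0r.
split=> [c|/esym]; rewrite -f0.
  by congr form; apply/colP => i; rewrite !mxE; apply/constantP; exact: c.
by move=> /form_inj/colP e i; have := e i; rewrite !mxE => e0; apply/constantP.
Qed.

Theorem theorem2 (k : diffFieldType)
    (k_fingen : finitely_generated_over_Qbar k)
    (C_closed : GRing.closed_field_axiom (constants k))
    (kbar : closedFieldType) (ib : {rmorphism k -> kbar})
    (ib_closure : is_algebraic_closure ib)
    (n : nat) (A : 'M[k]_n)
    (K : diffFieldType) (iK : {rmorphism k -> K})
    (K_PV : is_Picard_Vessiot iK A)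
    (G_reductive : Galois_reductive iK A)
    (G_unimodular : Galois_unimodular iK A) :
  reduced_form iK A ib <->
  forall (m : nat) (phi : 'cV[k]_(Sym_dim (\sum_(i < n) n) m)),
    Sym_invariant A phi -> constant_coefficients phi.
Proof.
have [j [j_der _]] := k_fingen; pose qF : {rmorphism rat -> constants k} := rat_constant j_der.
split=> [[U [U_sol AL]] m phi|H].
  move/Sym_invariant_form => phiA; apply/constant_coefficients_form.
  exact: (reduced_constant_forms K_PV U_sol (pchar_ratr_morph qF) AL).
have [U [U_sol G_red]] := G_reductive.
apply: (reduced_form_of_constant_forms K_PV U_sol C_closed qF G_red G_unimodular).
move=> m f /form_homog[phi ->] /Sym_invariant_form/H.
by move/constant_coefficients_form.
Qed.
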